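(* Let $a,b$ be tuples and $A$ an extension base. The following are equivalent: (1) $a\downarrow^{st}_A b$; (2) the set $\{a,b\}$ is strictly independent over $A$; (3) the sequence $\langle b,a\rangle$ is $\tfrac12$-strictly independent over $A$; (4) $b\downarrow^{st}_A a$.
   Context: $T$ is a complete first-order dependent (NIP) theory; we work in a monster model. $x\equiv_C y$ means equal types over $C$. $a\downarrow_A B$ means $\operatorname{tp}(a/AB)$ does not fork over $A$. $A$ is an extension base if no type over $A$ forks over $A$. Strict non-forking: $a\downarrow^{st}_A b$ means there is a global type $p\supseteq\operatorname{tp}(a/Ab)$ not forking over $A$ such that for every set $D\supseteq Ab$ and every $c\models p|_D$, $\operatorname{tp}(D/Ac)$ does not divide over $A$. A set $\{a_i:i<\lambda\}$ is strictly independent over $B$ if for every family $\{I_i:i<\lambda\}$ of $B$-indiscernible sequences with $I_i$ starting with $a_i$, there is a family $\{I'_i:i<\lambda\}$ with $I'_i\equiv_{Ba_i} I_i$ for all $i$ and each $I'_i$ indiscernible over $B\cup\bigcup_{j\neq i}I'_j$. A sequence $\langle a_i:i<\lambda\rangle$ is $\tfrac12$-strictly independent over $B$ if for every family $\{I_i:i<\lambda\}$ of $B$-indiscernible sequences with $I_i$ starting with $a_i$, there is $\{I'_i:i<\lambda\}$ with $I'_i\equiv_{Ba_i}I_i$ and each $I'_i$ indiscernible over $B\cup\bigcup_{j<i}I'_j\cup\{a_j:j>i\}$. *)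

(* Defs.v *)
From HB Require Import structures.
From mathcomp Require Import all_boot all_order.
From mathcomp Require Import boolp classical_sets functions cardinality.

Set Implicit Arguments.
Unset Strict Implicit.
Unset Printing Implicit Defensive.

Import Order.TTheory.
Local Open Scope order_scope.
Local Open Scope classical_set_scope.
Local Open Scope card_scope.

(** * First-order logic *)

Record language : Type := Language {
  func : Type;
  farity : func -> nat;
  relsym : Type;
  rarity : relsym -> nat }.

(* Free variables are the elements of an arbitrary type [V], so that formulas
   can have infinite tuples of variables, and so that parameters are just
   variables with an intended value. *)
Inductive term (L : language) (V : Type) : Type :=
| Var of V
| App (f : func L) of ('I_(farity f) -> term L V).

(* [All] binds [None]. *)
Inductive formula (L : language) (V : Type) : Type :=
| Bot
| Eq of term L V & term L V
| Rel (r : relsym L) of ('I_(rarity r) -> term L V)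
| Imp of formula L V & formula L V
| All of formula L (option V).

Definition Not (L : language) (V : Type) (phi : formula L V) : formula L V :=
  Imp phi (Bot L V).

Definition sentence (L : language) : Type := formula L void.

Fixpoint tmap (L : language) (V W : Type) (f : V -> W) (t : term L V) :
    term L W :=
  match t with
  | Var x => Var L (f x)
  | App g ts => @App L W g (fun k => tmap f (ts k))
  end.

Fixpoint fmap (L : language) (V W : Type) (f : V -> W) (phi : formula L V) :
    formula L W :=
  match phi with
  | Bot => Bot L W
  | Eq t u => Eq (tmap f t) (tmap f u)
  | Rel r ts => @Rel L W r (fun k => tmap f (ts k))
  | Imp phi1 phi2 => Imp (fmap f phi1) (fmap f phi2)
  | All phi1 => All (fmap (omap f) phi1)
  end.

Record structure (L : language) : Type := Structure {
  dom :> Type;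
  dom_inhabited : inhabited dom;
  fint : forall f : func L, ('I_(farity f) -> dom) -> dom;
  rint : forall r : relsym L, ('I_(rarity r) -> dom) -> Prop }.

Fixpoint teval (L : language) (M : structure L) (V : Type) (v : V -> M)
    (t : term L V) : M :=
  match t with
  | Var x => v x
  | App f ts => @fint L M f (fun k => teval v (ts k))
  end.

Fixpoint holds (L : language) (M : structure L) (V : Type) (phi : formula L V)
    (v : V -> M) : Prop :=
  match phi with
  | Bot => False
  | Eq t u => teval v t = teval v u
  | Rel r ts => @rint L M r (fun k => teval v (ts k))
  | Imp phi1 phi2 => holds phi1 v -> holds phi2 v
  | All phi1 =>
      forall x : M, holds phi1 (fun o => if o is Some y then v y else x)
  end.

(** * Theories *)

Definition models (L : language) (M : structure L) (phi : sentence L) : Prop :=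
  holds phi (of_void M).

Definition is_model (L : language) (T : set (sentence L)) (M : structure L) :
    Prop :=
  forall phi, T phi -> models M phi.

Definition entails (L : language) (T : set (sentence L)) (phi : sentence L) :
    Prop :=
  forall M : structure L, is_model T M -> models M phi.

Definition complete_theory (L : language) (T : set (sentence L)) : Prop :=
  (exists M : structure L, is_model T M) /\
  forall phi, entails T phi \/ entails T (Not phi).

Definition has_IP (L : language) (N : structure L) (m n : nat)
    (phi : formula L ('I_m + 'I_n)) : Prop :=
  exists (a : nat -> 'I_m -> N) (b : set nat -> 'I_n -> N),
    forall (k : nat) (S : set nat),
      holds phi (fun z => match z with inl x => a k x | inr y => b S y end)
      <-> S k.

Definition dependent (L : language) (T : set (sentence L)) : Prop :=
  forall N : structure L, is_model T N ->
  forall (m n : nat) (phi : formula L ('I_m + 'I_n)), ~ has_IP N phi.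

(** * Types *)

Section Types.
Context {L : language} {M : structure L}.

(* L(M)-formulas in the variables (x_i)_{i : I}; the variable [inr m] stands
   for the parameter [m]. *)
Definition Mformula (I : Type) : Type := formula L (I + M).

Definition sat (I : Type) (c : I -> M) (phi : Mformula I) : Prop :=
  holds phi (fun z => match z with inl i => c i | inr m => m end).

(* [subst_params psi b] is psi(x, b), for psi(x, y) without parameters. *)
Definition subst_params (I J : Type) (psi : formula L (I + J)) (b : J -> M) :
    Mformula I :=
  fmap (fun z => match z with inl i => inl i | inr j => inr (b j) end) psi.

Definition over (I : Type) (B : set M) : set (Mformula I) :=
  range (fun psi : formula L (I + B) => subst_params psi val).

Definition tp (I : Type) (a : I -> M) (B : set M) : set (Mformula I) :=
  [set phi | over B phi /\ sat a phi].

Definition realizes (I : Type) (c : I -> M) (p : set (Mformula I)) : Prop :=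
  forall phi, p phi -> sat c phi.

(* Finitely satisfiable in M, i.e. consistent with the elementary diagram. *)
Definition consistent (I : Type) (p : set (Mformula I)) : Prop :=
  forall q, finite_set q -> q `<=` p -> exists c : I -> M, realizes c q.

Definition type_over (I : Type) (B : set M) (p : set (Mformula I)) : Prop :=
  p `<=` over B /\ consistent p.

Definition global_type (I : Type) (p : set (Mformula I)) : Prop :=
  consistent p /\ forall phi, p phi \/ p (Not phi).

(* p |- \/ F *)
Definition proves_disj (I : Type) (p F : set (Mformula I)) : Prop :=
  exists q, [/\ finite_set q, q `<=` p &
    forall c : I -> M, realizes c q -> exists2 phi, F phi & sat c phi].

Definition equiv_over (I : Type) (C : set M) (a a' : I -> M) : Prop :=
  tp a C = tp a' C.

(** * The monster model *)

Definition automorphism (s : M -> M) : Prop :=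
  [/\ bijective s,
      forall (f : func L) (x : 'I_(farity f) -> M),
        s (fint x) = fint (fun k => s (x k)) &
      forall (r : relsym L) (x : 'I_(rarity r) -> M),
        rint x <-> rint (fun k => s (x k))].

(* |S| < |kappa|; any two cardinals are comparable. *)
Definition small (kappa X : Type) (S : set X) : Prop :=
  ~ ([set: kappa] #<= S).

Definition saturated (kappa : Type) : Prop :=
  forall (B : set M) (p : set (Mformula unit)),
    small kappa B -> type_over B p -> exists c, realizes c p.

Definition strongly_homogeneous (kappa : Type) : Prop :=
  forall (I : Type) (a a' : I -> M), small kappa [set: I] ->
    equiv_over set0 a a' ->
    exists2 s, automorphism s & forall i, s (a i) = a' i.

(** * Indiscernible sequences *)

(* The concatenation of the tuples of the sequence. *)
Definition concat (O I : Type) (s : O -> I -> M) (z : O * I) : M := s z.1 z.2.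

Definition indiscernible d (O : orderType d) (I : Type) (B : set M)
    (s : O -> I -> M) : Prop :=
  forall (n : nat) (u v : 'I_n -> O),
    (forall k l : 'I_n, (k < l)%N -> u k < u l) ->
    (forall k l : 'I_n, (k < l)%N -> v k < v l) ->
    equiv_over B (concat (fun k => s (u k))) (concat (fun k => s (v k))).

(** * Dividing and forking *)

Definition divides (I : Type) (A : set M) (phi : Mformula I) : Prop :=
  exists (n : nat) (psi : formula L (I + 'I_n)) (b : nat -> 'I_n -> M),
    [/\ phi = subst_params psi (b 0%N),
        indiscernible A b &
        ~ consistent (range (fun k => subst_params psi (b k)))].

Definition type_divides (I : Type) (A : set M) (p : set (Mformula I)) : Prop :=
  exists2 phi, divides A phi & proves_disj p [set phi].

Definition type_forks (I : Type) (A : set M) (p : set (Mformula I)) : Prop :=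
  exists F, [/\ finite_set F, F `<=` divides A & proves_disj p F].

Definition extension_base (kappa : Type) (A : set M) : Prop :=
  forall (I : Type) (p : set (Mformula I)), small kappa [set: I] ->
    type_over A p -> ~ type_forks A p.

Definition strict_nonforking (kappa : Type) (I J : Type) (A : set M)
    (a : I -> M) (b : J -> M) : Prop :=
  exists p : set (Mformula I),
    [/\ global_type p, tp a (A `|` range b) `<=` p, ~ type_forks A p &
      forall D : set M, small kappa D -> A `|` range b `<=` D ->
      forall c : I -> M, realizes c (p `&` over D) ->
        ~ type_divides A (tp (val : D -> M) (A `|` range c))].

(** * Strict independence *)

Record mtuple : Type := MTuple { tidx : Type; tval :> tidx -> M }.

Definition pair_family (a b : mtuple) (i : bool) : mtuple :=
  if i then b else a.

Section Independence.
Variables (kappa : Type) (B : set M).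

(* A family of sequences of tuples, the i-th one being a B-indiscernible
   infinite sequence starting with [a i]. *)
Definition indiscernible_family (X : Type) (a : X -> mtuple) d
    (O : X -> bOrderType d) (s : forall i, O i -> tidx (a i) -> M) : Prop :=
  forall i, [/\ infinite_set [set: O i], small kappa [set: O i],
                indiscernible B (s i) & s i \bot = a i].

(* The union is over indices: in a family such as (a, a) both occurrences
   count. *)
Definition strictly_independent (X : Type) (a : X -> mtuple) : Prop :=
  forall d (O : X -> bOrderType d) (s : forall i, O i -> tidx (a i) -> M),
    indiscernible_family s ->
    exists s' : forall i, O i -> tidx (a i) -> M,
      (forall i,
        equiv_over (B `|` range (a i)) (concat (s' i)) (concat (s i))) /\
      (forall i, indiscernible
        (B `|` \bigcup_(j in [set j | j <> i]) range (concat (s' j))) (s' i)).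

Definition half_strictly_independent dX (X : orderType dX) (a : X -> mtuple) :
    Prop :=
  forall d (O : X -> bOrderType d) (s : forall i, O i -> tidx (a i) -> M),
    indiscernible_family s ->
    exists s' : forall i, O i -> tidx (a i) -> M,
      (forall i,
        equiv_over (B `|` range (a i)) (concat (s' i)) (concat (s i))) /\
      (forall i, indiscernible
        (B `|` \bigcup_(j in [set j | j < i]) range (concat (s' j))
           `|` \bigcup_(j in [set j | i < j]) range (a j)) (s' i)).

End Independence.
End Types.

Arguments saturated {L} M kappa.
Arguments strongly_homogeneous {L} M kappa.

(* [kappa] is an uncountable strong limit cardinal greater than the number of
   symbols of the language. *)
Record monster (L : language) (T : set (sentence L)) (kappa : Type)
    (M : structure L) : Prop := Monster {
  monster_uncountable : small kappa [set: nat];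
  monster_strong_limit : forall X : set kappa,
    small kappa X -> small kappa [set Y : set kappa | Y `<=` X];
  monster_language : small kappa [set: func L + relsym L];
  monster_model : is_model T M;
  monster_saturated : saturated M kappa;
  monster_homogeneous : strongly_homogeneous M kappa }.

(* Main.v *)
(** Global types are ultrafilters. By NIP, a global type that does not fork over A
    does not split along A-indiscernible sequences.

    If a is strictly non-forking from b over A, let J be an A-indiscernible
    sequence starting with b and c a realization over AJ of the global type. Then
    J is indiscernible over Ac, and since tp(J/Ac) does not divide over A, every
    A-indiscernible sequence starting with c has a conjugate over Ac that is
    indiscernible over AJ. Extracting from J an indiscernible sequence over the
    latter makes the two sequences mutually indiscernible.

    The converse needs, for finitely many formulas dividing over A with parameters
    in d, a single A-indiscernible sequence starting with d that witnesses all of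
    these dividings. It is obtained as for the theorem of Chernikov and Kaplan that
    forking equals dividing. A formula that forks over A has finitely many
    conjugates over A with inconsistent conjunction: choosing copies of the
    witnesses independent from each other gives a base N over which each dividing is
    witnessed by Morley sequences of a coheir, all these coheirs having the same
    restriction to N, and the broom argument eliminates the dividing formulas one
    by one. Hence tp(d/A) has a strictly non-forking global extension, and its Morley
    sequences, together with suitable rows, form an array to which NIP applies.

    Now suppose that <b, a> is half-strictly independent and that tp(b/Aa) has no
    strictly non-forking extension: some formula of tp(b/Aa) implies a disjunction
    of formulas phi_i(x, d) dividing over A and psi_j(e_j, x) with psi_j(y, b)
    dividing over A. Apply the hypothesis to a witness (b_m) for the psi_j(y, b) and
    to the projection to a of a witness (a, d, e)_l for the phi_i. The formula then
    holds for all b_m and a_l. For each l only finitely many b_m satisfy some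
    psi_j(e_l, x), so that some element satisfies, for every l, one of the
    phi_i(x, d_l), and hence one of them for infinitely many l: a contradiction. *)

Require Import Defs.
From mathcomp Require Import all_boot all_order zify.
From mathcomp Require Import boolp classical_sets functions cardinality filter.
From Stdlib Require List.
Import Defs.

Set Implicit Arguments.
Unset Strict Implicit.
Unset Printing Implicit Defensive.

Import Order.TTheory.
Local Open Scope classical_set_scope.

(** * Small sets *)

Section SmallSets.
Local Open Scope card_scope.

(** Half-independence returns one sequence per tuple, whereas a failure of strictness involves
    finitely many dividing formulas whose witnesses are unrelated; this is why one sequence has to
    witness them all at once. It must consist of tuples extending [a]: half-independence only moves
    the projections to [a], and an automorphism carries the remaining coordinates along. Strictness
    quantifies over all small sets D and all realizations c, yet it is finitary. As c has the type
    of b over A, Y(y, c) divides over A exactly when Y(y, b) does, so the condition excludes from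
    the type each Y(e, x) with Y(y, b) dividing. A type over A need not have a coheir. This forces
    the detour through N, but the resulting statement about conjugates over A no longer mentions N.
    Sequences indexed by the natural numbers carry the proof; the arbitrary orders of the
    definitions are reached by stretching once mutual indiscernibility is established. The passage
    from (4) to (1) is that from (1) to (4) with a and b exchanged. *)

Lemma card_le_injP (T U : Type) (A : set T) (B : set U) :
  A #<= B <-> exists f : A -> B, injective f.
Proof.
split=> [/card_leP[f]|[f injf]].
  exists (fun t => f t) => t t' /(inj (f:=f)) e.
  by apply: e; exact: mem_set.
apply/card_leP/injfunPex; exists f => // x y _ _; exact: injf.
Qed.

(** A maximal partial bijection, given by Zorn's lemma as a graph, is total on one side: otherwise a
    pair of missing points could be added. *)
Lemma card_comparable (T U : Type) :
  (exists f : T -> U, injective f) \/ (exists f : U -> T, injective f).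
Proof.
pose P (G : set (T * U)) := forall p q, G p -> G q ->
  (p.1 = q.1 -> p.2 = q.2) /\ (p.2 = q.2 -> p.1 = q.1).
have [F FP Ftot|G [PG maxG]] := @Zorn_bigcup _ P.
  move=> p q [X FX Xp] [Y FY Yq].
  have [XY|YX] := Ftot _ _ FX FY.
    by apply: (FP _ FY) => //; exact: XY.
  by apply: (FP _ FX) => //; exact: YX.
have [Tot|/existsNP nTot] := pselect (forall x, exists y, G (x, y)).
  left; have [f fP] := choice Tot; exists f => x x' e.
  by have [_ /(_ e)] := PG _ _ (fP x) (fP x').
have [x nx] := nTot.
have [Tot|/existsNP nTot'] := pselect (forall y, exists x, G (x, y)).
  right; have [f fP] := choice Tot; exists f => y y' e.
  by have [/(_ e)] := PG _ _ (fP y) (fP y').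
have [y ny] := nTot'.
case: (maxG (G `|` [set (x, y)])).
  split; first by move=> p Gp; left.
  by move=> GG; apply: nx; exists y; apply: GG; right.
move=> p q [Gp|->] [Gq|->] //=; first exact: PG.
  by split=> e; [case: nx; exists p.2|case: ny; exists p.1];
    rewrite -e -surjective_pairing.
by split=> e; [case: nx; exists q.2|case: ny; exists q.1];
  rewrite e -surjective_pairing.
Qed.

Variable kappa : Type.

Definition small_type (X : Type) : Prop := ~ exists f : kappa -> X, injective f.

Lemma small_setE X (S : set X) : small kappa S <-> small_type S.
Proof.
rewrite /small /small_type; split=> h.
  move=> [f injf]; apply: h; apply/card_le_injP; exists (fun k => f (val k)).
  by move=> k k' /injf /val_inj.
move=> /card_le_injP [f injf]; apply: h;
  exists (fun k : kappa => f (SigSub (mem_set I : k \in setT))).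
by move=> k k' /injf /(congr1 val).
Qed.

Lemma small_type_inj X Y (f : X -> Y) : injective f -> small_type Y ->
  small_type X.
Proof. by move=> injf + [g injg] => h; apply: h; exists (f \o g);
  exact: inj_comp. Qed.

Lemma smallTE X : small kappa [set: X] <-> small_type X.
Proof.
rewrite small_setE; split; last exact: (small_type_inj val_inj).
apply: (small_type_inj (f := fun x : X => SigSub (mem_set I : x \in setT))).
by move=> x y /(congr1 val).
Qed.

Lemma small_type_surj X Y (f : X -> Y) : (forall y, exists x, f x = y) ->
  small_type X -> small_type Y.
Proof.
move=> /choice[g fg]; apply: (small_type_inj (f := g)).
exact: can_inj fg.
Qed.

Lemma small_range X Y (f : X -> Y) : small_type X -> small kappa (range f).
Proof.
move=> smX; apply/small_setE.
apply: (small_type_surj (f := fun x =>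
  SigSub (mem_set (imageT f x)) : range f)) smX.
by move=> [y yP]; have [x _ fx] := set_mem yP; exists x; apply: val_inj.
Qed.

Lemma small_sub X (A B : set X) : A `<=` B -> small kappa B -> small kappa A.
Proof.
move=> AB /small_setE smB; apply/small_setE; move: smB.
apply: (small_type_inj (f := fun x : A =>
  SigSub (mem_set (AB _ (set_mem (valP x)))) : B)).
by move=> x y /(congr1 val) /= /val_inj.
Qed.

Hypothesis kappa_nat : small kappa [set: nat].
Hypothesis kappa_pow : forall X : set kappa,
  small kappa X -> small kappa [set Y : set kappa | Y `<=` X].

Lemma small_nat : small_type nat. Proof. exact/smallTE. Qed.

Lemma small_countType (X : countType) : small_type X.
Proof. exact: (small_type_inj (pcan_inj (@pickleK X)) small_nat). Qed.

(** Since [kappa] does not embed in X, X embeds in [kappa], where the strong limit hypothesis speaks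
    of subsets. *)
Lemma small_pow X : small_type X -> small_type (set X).
Proof.
move=> smX; have [//|[f injf]] := card_comparable kappa X.
have /kappa_pow/small_setE : small kappa (range f) by exact: small_range.
have fP (S : set X) : f @` S \in [set Y : set kappa | Y `<=` range f].
  by apply/mem_set => _ [x _ <-]; exists x.
apply: (small_type_inj (f := fun S => SigSub (fP S))) =>
  S S' /(congr1 val) /= e.
apply/seteqP; split=> x Sx.
  have : (f @` S) (f x) by exists x.
  by rewrite e => -[x' ? /injf <-].
have : (f @` S') (f x) by exists x.
by rewrite -e => -[x' ? /injf <-].
Qed.

(** Kuratowski pairs embed the square into the double power set, where [small_pow] applies twice. *)
Lemma small_square X : small_type X -> small_type (X * X).
Proof.
move=> /small_pow/small_pow.
apply: (small_type_inj (f := fun p => [set [set p.1]; [set p.1; p.2]])).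
move=> [x y] [x' y'] /= /seteqP[h h'].
have ex : x = x'.
  have /= [e|e] := h _ (or_introl erefl).
    have : [set x'] x by rewrite -e.
    by [].
  have : [set x] x' by rewrite e; left.
  by [].
rewrite -ex in h h' *; congr pair.
have /= [e|e] := h _ (or_intror erefl).
  have ey : y = x by have : [set x] y by rewrite -e; right.
  rewrite ey in h' *; have /= [e'|e'] := h' _ (or_intror erefl).
    by have -> : [set x] y' by rewrite -e'; right.
  by have [->|->] : [set x; x] y' by rewrite -e'; right.
have : [set x; y'] y by rewrite -e; right.
case=> // ey; have : [set x; y] y' by rewrite e; right.
by case=> // ->.
Qed.

Lemma small_prod X Y : small_type X -> small_type Y -> small_type (X * Y).
Proof.
have [[f injf] _|[f injf] +  _] := card_comparable X Y => /small_square.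
  apply: (small_type_inj (f := fun p : X * Y => (f p.1, p.2))).
  by move=> [x y] [x' y'] [/injf -> ->].
apply: (small_type_inj (f := fun p : X * Y => (p.1, f p.2))).
by move=> [x y] [x' y'] [-> /injf ->].
Qed.

Lemma small_sum X Y : small_type X -> small_type Y -> small_type (X + Y).
Proof.
have smb := @small_countType bool.
have [[f injf] _ smY|[f injf] smX  _] := card_comparable X Y.
  apply: (small_type_inj (f := fun z : X + Y => match z with
    inl x => (true, f x) | inr y => (false, y) end) _ (small_prod smb smY)).
  by move=> [x|y] [x'|y'] //= []; [move=> /injf ->|move=> ->].
apply: (small_type_inj (f := fun z : X + Y => match z with
  inl x => (true, x) | inr y => (false, f y) end) _ (small_prod smb smX)).
by move=> [x|y] [x'|y'] //= []; [move=> ->|move=> /injf ->].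
Qed.

Lemma small_setU X (A B : set X) : small kappa A -> small kappa B ->
  small kappa (A `|` B).
Proof.
move=> /small_setE sA /small_setE sB.
have := @small_range (A + B) X
  (fun z => match z with inl a => val a | inr b => val b end) (small_sum sA sB).
apply: small_sub => x [Ax|Bx].
  by exists (inl (SigSub (mem_set Ax))).
by exists (inr (SigSub (mem_set Bx))).
Qed.

End SmallSets.

(** * Formulas and definable sets *)

Section Syntax.
Context {L : language}.

Lemma teval_tmap (M : structure L) V W (f : V -> W) (t : term L V)
    (v : W -> M) : teval v (tmap f t) = teval (v \o f) t.
Proof. by elim: t => //= g ts IH; congr fint; apply/funext => k; exact: IH. Qed.

Lemma holds_fmap (M : structure L) V W (f : V -> W) (phi : formula L V)
    (v : W -> M) : holds (fmap f phi) v <-> holds phi (v \o f).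
Proof.
elim: phi W f v => //= [{}V t u|{}V r ts|{}V p1 IH1 p2 IH2|{}V p IH] W f v.
- by rewrite !teval_tmap.
- by under [X in rint X]eq_fun do rewrite teval_tmap.
- by rewrite IH1 IH2.
- split=> h x; have := h x; rewrite IH; congr holds; apply/funext.
    by case.
  by case.
Qed.

Lemma tmap_comp V W U (g : W -> U) (f : V -> W) (t : term L V) :
  tmap g (tmap f t) = tmap (g \o f) t.
Proof. by elim: t => //= h ts IH; congr App; apply/funext => k; exact: IH. Qed.

Lemma fmap_comp V W U (g : W -> U) (f : V -> W) (phi : formula L V) :
  fmap g (fmap f phi) = fmap (g \o f) phi.
Proof.
elim: phi W U g f => //= [{}V t u|{}V r ts|{}V p1 IH1 p2 IH2|{}V p IH] W U g f.
- by rewrite !tmap_comp.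
- by congr Rel; apply/funext => k; rewrite tmap_comp.
- by rewrite IH1 IH2.
- by rewrite IH; congr (All (fmap _ _)); apply/funext => -[].
Qed.

Lemma term_fin V (t : term L V) :
  exists (W : finType) (u : W -> V) t', t = tmap u t'.
Proof.
elim: t => [x|f ts IH].
  by exists unit, (fun _ => x), (Var L tt).
have [g gP] : exists g : forall k, {W : finType & ((W -> V) * term L W)%type},
    forall k, ts k = tmap (projT2 (g k)).1 (projT2 (g k)).2.
  suff /choice[g gP] : forall k, exists z : {W : finType & ((W ->
    V) * term L W)%type},
      ts k = tmap (projT2 z).1 (projT2 z).2 by exists g.
  by move=> k; have [W [u [t' e]]] := IH k; exists (existT _ W (u, t')).
exists {k : 'I_(farity f) & projT1 (g k)},
  (fun z => (projT2 (g (tag z))).1 (tagged z)),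
  (App (fun k => tmap (fun w => Tagged (fun k =>
    projT1 (g k)) w) (projT2 (g k)).2)).
by rewrite /=; congr App; apply/funext => k; rewrite tmap_comp -gP.
Qed.

(** Variables range over arbitrary types, so the finiteness behind every compactness argument has to
    be recovered here. The naming [u] need not be injective. *)
Lemma formula_fin V (phi : formula L V) :
  exists (W : finType) (u : W -> V) phi', phi = fmap u phi'.
Proof.
elim: phi => {V} [V|V t1 t2|V r ts|V p1 [W1 [u1 [q1 ->]]] p2 [W2 [u2 [q2 ->]]]|
    V p [W [u [q ->]]]].
- by exists void, (of_void V), (Bot L void).
- have [W1 [u1 [s1 ->]]] := term_fin t1; have [W2 [u2 [s2 ->]]] := term_fin t2.
  exists (W1 + W2)%type, (fun z => match z with inl w => u1 w | inr w =>
    u2 w end),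
    (Eq (tmap inl s1) (tmap inr s2)).
  by rewrite /= !tmap_comp.
- have [g gP] : exists g : forall k, {W : finType & ((W -> V) * term L W)%type},
      forall k, ts k = tmap (projT2 (g k)).1 (projT2 (g k)).2.
    suff /choice[g gP] : forall k,
        exists z : {W : finType & ((W -> V) * term L W)%type},
        ts k = tmap (projT2 z).1 (projT2 z).2 by exists g.
    by move=> k; have [W [u [t' e]]] := term_fin (ts k);
      exists (existT _ W (u, t')).
  exists {k : 'I_(rarity r) & projT1 (g k)},
    (fun z => (projT2 (g (tag z))).1 (tagged z)),
    (Rel (fun k => tmap (fun w => Tagged (fun k =>
      projT1 (g k)) w) (projT2 (g k)).2)).
  by rewrite /=; congr Rel; apply/funext => k; rewrite tmap_comp -gP.
- exists (W1 + W2)%type, (fun z => match z with inl w => u1 w | inr w =>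
    u2 w end),
    (Imp (fmap inl q1) (fmap inr q2)).
  by rewrite /= !fmap_comp.
(* The names that [u] sends to [None] denote the bound variable; [insub] sends exactly these to
   [None], and the others stay free. *)
- pose W' : finType := {k : W | isSome (u k)}.
  have /choice[u' u'P] : forall k : W', exists v, u (val k) = Some v.
    by move=> [k]; rewrite /=; case: (u k) => // v _; exists v.
  exists W', u', (All (fmap (insub : W -> option W') q)).
  rewrite /= fmap_comp; congr (All (fmap _ _)); apply/funext => k /=.
  by case: insubP => [k' _ <-|]; rewrite /= ?u'P //; case: (u k).
Qed.

End Syntax.

Section Definable.
Context {L : language} {M : structure L}.

Definition vcat (I J : Type) (c : I -> M) (d : J -> M) (z : I + J) : M :=
  match z with inl i => c i | inr j => d j end.

(** Sets of tuples take the place of formulas: equivalent formulas are identified, and a change of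
    variables becomes a preimage. *)
Definition definable (B : set M) (V : Type) (X : set (V -> M)) : Prop :=
  exists psi : formula L (V + B), forall v, X v <-> holds psi (vcat v val).

(** Substitutions are recognized by their effect on tuples, so that [definable_subst] covers
    renaming, merging and specializing variables at once. *)
Definition substitution_over (B : set M) V V' (f : (V' -> M) -> V -> M) :=
  forall v, (exists v', forall w, f w v = w v') \/
            (exists2 m, B m & forall w, f w v = m).

Lemma definable_subst (B B' : set M) V V' (X : set (V -> M))
    (f : (V' -> M) -> V -> M) :
  B `<=` B' -> substitution_over B' f -> definable B X ->
    definable B' [set w | X (f w)].
Proof.
move=> BB' fP [psi psiP].
have /choice[g gP] : forall z : V + B, exists z' : V' + B',
    forall w, vcat (f w) val z = vcat w val z'.
  move=> [v|b] /=; last first.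
    by exists (inr (SigSub (mem_set (BB' _ (set_mem (valP b)))))).
  have [[v' e]|[m Bm e]] := fP v; first by exists (inl v').
  by exists (inr (SigSub (mem_set Bm))).
exists (fmap g psi) => w; rewrite holds_fmap /= psiP.
by rewrite (_ : vcat w val \o g = vcat (f w) val) //; apply/funext => z /=.
Qed.

Lemma definableW (B B' : set M) V (X : set (V -> M)) : B `<=` B' ->
  definable B X -> definable B' X.
Proof. by move=> BB'; apply: definable_subst BB' _ => v; left; exists v. Qed.

Lemma definable_pre (B : set M) V V' (X : set (V -> M)) (f : V -> V') :
  definable B X -> definable B [set w : V' -> M | X (w \o f)].
Proof. by apply: definable_subst => // v; left; exists (f v). Qed.

Lemma definable_ext (B : set M) V (X X' : set (V -> M)) :
  (forall v, X v <-> X' v) -> definable B X -> definable B X'.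
Proof. by move=> e [psi h]; exists psi => v; rewrite -e. Qed.

Lemma definableT (B : set M) V : definable B (@setT (V -> M)).
Proof. by exists (Not (Bot _ _)) => v; split=> // _ []. Qed.

Lemma definableN (B : set M) V (X : set (V -> M)) : definable B X ->
  definable B (~` X).
Proof. by move=> [psi h]; exists (Not psi) => v /=; rewrite -h. Qed.

Lemma definableimp (B : set M) V (X Y : set (V -> M)) : definable B X ->
  definable B Y ->
  definable B [set v | X v -> Y v].
Proof. by move=> [p hp] [q hq]; exists (Imp p q) => v /=; rewrite -hp -hq. Qed.

Lemma definableI (B : set M) V (X Y : set (V -> M)) : definable B X ->
  definable B Y ->
  definable B (X `&` Y).
Proof.
move=> dX dY; apply: definable_ext (definableN (definableimp dX (definableN
  dY))) => v.
split=> [h|[Xv Yv] h]; last exact: h.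
by split; apply: contrapT => h'; apply: h => // ?; exact: h'.
Qed.

Lemma definableU (B : set M) V (X Y : set (V -> M)) : definable B X ->
  definable B Y ->
  definable B (X `|` Y).
Proof.
move=> dX dY; apply: definable_ext (definableN (definableI (definableN dX)
  (definableN dY))) => v.
split=> [h|[Xv|Yv] []//].
have [Xv|nX] := pselect (X v); [by left|right].
by apply: contrapT => nY; apply: h.
Qed.

Lemma definable_fin_support (B : set M) V (X : set (V -> M)) : definable B X ->
  exists (W : finType) (u : W -> V) (Y : set (W -> M)),
    definable B Y /\ forall v, X v <-> Y (v \o u).
Proof.
move=> [psi psiP]; have [W [u [phi e]]] := formula_fin psi.
pose isl w := if u w is inl _ then true else false.
pose W' : finType := {w : W | isl w}.
have /choice[u' u'P] : forall w : W', exists v, u (val w) = inl v.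
  by move=> [w] /=; rewrite /isl; case: (u w) => // v _; exists v.
have /choice[g gP] : forall w : W, exists z : W' + B, forall v,
    vcat v val (u w) = vcat (v \o u') val z.
  move=> w; case E: (u w) => [v|b]; last by exists (inr b).
  have h : isl w by rewrite /isl E.
  exists (inl (exist _ w h)) => v' /=.
  by have /= := u'P (exist _ w h); rewrite E => -[->].
exists W', u', [set z : W' -> M | holds (fmap g phi) (vcat z val)]; split.
  by exists (fmap g phi).
move=> v; rewrite psiP e /= !holds_fmap.
by rewrite (_ : vcat v val \o u = vcat (v \o u') val \o g) //;
  apply/funext => w /=.
Qed.

Lemma definable_ex_option (B : set M) V (X : set (option V ->
  M)) : definable B X ->
  definable B [set v : V -> M | exists m, X (fun o =>
    if o is Some y then v y else m)].
Proof.
move=> [psi psiP].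
pose g (z : option V + B) : option (V + B) := match z with
  | inl (Some v) => Some (inl v) | inl None => None | inr b => Some (inr b) end.
exists (Not (All (Not (fmap g psi)))) => v /=.
have e m : holds (fmap g psi) (fun o => if o is Some y then vcat v val y else m)
    <-> X (fun o => if o is Some y then v y else m).
  rewrite holds_fmap psiP; apply/propeqP; congr holds.
  by apply/funext => -[[?|]|?].
split=> [[m Xm] h|h]; first by apply: (h m); rewrite e.
by apply: contrapT => h'; apply: h => m /e Xm; apply: h'; exists m.
Qed.

Lemma definable_ex_ord (B : set M) V n (X : set (V + 'I_n ->
  M)) : definable B X ->
  definable B [set v : V -> M | exists z : 'I_n -> M, X (vcat v z)].
Proof.
elim: n X => [|n IH] X dX.
  have z0 : 'I_0 -> M by case.
  have : definable B [set v : V -> M | X (vcat v z0)].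
    by apply: definable_subst dX => // -[v|[]//]; left; exists v.
  apply: definable_ext => v; split=> [h|[z]]; first by exists z0.
  by rewrite (_ : z = z0) //; apply/funext => -[].
pose f (w : option (V + 'I_n) -> M) (z : V + 'I_n.+1) := match z with
  | inl v => w (Some (inl v))
  | inr k => if unlift ord0 k is Some k' then w (Some (inr k')) else w None end.
have /definable_ex_option/IH : definable B [set w | X (f w)].
  apply: definable_subst dX => // -[v|k]; left; first by exists (Some (inl v)).
  rewrite /f; case: unlift => [k'|]; by [exists (Some (inr k'))|exists None].
apply: definable_ext => v; split=> [[z [m Xz]]|[z Xz]].
  exists (fun k => if unlift ord0 k is Some k' then z k' else m).
  by congr (X _): Xz; apply/funext => -[?|k] //=; case: unlift.
exists (fun k => z (lift ord0 k)), (z ord0).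
congr (X _): Xz; apply/funext => -[?|k] //=.
by case: unliftP => [k'|] ->.
Qed.

(** A quantifier over an infinite tuple amounts to one over the finitely many coordinates that the
    formula mentions; the others can take any value. *)
Lemma definable_ex (B : set M) V W (X : set (V + W -> M)) : definable B X ->
  definable B [set v : V -> M | exists z : W -> M, X (vcat v z)].
Proof.
move=> /definable_fin_support[K [u [Y [dY XY]]]].
(* Several indices may name the same variable; [rep] selects one of them, so that all receive the
   same value. *)
pose rep (y : V + W) := [pick k | `[< u k = y >]].
have repP k : exists2 k', rep (u k) = Some k' & u k' = u k.
  rewrite /rep; case: pickP => [k' /asboolP e|/(_ k)/asboolP//].
  by exists k'.
pose f (w : V + 'I_#|K| -> M) (k : K) := match u k with
  | inl v => w (inl v)
  | inr y => w (inr (enum_rank (odflt k (rep (inr y))))) end.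
have /definable_ex_ord : definable B [set w | Y (f w)].
  apply: definable_subst dY => // k; left; rewrite /f.
  by case: (u k) => [v|y]; eexists.
apply: definable_ext => v; split=> [[z Yz]|[w /XY Yw]].
  have [m0] := dom_inhabited M.
  exists (fun y => if rep (inr y) is Some k then z (enum_rank k) else m0).
  apply/XY; congr (Y _): Yz; apply/funext => k; rewrite /f /=.
  have [k' + _] := repP k.
  by case: (u k) => [//|y] /= ->.
exists (fun k => vcat v w (u (enum_val k))).
congr (Y _): Yw; apply/funext => k; rewrite /f /=.
have [k' + +] := repP k.
by case: (u k) => [//|y] /= -> /=; rewrite enum_rankK => ->.
Qed.

Lemma definable_split (A : set M) V J (b : J -> M) (X : set (V -> M)) :
  definable (A `|` range b) X ->
  exists Y : set (V + J -> M), definable A Y /\ forall v, X v <-> Y (vcat v b).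
Proof.
move=> [psi psiP].
have /choice[g gP] : forall z : V + (A `|` range b)%classic, exists z' :
  (V + J) + A,
    forall v, vcat v val z = vcat (vcat v b) val z'.
  move=> [v|[m /= mP]] /=; first by exists (inl (inl v)).
  have [Am|[j _ e]] := set_mem mP; first by exists (inr (SigSub (mem_set Am))).
  by exists (inl (inr j)).
exists [set w : V + J -> M | holds (fmap g psi) (vcat w val)]; split.
  by exists (fmap g psi).
move=> v; rewrite psiP /= holds_fmap.
by rewrite (_ : vcat _ val \o g = vcat v val) //; apply/funext => z /=.
Qed.

Lemma definable_join (A : set M) V J (b : J -> M) (Y : set (V + J -> M)) :
  definable A Y -> definable (A `|` range b) [set v : V -> M | Y (vcat v b)].
Proof.
apply: definable_subst; first exact: subsetUl.
by move=> [v|j]; [left; exists v|right; exists (b j) => //; right; exists j].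
Qed.

(* The group Aut(M/B). *)
Definition aut (B : set M) (s : M -> M) : Prop :=
  automorphism s /\ forall m, B m -> s m = m.

Lemma teval_aut V (s : M -> M) (t : term L V) v :
  automorphism s -> teval (s \o v) t = s (teval v t).
Proof.
move=> [_ sf _]; elim: t => //= f ts IH; rewrite sf; congr fint.
by apply/funext => k; exact: IH.
Qed.

Lemma holds_aut V (s : M -> M) (phi : formula L V) v :
  automorphism s -> holds phi v <-> holds phi (s \o v).
Proof.
move=> sa; have [[s' s'K sK] sf sr] := sa.
elim: phi v => {V} /= [V|V t1 t2|V r ts|V p IHp q IHq|V p IH] v //.
- by rewrite !teval_aut //; split=> [->|/(can_inj s'K)].
- by rewrite sr; apply/propeqP; congr rint; apply/funext => k;
    rewrite teval_aut.
- by rewrite IHp IHq.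
- split=> h m; last first.
    by rewrite IH; have := h (s m); congr holds; apply/funext => -[].
  by have := h (s' m); rewrite IH; congr holds; apply/funext => -[] //=;
    rewrite sK.
Qed.

Lemma aut_dfn (B : set M) s V (X : set (V -> M)) v :
  aut B s -> definable B X -> X v <-> X (s \o v).
Proof.
move=> [sa sB] [psi psiP]; rewrite !psiP (holds_aut _ _ sa).
rewrite (_ : s \o _ = vcat (s \o v) val) //.
by apply/funext => -[//|b] /=; rewrite sB //; exact/set_mem/valP.
Qed.

Lemma autW (A B : set M) s : A `<=` B -> aut B s -> aut A s.
Proof. by move=> AB [sa sB]; split=> // m /AB /sB. Qed.

Lemma aut_id B : aut B id.
Proof. by split=> //; split=> //; exists id. Qed.

Lemma aut_comp B s t : aut B s -> aut B t -> aut B (s \o t).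
Proof.
move=> [[bs fin_sat rs] sB] [[bt ft rt] tB]; split; last by move=> m Bm /=;
  rewrite tB // sB.
split; first exact: bij_comp.
  by move=> f x /=; rewrite ft fin_sat.
by move=> r x; rewrite rt rs.
Qed.

Lemma aut_inv B s : aut B s ->
  exists s', [/\ aut B s', cancel s s' & cancel s' s].
Proof.
move=> [[[s' s'K sK] fin_sat rs] sB]; exists s'; split=> //; split.
  split; first by exists s.
    move=> f x; apply: (can_inj s'K); rewrite fin_sat sK; congr fint.
    by apply/funext => k; rewrite /= sK.
  move=> r x; rewrite [X in _ <-> X]rs (_ : (fun k => s _) = x) //.
  by apply/funext => k; rewrite sK.
by move=> m /sB {1}<-.
Qed.

(* In the monster model this is [equiv_over B] for small tuples; the automorphism
   itself is what the proofs need. *)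
Definition conjugate (B : set M) V (a a' : V -> M) : Prop :=
  exists2 s, aut B s & s \o a = a'.

Lemma conjugate_refl B V (a : V -> M) : conjugate B a a.
Proof. by exists id; first exact: aut_id. Qed.

Lemma conjugate_sym B V (a a' : V -> M) : conjugate B a a' -> conjugate B a' a.
Proof.
move=> [s /aut_inv[s' [as' sK s'K]] <-]; exists s' => //.
by apply/funext => v /=.
Qed.

Lemma conjugate_trans B V (a a' a'' : V -> M) : conjugate B a a' ->
  conjugate B a' a'' -> conjugate B a a''.
Proof. by move=> [s as_ <-] [t at_ <-]; exists (t \o s) => //;
  exact: aut_comp. Qed.

Lemma conjugateW A B V (a a' : V -> M) : A `<=` B -> conjugate B a a' ->
  conjugate A a a'.
Proof. by move=> AB [s as_ <-]; exists s => //; exact: autW as_. Qed.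

Lemma conjugate_pre B V W (f : W -> V) (a a' : V -> M) :
  conjugate B a a' -> conjugate B (a \o f) (a' \o f).
Proof. by move=> [s as_ <-]; exists s. Qed.

Lemma conjugate_dfn B V (X : set (V -> M)) a a' : conjugate B a a' ->
  definable B X -> X a <-> X a'.
Proof. by move=> [s as_ <-]; exact: aut_dfn. Qed.

Lemma sat_subst_params I J (psi : formula L (I + J)) (b : J -> M) c :
  sat c (subst_params psi b) <-> holds psi (vcat c b).
Proof.
by rewrite /sat holds_fmap; apply/propeqP; congr holds; apply/funext => -[].
Qed.

Lemma equiv_overE B V (a a' : V -> M) :
  equiv_over B a a' <-> forall X, definable B X -> X a <-> X a'.
Proof.
split=> [e X [psi psiP]|h].
  rewrite !psiP -!sat_subst_params.
  have o : over B (subst_params psi val) by exists psi.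
  split=> sa.
    by have : tp a B (subst_params psi val) by []; rewrite e => -[].
  by have : tp a' B (subst_params psi val) by []; rewrite -e => -[].
have hD (psi : formula L (V + B)) : definable B [set v : V ->
  M | holds psi (vcat v val)] by exists psi.
apply/seteqP; split=> _ [[psi _ <-] /sat_subst_params s]; (split;
  first by exists psi);
  apply/sat_subst_params.
  exact: (iffLR (h _ (hD psi))) s.
exact: (iffRL (h _ (hD psi))) s.
Qed.

End Definable.

(** * Saturation *)

Section FiniteIntersections.

Definition cap_list (X : Type) (l : seq (set X)) : set X :=
  [set x | forall A, List.In A l -> A x].

Definition fip (X : Type) (G : set (set X)) : Prop :=
  forall l, (forall A, List.In A l -> G A) -> cap_list l !=set0.

Lemma cap_listS X (l l' : seq (set X)) : (forall A, List.In A l ->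
  List.In A l') ->
  cap_list l' `<=` cap_list l.
Proof. by move=> h x cx A /h /cx. Qed.

Lemma InP (X : eqType) (x : X) l : List.In x l <-> x \in l.
Proof.
elim: l => //= y l IH; rewrite inE IH.
by split=> [[->|->]|/predU1P[->|]]; rewrite ?eqxx ?orbT; [| |left|right].
Qed.

Lemma finite_set_list X (q : set X) : finite_set q ->
  exists l, forall x, q x <-> List.In x l.
Proof.
elim/Peq: X => X in q *; move=> /finite_seqP[l ->].
by exists l => x; rewrite InP.
Qed.

Lemma In_map X Y (f : X -> Y) l y :
  List.In y (map f l) -> exists2 x, List.In x l & y = f x.
Proof. by elim: l => //= x l IH [<-|/IH[x' ? ->]]; [exists x|exists x'];
  auto. Qed.

Lemma map_In X Y (f : X -> Y) l x : List.In x l -> List.In (f x) (map f l).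
Proof. by elim: l => //= y l IH [->|/IH]; auto. Qed.

Lemma In_cat X (l l' : seq X) x : List.In x (l ++ l')
  <-> List.In x l \/ List.In x l'.
Proof. exact: List.in_app_iff. Qed.

Lemma In_flatten X (ll : seq (seq X)) x :
  List.In x (flatten ll) <-> exists2 l, List.In l ll & List.In x l.
Proof.
elim: ll => /= [|l ll IH]; first by split=> // -[].
rewrite In_cat IH; split=> [[h|[l' h h']]|[l' [<-|h] h']].
- by exists l; auto.
- by exists l'; auto.
- by left.
- by right; exists l'.
Qed.

(** Compactness arguments pass from a finite family of sets to the data defining its members; both
    inclusions between the two lists are needed there. *)
Lemma In_choice X Y (P : X -> Y -> Prop) (l : seq Y) :
  (forall y, List.In y l -> exists x, P x y) ->
  exists l' : seq X, (forall x, List.In x l' ->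
    exists2 y, List.In y l & P x y) /\
    forall y, List.In y l -> exists2 x, List.In x l' & P x y.
Proof.
elim: l => [|y l IH] h; first by exists [::].
have [|l' [h1 h2]] := IH; first by move=> y' Hy'; apply: h; right.
have [x Pxy] := h y (or_introl erefl).
exists (x :: l'); split=> /=.
  move=> x' [<-|/h1[y' ? ?]]; first by exists y; auto.
  by exists y'; auto.
move=> y' [<-|/h2[x' ? ?]]; first by exists x; auto.
by exists x'; auto.
Qed.

Lemma fip_ultrafilter X (G : set (set X)) : fip G ->
  exists F : set_system X, UltraFilter F /\ G `<=` F.
Proof.
move=> fG; pose F0 : set_system X := [set A | exists2 l,
  (forall B, List.In B l -> G B) & cap_list l `<=` A].
have F0P : ProperFilter F0.
  apply: Build_ProperFilter_ex.
    by move=> A [l lG sA]; have [x /sA] := fG _ lG; exists x.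
  split.
  - by exists [::].
  - move=> A B [l lG lA] [l' l'G l'B]; exists (l ++ l').
      by move=> C /In_cat[/lG|/l'G].
    move=> x cx; split; [apply: lA|apply: l'B]; move: x cx;
      apply: cap_listS => C ?;
      by apply/In_cat; auto.
  - by move=> A B AB [l lG lA]; exists l => //; exact: subset_trans AB.
have [F [FU sF]] := ultraFilterLemma F0P.
exists F; split=> // A GA; apply: sF; exists [:: A]; first by move=> B [<-|[]].
by move=> x; apply; left.
Qed.

Lemma ultraN X (F : set_system X) A : UltraFilter F -> F (~` A) <-> ~ F A.
Proof.
move=> FU; split=> [FnA FA|nFA].
  by have [x []] := filter_ex (filterI FA FnA).
by have [] := in_ultra_setVsetC A FU.
Qed.

Lemma ultraU X (F : set_system X) A B : UltraFilter F -> F (A `|` B) ->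
  F A \/ F B.
Proof.
move=> FU FAB; have [|FnA] := in_ultra_setVsetC A FU; first by left.
by right; apply: filterS (filterI FAB FnA) => x [[]].
Qed.

Lemma filter_cap X (F : set_system X) l : Filter F ->
  (forall A, List.In A l -> F A) -> F (cap_list l).
Proof.
move=> FF; elim: l => [|A l IH] h; first by apply: filterS (filterT) =>
  x _ A [].
have FA : F A by apply: h; left.
have {}IH : F (cap_list l) by apply: IH => B ?; apply: h; right.
by apply: filterS (filterI FA IH) => x [Ax cx] B [<-//|/cx].
Qed.

End FiniteIntersections.

(** * Homogeneity and saturation for tuples of small length *)

Section Monster.
Context {L : language} {T : set (sentence L)} {kappa : Type} {M : structure L}.
Hypothesis hM : monster T kappa M.

Let kappa_nat := monster_uncountable hM.
Let kappa_pow := monster_strong_limit hM.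

Lemma definable_cap (B : set M) V (l : seq (set (V -> M))) :
  (forall X, List.In X l -> definable B X) -> definable B (cap_list l).
Proof.
elim: l => [|X l IH] h; first by apply: definable_ext (definableT B V) => v;
  split=> // _ A [].
have dX : definable B X by apply: h; left.
have {}IH : definable B (cap_list l) by apply: IH => B' ?; apply: h; right.
apply: definable_ext (definableI dX IH) => v;
  split=> [[Xv cv] Y [<-//|/cv//]|cv].
by split=> [|Y ?]; apply: cv; [left|right].
Qed.

(** The elements of [B] are appended to the tuples, which turns homogeneity over the empty set into
    homogeneity over [B]. One implication suffices because complements of definable sets are
    definable. *)
Lemma homogeneous (B : set M) V (a a' : V -> M) : small_type kappa V ->
  small kappa B ->
  (forall X, definable B X -> X a -> X a') -> conjugate B a a'.
Proof.
move=> sV sB h.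
have sVB : small kappa [set: (V + B)%type] by apply/smallTE/small_sum => //;
  exact/small_setE.
have e : equiv_over set0 (vcat a val : V + B -> M) (vcat a' val).
  have hX X : definable set0 X -> X (vcat a val : V + B -> M) ->
    X (vcat a' val).
    move=> dX; have /h : definable B [set v : V -> M | X (vcat v val)] by [
    apply: definable_subst dX => // -[v|b]; [left; by exists v|right;
      exists (val b) => //];
      exact/set_mem/valP].
    by apply.
  apply/equiv_overE => X dX; split; first exact: hX.
  by move=> Xa'; apply: contrapT => /(hX _ (definableN dX)).
have [s as_ sa] := monster_homogeneous hM sVB e.
exists s; last by apply/funext => v; have := sa (inl v).
split=> // m Bm; have := sa (inr (SigSub (mem_set Bm))).
by [].
Qed.

Lemma unary_saturation (B : set M) (G : set (set (unit ->
  M))) : small kappa B ->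
  (forall X, G X -> definable B X) -> fip G -> exists c, forall X, G X -> X c.
Proof.
move=> sB GB fG.
pose p : set (Mformula (M := M) unit) :=
  [set phi | over B phi /\ exists2 X, G X & forall c, sat c phi <-> X c].
have [] := @monster_saturated _ _ _ _ hM B p sB; last first.
  move=> c cp; exists c => X GX; have [psi psiP] := GB _ GX.
  rewrite psiP -sat_subst_params; apply: cp; split; first by exists psi.
  by exists X => // d; rewrite sat_subst_params psiP.
split=> [phi []//|q /finite_set_list[l lq] qp].
have [|l' [l'1 l'2]] := @In_choice _ _
    (fun X phi => G X /\ forall c, sat c phi <-> X c) l.
  by move=> phi /lq/qp[_ [X GX e]]; exists X.
have [|c cl] := fG l'; first by move=> X /l'1[phi _ []].
exists c => phi /lq/l'2[X /cl Xc [_ e]]; exact/e.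
Qed.

(** Saturation in one variable is iterated along the tuple: Zorn's lemma gives a maximal partial
    assignment [H] compatible with every finite part of [G], and a missing coordinate could still be
    assigned. *)
Theorem saturation (B : set M) V (G : set (set (V -> M))) :
  small_type kappa V -> small kappa B ->
  (forall X, G X -> definable B X) -> fip G -> exists c, forall X, G X -> X c.
Proof.
move=> sV sB GB fG.
pose agree (H : set (V * M)) (v : V -> M) := forall x m, H (x, m) -> v x = m.
pose P (H : set (V * M)) := forall l, (forall X, List.In X l -> G X) ->
  exists2 v, cap_list l v & agree H v.
have [F FP Ftot|H [PH maxH]] := @Zorn_bigcup _ P.
  have [[H0 FH0]|F0] := pselect (exists H, F H); last first.
    move=> l /fG[v cv]; exists v => // x m [H FH]; case: F0; by exists H.
  move=> l lG.
  (* A finite part of [G] mentions finitely many coordinates, and one member [H1] of the chain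
     assigns all of those that the union assigns. *)
  have /definable_fin_support[W [u [Y [dY YP]]]] :
    definable B (cap_list l) by apply: definable_cap => X /lG/GB.
  have [H1 FH1 H1P] : exists2 H1, F H1 & forall k, k \in enum W -> forall m,
      (\bigcup_(X in F) X) (u k, m) -> H1 (u k, m).
    elim: (enum W) => [|k s [H1 FH1 IH]]; first by exists H0.
    have [[m [H2 FH2 H2m]]|nm] := pselect (exists m, (\bigcup_(X in F) X) (u k,
      m)).
      have [H3 FH3 [H13 H23]] : exists2 H3, F H3 & H1 `<=` H3 /\ H2 `<=` H3.
        by have [h|h] := Ftot _ _ FH1 FH2; [exists H2|exists H1] => //; split.
      exists H3 => // k'; rewrite inE => /predU1P[->|ks] m' h'.
        suff -> : m' = m by exact: H23.
        have [H4 FH4 H4m'] := h'.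
        have [H5 FH5 [H45 H25]] : exists2 H5, F H5 & H4 `<=` H5 /\ H2 `<=` H5.
          by have [h|h] := Ftot _ _ FH4 FH2; [exists H2|exists H4] => //; split.
        have [|v _ va] := FP _ FH5 [::]; first by [].
        by rewrite -(va _ _ (H45 _ H4m')) (va _ _ (H25 _ H2m)).
      by apply: H13; exact: IH.
    exists H1 => // k'; rewrite inE => /predU1P[->|ks] m' h'; last exact: IH.
    by case: nm; exists m'.
  have [v cv va] := FP _ FH1 l lG.
  have /choice[w wP] : forall x, exists m,
      ((exists m', (\bigcup_(X in F) X) (x, m')) ->
        (\bigcup_(X in F) X) (x, m)) /\
      (~ (exists m', (\bigcup_(X in F) X) (x, m')) -> m = v x).
    move=> x; have [[m hm]|n] := pselect (exists m', (\bigcup_(X in F) X) (x,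
      m')).
      by exists m; split=> // n; case: n; exists m.
    by exists (v x); split.
  exists w.
    apply/YP; move/YP: cv; congr Y; apply/funext => k /=.
    have [hk|n] := pselect (exists m', (\bigcup_(X in F) X) (u k, m')).
      by apply: va; apply: H1P; [rewrite mem_enum|exact: (wP _).1].
    by rewrite (wP (u k)).2.
  move=> x m hm; have [H4 FH4 H4m] := hm.
  have /(wP x).1[H2 FH2 H2m] : exists m', (\bigcup_(X in F) X) (x,
    m') by exists m.
  have [H5 FH5 [H45 H25]] : exists2 H5, F H5 & H4 `<=` H5 /\ H2 `<=` H5.
    by have [h|h] := Ftot _ _ FH4 FH2; [exists H2|exists H4] => //; split.
  have [|v' _ va'] := FP _ FH5 [::]; first by [].
  by rewrite -(va' _ _ (H45 _ H4m)) (va' _ _ (H25 _ H2m)).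
(* [v0] carries the values assigned by [H], which makes them parameters from the small set
   [range v0]. *)
have [v0 _ v0a] := PH [::] (fun _ => @False_ind _).
have tot i : exists m, H (i, m).
  apply: contrapT => ni.
  (* The values that coordinate [i] takes in the solutions of [l] compatible with [H]. *)
  pose E l : set (unit -> M) :=
    [set c | exists2 v, cap_list l v & agree H v /\ v i = c tt].
  have [|||c cP] := @unary_saturation (B `|` range v0)
      [set X | exists2 l, (forall X, List.In X l -> G X) & X = E l].
  - apply: small_setU => //; exact: small_range.
  - move=> _ [l lG ->].
    pose f (w : unit + V -> M) (x : V) : M :=
      if pselect (exists m, H (x, m)) then v0 x
      else if pselect (x = i) then w (inl tt) else w (inr x).
    have /definable_ex : definable (B `|` range v0) [set w | cap_list l (f w)].
      apply: definable_subst (definable_cap (fun X h => GB _ (lG X h)));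
        first exact: subsetUl.
      move=> x; rewrite /f; case: (pselect (exists m, H (x, m))) => ? /=.
        by right; exists (v0 x) => //; right; exists x.
      by case: (pselect (x = i)) => ?; left; [exists (inl tt)|exists (inr x)].
    apply: definable_ext => c; split=> [[z cz]|[v cv [va vi]]].
      exists (f (vcat c z)) => //; split.
        move=> x m Hx; rewrite /f; case: pselect => [?|[]]; first exact: v0a.
        by exists m.
      by rewrite /f; case: pselect => // ?; case: pselect.
    exists v; congr (cap_list _ _): cv; apply/funext => x; rewrite /f /=.
    case: pselect => [[m Hm]|?] /=; first by rewrite (va _ _ Hm) (v0a _ _ Hm).
    by case: pselect => [xi|//] /=; rewrite xi.
  - move=> ls hls.
    have [|ll [ll1 ll2]] := @In_choice (seq (set (V -> M))) _
        (fun l X => (forall X, List.In X l -> G X) /\ X = E l) ls.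
      by move=> X /hls[l lG ->]; exists l.
    have [|v cv va] := PH (flatten ll).
      by move=> X /In_flatten[l /ll1[X' _ [lG _]]]; exact: lG.
    exists (fun _ => v i) => X /ll2[l lll [_ ->]]; exists v => // Y Yl.
    by apply: cv; apply/In_flatten; exists l.
  case: (maxH (H `|` [set (i, c tt)])).
    split; first by move=> x Hx; left.
    by move=> h; apply: ni; exists (c tt); apply: h; right.
  move=> l lG; have [|v cv [va vi]] := cP (E l); first by exists l.
  by exists v => // x m [/va//|[-> ->]].
have [w wP] := choice tot.
exists w => X GX; have [|v cv va] := PH [:: X]; first by move=> Y [<-|[]].
rewrite (_ : w = v); first by apply: cv; left.
by apply/funext => x; rewrite (va _ _ (wP x)).
Qed.

End Monster.

(** * Indiscernible sequences *)

Definition increasing (u : nat -> nat) : Prop := forall k l, (k < l)%N ->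
  (u k < u l)%N.

Lemma increasing_comp u v : increasing u -> increasing v -> increasing (u \o v).
Proof. by move=> iu iv k l /iv/iu. Qed.

Lemma increasing_ge u k : increasing u -> (k <= u k)%N.
Proof. by move=> iu; elim: k => // k IH;
  apply: leq_ltn_trans IH (iu _ _ _). Qed.

Lemma increasing_addn N : increasing (addn N).
Proof. by move=> k l; rewrite ltn_add2l. Qed.

Lemma increasingS u : (forall k, (u k < u k.+1)%N) -> increasing u.
Proof.
move=> h k l; elim: l => // l IH; rewrite ltnS leq_eqVlt =>
  /predU1P[->//|/IH kl].
exact: ltn_trans kl (h l).
Qed.

Definition increasing_tuple d (O : orderType d) n (v : 'I_n -> O) : Prop :=
  forall k l : 'I_n, (k < l)%N -> (v k < v l)%O.

Lemma extend_increasing n (v : 'I_n -> nat) : increasing_tuple v ->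
  exists2 u, increasing u & forall k : 'I_n, u k = v k.
Proof.
(* [N] exceeds all values of [v], so the tuple can be continued by [N + k]. *)
move=> iv; pose N := (\sum_k v k).+1.
exists (fun k => if insub k is Some i then v i else (N + k)%N); last first.
  by move=> k; rewrite valK.
move=> k l kl; case: (insubP _ k) => [k' _ ek|].
  case: insubP => [l' _ el|_]; first by apply: iv; rewrite ek el.
  by rewrite /N addSn ltnS (leq_trans _ (leq_addr _ _)) // (bigD1 k')
    //= leq_addr.
rewrite -leqNgt => nk; case: insubP => [l' _ el|_]; last by rewrite ltn_add2l.
by have := ltn_ord l'; rewrite el => /(ltn_trans (leq_ltn_trans nk kl));
  rewrite ltnn.
Qed.

Lemma infinite_increasing (S : nat ->
  Prop) : (forall N, exists2 k, (N <= k)%N & S k) ->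
  exists2 u, increasing u & forall k, S (u k).
Proof.
move=> h; have /choice[g gP] : forall N, exists k, (N <= k)%N /\ S k.
  by move=> N; have [k] := h N; exists k.
exists (fun k => iter k (fun m => g m.+1) (g 0)).
  by apply: increasingS => k; rewrite iterS; exact: (gP _).1.
by case=> [|k]; [exact: (gP _).2|rewrite iterS; exact: (gP _).2].
Qed.

(** * Iterated ultrafilters on the natural numbers *)

Section Nonprincipal.

Lemma nonprincipal_ultra : exists U : set_system nat,
  UltraFilter U /\ forall N, U [set k | (N <= k)%N].
Proof.
have [U [UU sU]] := ultraFilterLemma eventually_filter.
by exists U; split=> // N; apply: sU; exists N.
Qed.

Variable U : set_system nat.
Hypothesis UU : UltraFilter U.
Hypothesis Ucof : forall N, U [set k | (N <= k)%N].

(* [ultra_many n P]: for U-many k_0, for U-many k_1, ..., P [:: k_0; k_1; ...]. *)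
Fixpoint ultra_many (n : nat) (P : seq nat -> Prop) : Prop :=
  if n is n'.+1 then U [set k | ultra_many n' (fun l =>
    P (k :: l))] else P [::].

Lemma ultra_many_mono n (P Q : seq nat -> Prop) : (forall l, P l -> Q l) ->
  ultra_many n P -> ultra_many n Q.
Proof.
elim: n P Q => [|n IH] P Q PQ /=; first exact: PQ.
by apply: filterS => k /=; apply: IH => l; exact: PQ.
Qed.

Lemma ultra_many_and n (P Q : seq nat -> Prop) : ultra_many n P ->
  ultra_many n Q -> ultra_many n (fun l => P l /\ Q l).
Proof.
elim: n P Q => [|n IH] P Q //= hP hQ.
by apply: filterS (filterI hP hQ) => k [/= h h']; exact: IH.
Qed.

Lemma ultra_many_top n : ultra_many n (fun=> True).
Proof. by elim: n => //= n IH; apply: filterS filterT => k _ /=. Qed.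

Lemma ultra_many_mask n (m : bitseq) P : size m = n ->
  ultra_many (count id m) P ->
  ultra_many n (fun l => P (mask m l)).
Proof.
elim: m n P => [|b m IH] [|n] P //= [szm].
case: b => /= h; first by apply: filterS h => k /= /(IH _ _ szm).
by apply: filterS filterT => k _ /=; exact: IH.
Qed.

Lemma ultra_many_total n P : ultra_many n P \/ ultra_many n (fun l => ~ P l).
Proof.
elim: n P => [|n IH] P /=; first exact: EM.
have [|h] := in_ultra_setVsetC [set k | ultra_many n (fun l => P (k :: l))] UU;
  first by left.
right; apply: filterS h => k /= nh.
by have [] := IH (fun l => P (k :: l)).
Qed.

Lemma ultra_many_sorted n (P : seq nat -> Prop) :
  (forall l, sorted ltn l -> size l = n -> P l) -> ultra_many n P.
Proof.
move=> h; suff : forall a (P : seq nat -> Prop),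
    (forall l, path ltn a l -> size l = n -> P l) -> ultra_many n P.
  move=> h'; apply: (h' 0) => l pl; apply: h; exact: path_sorted pl.
elim: n {P h} => [|n IH] a P h /=; first exact: h.
apply: filterS (Ucof a.+1) => k /= ak; apply: (IH k) => l pl sl.
by apply: h => /=; rewrite ?ak ?sl.
Qed.

Lemma ultra_many_ex n P : ultra_many n P -> exists2 l, size l = n & P l.
Proof.
elim: n P => [|n IH] P /=; first by exists [::].
by move=> /filter_ex[k /= /IH[l <- Pl]]; exists (k :: l).
Qed.

End Nonprincipal.

Section Sequences.
Context {L : language} {T : set (sentence L)} {kappa : Type} {M : structure L}.
Hypothesis hM : monster T kappa M.

Let kappa_nat := monster_uncountable hM.
Let kappa_pow := monster_strong_limit hM.

Definition subtuple O (o0 : O) J (s : O -> J -> M) n (l : seq O) : 'I_n * J ->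
  M :=
  fun z => s (nth o0 l z.1) z.2.

(** [Q n P] is to be read: [P] holds for many [n]-tuples of indices. The hypotheses on [Q] are those
    of a filter, together with the stability under dummy coordinates expressed by [mask].
    Compactness makes all increasing tuples of the new sequence obey what holds for many tuples of
    the old one. The instances are iterated ultrafilters, for extraction, and validity at all
    increasing tuples, for stretching. *)
Lemma realize_pattern O (o0 : O) J (s : O -> J -> M)
    (Q : nat -> (seq O -> Prop) -> Prop) (B : set M) d (O' : orderType d) :
  (forall n P P', (forall l, P l -> P' l) -> Q n P -> Q n P') ->
  (forall n P P', Q n P -> Q n P' -> Q n (fun l => P l /\ P' l)) ->
  (forall n, Q n (fun=> True)) ->
  (forall n P, Q n P -> exists2 l, size l = n & P l) ->
  (forall n m P, size m = n -> Q (count id m) P -> Q n (fun l =>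
    P (mask m l))) ->
  small_type kappa J -> small_type kappa O' -> small kappa B ->
  exists s' : O' -> J -> M, forall n (Y : set ('I_n * J -> M)), definable B Y ->
    Q n (fun l => Y (subtuple o0 s l)) ->
    forall v : 'I_n -> O', increasing_tuple v -> Y (concat (fun k => s' (v k))).
Proof.
move=> Qmono Qand Qtop Qex Qmask smJ smO' smB.
pose entry := {n : nat & (set ('I_n * J -> M) * ('I_n -> O'))%type}.
pose good (e : entry) := let: existT n (Y, v) := e in
  [/\ definable B Y, increasing_tuple v & Q n (fun l => Y (subtuple o0 s l))].
pose lift (e : entry) : set (O' * J -> M) := let: existT n (Y, v) := e in
  [set x | Y (fun z => x (v z.1, z.2))].
have [||||c cP] := @saturation _ _ _ _ hM B (O' * J)%type
    [set X | exists2 e, good e & X = lift e].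
- exact: small_prod.
- by [].
- move=> _ [[n [Y v]] [dY _ _] ->] /=.
  exact: (definable_pre (fun z : 'I_n * J => (v z.1, z.2)) dY).
- move=> ls hls.
  have [|es [es1 es2]] := @In_choice entry _ (fun e X =>
    good e /\ X = lift e) ls.
    by move=> X /hls[e ge ->]; exists e.
  pose cod (e : entry) := let: existT n (Y, v) := e in codom v.
  (* All indices occurring in the finitely many conditions, in increasing order; [msk e] marks those
     used by the condition [e], so that all conditions speak of one list of length [size w]. *)
  pose w := sort <=%O (undup (flatten (map cod es))).
  have uw : uniq w by rewrite sort_uniq undup_uniq.
  have sw : sorted <%O w by rewrite sort_lt_sorted undup_uniq.
  pose msk e := [seq o \in cod e | o <- w].
  have mw e : good e -> List.In e es -> mask (msk e) w = cod e.
    move=> ge ein; rewrite -filter_mask; apply: lt_sorted_eq.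
    + by apply: sorted_filter sw; exact: lt_trans.
    + case: e ge {ein} => n [Y v] [_ iv _] /=; rewrite /codom /image_mem.
      have : sorted ltn (map val (enum 'I_n))
        by rewrite val_enum_ord iota_ltn_sorted.
      by rewrite !sorted_map; apply: sub_sorted => k l /=; exact: iv.
    + move=> o; rewrite mem_filter mem_sort mem_undup.
      case: (boolP (o \in cod e)) => //= oe; apply/flattenP;
        exists (cod e) => //.
      exact/InP/map_In.
  have : Q (size w) (fun l => forall e, List.In e es ->
      let: existT n (Y, v) := e in Y (subtuple o0 s (mask (msk e) l))).
    have {}es1 : forall e, List.In e es -> good e by move=> e /es1[X _ []].
    have : forall e, List.In e es -> mask (msk e) w = cod e.
      by move=> e ein; apply: mw => //; exact: es1.
    move: es1; clear es2 mw; clearbody w; elim: es => [|e es IH] ge em.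
      by apply: Qmono (Qtop (size w)) => l _ e [].
    have /IH{}IH : forall e, List.In e es -> good e by move=> e' ?; apply: ge;
      right.
    have {}/IH IH : forall e, List.In e es -> mask (msk e) w = cod e.
      by move=> e' ?; apply: em; right.
    have := ge e (or_introl erefl); have := em e (or_introl erefl).
    case: e {ge em} => n [Y v] /= emw [_ _ Qv].
    have sz : size (msk (existT _ n (Y, v))) = size w by rewrite size_map.
    have cn : count id (msk (existT _ n (Y, v))) = n.
      by rewrite -(size_mask sz) emw size_codom card_ord.
    rewrite -{1}cn in Qv.
    apply: Qmono (Qand _ _ _ (Qmask _ _ _ sz Qv) IH) => l [h1 h2] e [<-|];
      last exact: h2.
    exact: h1.
  move=> /Qex[l sl hl].
  pose g o := nth o0 l (index o w).
  have lg : l = map g w.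
    apply: (@eq_from_nth _ o0); rewrite ?size_map // sl => i iw.
    have [o ow] : exists o, o \in w by case: (w) iw => // o w' _; exists o;
      rewrite mem_head.
    by rewrite (nth_map o) // /g index_uniq.
  exists (fun z => s (g z.1) z.2) => X /es2[[n [Y v]] ein [ge ->]] /=.
  have := hl _ ein; congr Y; apply/funext => -[k j]; rewrite /subtuple /=.
  congr s; rewrite lg -map_mask (mw _ ge ein) /= codomE -map_comp.
  by rewrite (nth_map k) ?size_enum_ord // nth_ord_enum.
exists (fun o j => c (o, j)) => n Y dY QY v iv.
by apply: (cP (lift (existT _ n (Y, v)))); exists (existT _ n (Y, v)).
Qed.

Lemma increasing_tuple_nth d (O : orderType d) (o0 : O) l : sorted <%O l ->
  increasing_tuple (fun k : 'I_(size l) => nth o0 l k).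
Proof.
move=> sl k l' kl'; apply: (sorted_ltn_nth lt_trans) => //; exact: ltn_ord.
Qed.

Lemma definable_ordered_support (B : set M) d (O : orderType d) J (X :
  set (O * J -> M)) : definable B X ->
  exists n (v : 'I_n -> O) (Y : set ('I_n * J -> M)),
    [/\ increasing_tuple v, definable B Y & forall x, X x <-> Y (fun z =>
      x (v z.1, z.2))].
Proof.
move=> /definable_fin_support[W [u [Y [dY YP]]]].
(* If no variable occurs, [O] may be empty and cannot provide the default of [nth]. *)
have [[k0 _]|nW] := pselect (exists k : W, True); last first.
  have kF (k : W) : False by apply: nW; exists k.
  have v0 : 'I_0 -> O by case.
  exists 0, v0, [set y : 'I_0 * J -> M | Y (fun k => False_rect M (kF k))].
  split; first by case.
    by apply: definable_subst dY => // k; case: (kF k).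
  by move=> x; rewrite YP; apply/propeqP; congr Y; apply/funext => k;
    case: (kF k).
pose o0 := (u k0).1.
pose w := sort <=%O (undup (codom (fun k => (u k).1))).
have sw : sorted <%O w by rewrite sort_lt_sorted undup_uniq.
have iw k : (index (u k).1 w < size w)%N.
  by rewrite index_mem mem_sort mem_undup; apply/codomP; exists k.
exists (size w), (fun k => nth o0 w k), [set y | Y (fun k =>
  y (Ordinal (iw k), (u k).2))].
split; first exact: increasing_tuple_nth.
  exact: (definable_pre (fun k => (Ordinal (iw k), (u k).2)) dY).
move=> x; rewrite YP; apply/propeqP; congr Y; apply/funext => k /=.
by rewrite nth_index ?(inj_eq val_inj) -?index_mem // -surjective_pairing.
Qed.

Lemma definable_initial (B : set M) J (X : set (nat * J ->
  M)) : definable B X ->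
  exists n (Y : set ('I_n * J -> M)),
    definable B Y /\ forall x, X x <-> Y (fun z => x (val z.1, z.2)).
Proof.
move=> /definable_ordered_support[n [v [Y [_ dY YP]]]].
have vN k : (v k < (\sum_k v k).+1)%N by rewrite ltnS (bigD1 k) //= leq_addr.
exists (\sum_k v k).+1, [set y | Y (fun z => y (Ordinal (vN z.1), z.2))]; split.
  exact: (definable_pre (fun z : 'I_n * J => (Ordinal (vN z.1), z.2)) dY).
by move=> x; rewrite YP.
Qed.

(* Equivalent to [indiscernible] ([indiscE]), but a single automorphism acts on the
   whole sequence. *)
Definition indisc (B : set M) J (s : nat -> J -> M) : Prop :=
  forall u, increasing u -> conjugate B (concat s) (concat (s \o u)).

Lemma indiscernible_dfn (B : set M) J (s : nat -> J -> M) u u' X :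
  indiscernible B s -> increasing u -> increasing u' -> definable B X ->
  X (concat (s \o u)) -> X (concat (s \o u')).
Proof.
move=> is_ iu iu' /definable_initial[n [Y [dY YP]]] /YP h; apply/YP.
have /equiv_overE/(_ Y dY) := @is_ n (u \o val) (u' \o val) (fun k l => iu k l)
  (fun k l => iu' k l).
by move=> e; apply/e.
Qed.

Lemma indiscE (B : set M) J (s : nat -> J -> M) : small_type kappa J ->
  small kappa B ->
  indisc B s <-> indiscernible B s.
Proof.
move=> sJ sB; split=> [is_|is_ u iu].
  move=> n v v' /extend_increasing[u iu uv] /extend_increasing[u' iu' u'v'];
    apply/equiv_overE => X dX.
  have := definable_pre (fun z : 'I_n * J => (val z.1, z.2)) dX.
  move=> dX'; have /= := conjugate_dfn (conjugate_trans (conjugate_sym (is_ u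
    iu)) (is_ u' iu')) dX'.
  rewrite (_ : _ \o _ = concat (fun k => s (v k))); last first.
    by apply/funext => -[k j]; rewrite /concat /= uv.
  rewrite (_ : _ \o _ = concat (fun k => s (v' k))) //.
  by apply/funext => -[k j]; rewrite /concat /= u'v'.
apply: (homogeneous hM _ sB); first by apply: small_prod => //;
  exact: small_nat kappa_nat.
move=> X dX; exact: (indiscernible_dfn (u := id) is_ (fun _ _ h => h) iu dX).
Qed.

Lemma indiscW (A B : set M) J (s : nat -> J -> M) : A `<=` B -> indisc B s ->
  indisc A s.
Proof. by move=> AB is_ u iu; apply: conjugateW AB (is_ u iu). Qed.

Lemma indisc_inc (B : set M) J (s : nat -> J -> M) u : increasing u ->
  indisc B s -> indisc B (s \o u).
Proof.
move=> iu is_ v iv; apply: conjugate_trans (conjugate_sym (is_ u iu)) _.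
exact: is_ (increasing_comp iu iv).
Qed.

Lemma indisc_pre (B : set M) J K (h : K -> J) (s : nat -> J -> M) :
  indisc B s -> indisc B (fun k => s k \o h).
Proof.
move=> is_ u iu; exact: (conjugate_pre (fun z : nat * K =>
  (z.1, h z.2)) (is_ u iu)).
Qed.

Lemma indisc_aut (A B : set M) J (s : nat -> J -> M) t : indisc B s ->
  aut A t ->
  A `<=` B -> indisc (t @` B) (fun k => t \o s k).
Proof.
move=> is_ at_ AB u iu; have [r [ra rB] rs] := is_ u iu.
have [t' [at' tt' t't]] := aut_inv at_.
have [ta _] := at_; have [t'a _] := at'.
exists (t \o (r \o t')).
  have [] : aut set0 (t \o (r \o t')) by apply: aut_comp => //; apply: aut_comp.
  move=> ? _; split=> // _ [m Bm <-] /=; by rewrite tt' rB.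
apply/funext => -[k j]; rewrite /concat /= tt'.
by have /(congr1 (fun f => f (k, j))) := rs; rewrite /concat /= => ->.
Qed.

(** The iterated ultrafilter plays the part of Ramsey's theorem: a formula or its negation holds for
    many tuples, hence at all increasing tuples of [s'], which is indiscernibility. What holds at
    all increasing tuples of [s] holds for many. *)
Lemma extraction J (s : nat -> J -> M) (B : set M) d (O : orderType d) :
  small_type kappa J -> small_type kappa O -> small kappa B ->
  exists2 s' : O -> J -> M, indiscernible B s' &
    forall n (Y : set ('I_n * J -> M)), definable B Y ->
      (forall v : 'I_n -> nat, increasing_tuple v -> Y (concat (fun k =>
        s (v k)))) ->
      forall v : 'I_n -> O, increasing_tuple v -> Y (concat (fun k =>
        s' (v k))).
Proof.
move=> sJ sO sB; have [U [UU Uc]] := nonprincipal_ultra.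
have [|||||s' s'P] := @realize_pattern nat 0 J s (ultra_many U)
  B d O _ _ _ _ _ sJ sO sB.
- exact: ultra_many_mono.
- exact: ultra_many_and.
- exact: ultra_many_top.
- exact: ultra_many_ex.
- exact: ultra_many_mask.
exists s' => [n v v' iv iv'|n Y dY h v iv].
  apply/equiv_overE => X dX.
  have [h|h] := ultra_many_total UU n (fun l => X (subtuple 0 s l)).
    by split=> _; exact: s'P.
  have {}h := s'P _ _ (definableN dX) h.
  by split=> h'; [case: (h _ iv)|case: (h _ iv')].
apply: s'P => //; apply: ultra_many_sorted => // l sl ln.
by subst n; exact: h (increasing_tuple_nth 0 sl).
Qed.

Lemma extraction_nat J (s : nat -> J -> M) (B : set M) :
  small_type kappa J -> small kappa B ->
  exists2 s' : nat -> J -> M, indisc B s' &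
    forall X : set (nat * J -> M), definable B X ->
      (forall u, increasing u -> X (concat (s \o u))) -> X (concat s').
Proof.
move=> sJ sB; have [s' is' s'P] := @extraction J s B _ nat sJ (small_nat
  kappa_nat) sB.
exists s'; first exact/indiscE.
move=> X /definable_initial[n [Y [dY YP]]] h; apply/YP.
apply: (s'P n Y dY) => // v /extend_increasing[u iu uv].
have /YP := h _ iu; congr Y; apply/funext => -[k j].
by rewrite /concat /= uv.
Qed.

(** Equality of Ehrenfeucht-Mostowski types over [B], for sequences along possibly different
    orders. *)
Definition same_EM (B : set M) J d (O : orderType d) d' (O' : orderType d')
    (s : O -> J -> M) (s' : O' -> J -> M) : Prop :=
  forall n (v : 'I_n -> O) (v' : 'I_n -> O'), increasing_tuple v ->
    increasing_tuple v' ->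
    equiv_over B (concat (fun k => s (v k))) (concat (fun k => s' (v' k))).

(** By indiscernibility a formula true at one increasing tuple is true at all, so validity at all of
    them can serve as the pattern. Since [O] is infinite, increasing tuples of every length
    exist. *)
Lemma stretch J (B : set M) d (O : orderType d) (o0 : O) (s : O -> J -> M)
    d' (O' : orderType d') :
  infinite_set [set: O] -> indiscernible B s ->
  small_type kappa J -> small_type kappa O' -> small kappa B ->
  exists2 s' : O' -> J -> M, indiscernible B s' & same_EM B s s'.
Proof.
move=> infO is_ sJ sO' sB.
pose Q n (P : seq O -> Prop) := forall l, sorted <%O l -> size l = n -> P l.
have Qex n : exists l : seq O, sorted <%O l /\ size l = n.
  have [A _ An] := infinite_set_fset n infO.
  exists (take n (sort <=%O (finmap.enum_fset A))); split;
    last by rewrite size_take_min size_sort; exact/minn_idPl.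
  by apply: take_sorted; rewrite sort_lt_sorted; exact: finmap.fset_uniq.
have [|||||s' s'P] := @realize_pattern O o0 J s Q B d' O' _ _ _ _ _ sJ sO' sB.
- by move=> n P P' PP' h l sl /(h l sl)/PP'.
- by move=> n P P' h h' l sl ln; split; [exact: h|exact: h'].
- by [].
- by move=> n P h; have [l [sl ln]] := Qex n; exists l => //; exact: h.
- move=> n m P mn h l sl ln; apply: h; last by rewrite size_mask // mn.
  by apply: sorted_mask sl; exact: lt_trans.
have es : same_EM B s s'.
  move=> n v v' iv iv'; apply/equiv_overE.
  have h X : definable B X -> X (concat (fun k => s (v k))) ->
    X (concat (fun k => s' (v' k))).
    move=> dX Xv; apply: s'P => // l sl ln.
    subst n; have /equiv_overE/(_ X dX)[+ _] :=
      is_ _ _ _ iv (increasing_tuple_nth o0 sl).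
    exact.
  move=> X dX; split; first exact: h.
  by move=> Xv'; apply: contrapT => /(h _ (definableN dX)).
exists s' => // n v v' iv iv'.
have [l [sl ln]] := Qex n; subst n; have il := increasing_tuple_nth o0 sl.
by rewrite /equiv_over -(es _ _ _ il iv) -(es _ _ _ il iv').
Qed.

Lemma same_EM_eqv J (B : set M) d (O : orderType d) (s s' : O -> J -> M) :
  small_type kappa J -> small_type kappa O -> small kappa B -> same_EM B s s' ->
  conjugate B (concat s) (concat s').
Proof.
move=> sJ sO sB es; apply: (homogeneous hM _ sB); first exact: small_prod.
move=> X /definable_ordered_support[n [v [Y [iv dY YP]]]] /YP h; apply/YP.
by have /equiv_overE/(_ Y dY) := es _ _ _ iv iv => e; apply/e.
Qed.

End Sequences.

(** * Dividing and non-forking *)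

(** Only the parameter variables are made finite in number: [divides] asks for an [n]-tuple of
    parameters but leaves the object variables arbitrary. *)
Lemma formula_fin_right (L : language) I P (chi : formula L (I + P)) :
  exists n (h : 'I_n -> P) (chi' : formula L (I + 'I_n)),
    forall (M : structure L) (x : I -> M) (p : P -> M),
      holds chi (vcat x p) <-> holds chi' (vcat x (p \o h)).
Proof.
have [W [u [phi ->]]] := formula_fin chi.
pose isr w := if u w is inr _ then true else false.
pose W' : finType := {w : W | isr w}.
have /choice[h hP] : forall w : W', exists p, u (val w) = inr p.
  by move=> [w] /=; rewrite /isr; case: (u w) => // v _; exists v.
have /choice[g gP] : forall w : W, exists z : I + 'I_#|W'|, forall (M :
  structure L) x p,
    vcat (M := M) x p (u w) = vcat x (p \o (h \o enum_val)) z.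
  move=> w; case E: (u w) => [i|b]; first by exists (inl i).
  have hw : isr w by rewrite /isr E.
  exists (inr (enum_rank (exist _ w hw : W'))) => M x p /=.
  by rewrite enum_rankK; have /= := hP (exist _ w hw); rewrite E => -[->].
exists #|W'|, (h \o enum_val), (fmap g phi) => M x p; rewrite !holds_fmap.
by apply/propeqP; congr holds; apply/funext => w /=.
Qed.

Lemma list_bound (l : seq nat) : exists N, forall k, List.In k l -> (k < N)%N.
Proof.
elim: l => [|k l [N h]]; first by exists 0.
by exists (maxn k.+1 N) => m /= [<-|/h]; rewrite leq_max ?leqnn // => ->;
  rewrite orbT.
Qed.

Lemma list_finite X (l : seq X) : finite_set [set x | List.In x l].
Proof.
elim: l => [|x l IH]; first by rewrite (_ : [set _ | _] = set0) //;
  apply/seteqP; split.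
rewrite (_ : [set _ | _] = [set x] `|` [set y | List.In y l]) ?finite_setU //.
  by apply/seteqP; split=> y [<-|]; [left|right|left|right].
Qed.

Lemma list_partition X (P Q : X -> Prop) l : (forall x, List.In x l ->
  P x \/ Q x) ->
  exists l1 l2, [/\ forall x, List.In x l1 -> P x, forall x, List.In x l2 ->
    Q x &
    forall x, List.In x l -> List.In x l1 \/ List.In x l2].
Proof.
elim: l => [|x l IH] h; first by exists [::], [::].
have [|l1 [l2 [h1 h2 h12]]] := IH; first by move=> y ?; apply: h; right.
have [Px|Qx] := h x (or_introl erefl).
  exists (x :: l1), l2; split=> // [y [<-|/h1]|y [<-|/h12[]]] //=; by auto.
exists l1, (x :: l2); split=> // [y [<-|/h2]|y [<-|/h12[]]] //=; by auto.
Qed.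

Section Dividing.
Context {L : language} {T : set (sentence L)} {kappa : Type} {M : structure L}.
Hypothesis hM : monster T kappa M.

Let kappa_nat := monster_uncountable hM.
Let kappa_pow := monster_strong_limit hM.

(* Dividing of a definable set. Allowing small tuples [b k] and parameters from
   [A], instead of finite tuples, spares many changes of variables. *)
Definition set_divides (A : set M) I (X : set (I -> M)) : Prop :=
  exists (J : Type) (Y : set (I + J -> M)) (b : nat -> J -> M),
    [/\ small_type kappa J, definable A Y, indisc A b, forall x,
      X x <-> Y (vcat x (b 0)) &
      exists N, forall x, ~ forall k, (k < N)%N -> Y (vcat x (b k))].

Lemma indisc_autA (A : set M) J (s : nat -> J -> M) t : indisc A s -> aut A t ->
  indisc A (fun k => t \o s k).
Proof.
move=> is_ at_; have AA : A `<=` t @` A by move=> m Am; exists m => //;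
  exact: at_.2.
exact: indiscW AA (indisc_aut is_ at_ (fun _ h => h)).
Qed.

Lemma indisc_params (A : set M) J (s : nat -> J -> M) :
  indisc A s -> indisc A (fun k => vcat (s k) (val : A -> M)).
Proof.
move=> is_ u iu; have [t at_ ts] := is_ u iu; exists t => //.
apply/funext => -[k [j|a]]; rewrite /concat /=.
  by have /(congr1 (fun f => f (k, j))) := ts.
by apply: at_.2; exact/set_mem/valP.
Qed.

(** The elements of [A'] are appended to each member of the sequence as constant coordinates, so
    that they no longer occur as parameters. *)
Lemma set_dividesS (A A' : set M) I (X : set (I -> M)) : small kappa A' ->
  A `<=` A' -> set_divides A' X -> set_divides A X.
Proof.
move=> sA' AA' [J [Y [b [sJ [psi psiP] ib Xb [N bN]]]]].
pose f (z : (I + J) + A') : I + (J + A') := match z with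
  | inl (inl i) => inl i | inl (inr j) => inr (inl j) | inr a =>
    inr (inr a) end.
exists (J + A')%type, [set v : I + (J + A') -> M | holds psi (v \o f)],
  (fun k => vcat (b k) val).
have e x k : holds psi (vcat x (vcat (b k) (val : A' ->
  M)) \o f) <-> Y (vcat x (b k)).
  by rewrite psiP; apply/propeqP; congr holds; apply/funext => -[[i|j]|a].
split.
- by apply: (small_sum kappa_nat kappa_pow) => //; exact/small_setE.
- by exists (fmap (inl \o f) psi) => v; rewrite holds_fmap.
- exact: indiscW AA' (indisc_params ib).
- by move=> x; rewrite Xb -e.
- by exists N => x h; apply: (bN x) => k kN; apply/e; exact: h.
Qed.

Lemma definable_vcat (A B : set M) I J (Y : set (I + J -> M)) (b : J -> M) :
  A `<=` B -> range b `<=` B -> definable A Y -> definable B [set x : I ->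
    M | Y (vcat x b)].
Proof.
move=> AB bB; apply: definable_subst AB _ => -[i|j]; first by left; exists i.
by right; exists (b j) => //; apply: bB; exists j.
Qed.

Lemma compactness_seq (A : set M) I J (Y : set (I + J -> M)) (b : nat -> J ->
  M) :
  small_type kappa I -> small_type kappa J -> small kappa A -> definable A Y ->
  (forall N, exists x, forall k, (k < N)%N -> Y (vcat x (b k))) ->
  exists x, forall k, Y (vcat x (b k)).
Proof.
move=> sI sJ sA dY h.
have [||ls hls|x xP] := @saturation _ _ _ _ hM (A `|` range (concat b)) I
  [set X | exists k, X = [set x | Y (vcat x (b k))]] sI.
- by apply: (small_setU kappa_nat kappa_pow) => //; apply: small_range;
    apply: (small_prod kappa_pow) => //; exact: small_nat kappa_nat.
- move=> _ [k ->]; apply: definable_vcat dY; first exact: subsetUl.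
  by move=> _ [j _ <-]; right; exists (k, j).
- have [|l [l1 l2]] := @In_choice _ _ (fun k X =>
    X = [set x | Y (vcat x (b k))]) ls.
    by move=> X /hls.
  have [N lN] := list_bound l; have [x xN] := h N.
  by exists x => X /l2[k /lN kN ->]; exact: xN.
- by exists x => k; apply: (xP [set x | Y (vcat x (b k))]); exists k.
Qed.

Lemma set_divides_intro (A : set M) I J (Y : set (I + J -> M)) (b : nat -> J ->
  M) :
  small_type kappa I -> small_type kappa J -> small kappa A -> definable A Y ->
    indisc A b ->
  (forall x, ~ forall k, Y (vcat x (b k))) ->
    set_divides A [set x | Y (vcat x (b 0))].
Proof.
move=> sI sJ sA dY ib h; exists J, Y, b; split=> //.
apply: contrapT => n; have [x] : exists x, forall k, Y (vcat x (b k)).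
  apply: compactness_seq sI sJ sA dY _ => N; apply: contrapT => nN.
  by apply: n; exists N => x hx; apply: nN; exists x.
exact: h.
Qed.

(** Dividing passes to smaller sets, and the witness can be made to start with the parameters [d] of
    the smaller set. To this end [d] is carried along the given sequence by automorphisms, an
    indiscernible sequence of pairs is extracted, and its first pair is moved back to
    [vcat (b 0) d]. *)
Lemma set_divides_witness (A : set M) I K (X : set (I -> M)) (Y' : set (I + K ->
  M)) (d : K -> M) :
  small_type kappa I -> small_type kappa K -> small kappa A ->
    set_divides A X ->
  definable A Y' -> (forall x, Y' (vcat x d) -> X x) ->
  exists s, [/\ indisc A s, s 0 = d & forall x, ~ forall k, Y' (vcat x (s k))].
Proof.
move=> sI sK sA [J [Y [b [sJ dY ib Xb [N bN]]]]] dY' Y'X.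
have /choice[r rP] : forall k, exists t, aut A t /\ t \o b 0 = b k.
  move=> k; have [t at_ tb] := ib _ (@increasing_addn k); exists t; split=> //.
  apply/funext => j; have /(congr1 (fun f => f (0, j))) := tb.
  by rewrite /concat /= addn0.
pose t k := vcat (b k) (r k \o d).
have t0 k Z : definable A Z -> Z (vcat (b 0) d) -> Z (t k).
  move=> dZ; have [ar rb] := rP k => /(iffLR (aut_dfn _ ar dZ)).
  by congr (Z _); apply/funext => -[j|x] //=; rewrite -rb.
have [|t' it' t'P] := @extraction_nat _ _ _ _ hM (J + K)%type t A _ sA.
  exact: (small_sum kappa_nat kappa_pow).
have EMP Z k : definable A Z -> Z (vcat (b 0) d) -> Z (t' k).
  move=> dZ Z0; have h := t'P _ (definable_pre (fun z => (k, z)) dZ).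
  have h1 : forall u, increasing u -> [set w : nat * (J + K) ->
    M | Z (w \o (fun z => (k, z)))]
    (concat (t \o u)) by move=> u _; exact: (t0 (u k) Z dZ Z0).
  exact: (h h1).
have [p ap pt] : conjugate A (t' 0) (vcat (b 0) d).
  apply: conjugate_sym; apply: (homogeneous hM) => //;
    first exact: (small_sum kappa_nat kappa_pow).
  by move=> Z dZ; exact: EMP.
exists (fun k => p \o (t' k \o inr)); split.
- by apply: indisc_autA ap; exact: (indisc_pre inr it').
- by apply/funext => k; have /(congr1 (fun f => f (inr k))) := pt.
move=> x xP; have [p' [ap' p'p pp']] := aut_inv ap.
have h k : Y (vcat (p' \o x) (t' k \o inl)).
  (* The inclusion of Y'(x, d) in Y(x, b 0) belongs to the type over [A] of the pair and so holds
     for every extracted pair. *)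
  have imp : ~ exists y : I -> M, Y' (vcat y (t' k \o inr)) /\
    ~ Y (vcat y (t' k \o inl)).
    pose Z : set (J + K -> M) := [set v : J + K -> M | ~ exists y : I -> M,
      Y' (vcat y (v \o inr)) /\ ~ Y (vcat y (v \o inl))].
    suff dZ : definable A Z.
      apply: (EMP Z k dZ) => -[y [h1 h2]]; apply: h2; apply/Xb; apply: Y'X;
        exact: h1.
    apply: definableN; pose f (w : (J + K) + I -> M) (z : I + K) := match z with
        inl i => w (inr i) | inr j => w (inl (inr j)) end.
      pose g (w : (J + K) + I -> M) (z : I + J) := match z with
        inl i => w (inr i) | inr j => w (inl (inl j)) end.
      have df : definable A [set w | Y' (f w) /\ ~ Y (g w)].
        apply: definableI; first by apply: definable_subst dY' => // -[i|j];
          left; [exists (inr i)|exists (inl (inr j))].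
        apply: definableN; by apply: definable_subst dY => // -[i|j]; left;
          [exists (inr i)|exists (inl (inl j))].
      apply: definable_ext (definable_ex df) => v; split=> -[y [h1 h2]];
        exists y; split.
      - by congr Y': h1; apply/funext => -[].
      - by move=> h; apply: h2; congr Y: h; apply/funext => -[].
      - by congr Y': h1; apply/funext => -[].
      - by move=> h; apply: h2; congr Y: h; apply/funext => -[].
  apply: contrapT => nY; apply: imp; exists (p' \o x); split=> //.
  have := iffLR (aut_dfn _ ap' dY') (xP k); congr (Y' _).
  by apply/funext => -[i|j] //=; rewrite p'p.
suff : ~ exists x, forall k, (k < N)%N -> Y (vcat x (t' k \o inl)) by apply;
  exists (p' \o x).
(* Inconsistency of the first [N] sets is a definable property, valid for all subsequences of [b];
   hence extraction preserves it. *)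
pose Z : set (nat * (J + K) -> M) := [set v : nat * (J + K) ->
  M | ~ exists x : I -> M, forall k, (k < N)%N ->
  Y (vcat x (fun j => v (k, inl j)))].
have dZ : definable A Z.
  apply: definableN; pose f (w : nat * (J + K) + I -> M) k (z : I + J) :=
    match z with
    inl i => w (inr i) | inr j => w (inl (k, inl j)) end.
  have df : definable A (cap_list [seq [set w | Y (f w k)] | k <- iota 0 N]).
    apply: definable_cap => X' X'l; have [k _ ->] := In_map X'l.
    by apply: definable_subst dY => // -[i|j]; left;
      [exists (inr i)|exists (inl (k, inl j))].
  apply: definable_ext (definable_ex df) => v; split=> -[y h']; exists y.
    move=> k kN; have : List.In [set w | Y (f w k)] [seq [set w | Y (f w k)] | k
      <- iota 0 N].
      by apply: map_In; apply/InP; rewrite mem_iota.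
    by move=> /h' /=; congr Y; apply/funext => -[].
  move=> X' X'l; have [k /InP] := In_map X'l;
    rewrite mem_iota add0n => kN -> /=.
  by have := h' k kN; congr Y; apply/funext => -[].
apply: (t'P Z dZ) => u iu [y yP]; have [q aq qb] := conjugate_sym (ib u iu).
apply: (bN (q \o y)) => k kN; have := iffLR (aut_dfn _ aq dY) (yP k kN);
  congr (Y _).
by apply/funext => -[i|j] //=; have /(congr1 (fun f => f (k, j))) := qb.
Qed.

(* A global type is represented by an ultrafilter on [I -> M]: the formulas of the
   type are those whose solution set is large. By completeness, such a type forks
   as soon as it contains a dividing set. *)
Definition nonforking (A : set M) I (F : set_system (I -> M)) : Prop :=
  forall X, set_divides A X -> ~ F X.

Lemma nonforkingS (A A' : set M) I (F : set_system (I -> M)) : small kappa A' ->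
  A `<=` A' -> nonforking A F -> nonforking A' F.
Proof. by move=> sA' AA' nF X /(set_dividesS sA' AA')/nF. Qed.

(* [c] realizes the restriction of the global type [F] to [B]. *)
Definition realizes_over (B : set M) I (F : set_system (I -> M)) (c : I ->
  M) : Prop :=
  forall X, definable B X -> F X -> X c.

Lemma realizes_overE B I (F : set_system (I -> M)) c X : UltraFilter F ->
  realizes_over B F c ->
  definable B X -> X c <-> F X.
Proof.
move=> FU cF dX; split; last exact: cF.
move=> Xc; apply: contrapT => nFX; have FnX : F (~` X) by apply/ultraN.
exact: (cF _ (definableN dX) FnX).
Qed.

Lemma realizes_overS B B' I (F : set_system (I -> M)) c : B `<=` B' ->
  realizes_over B' F c -> realizes_over B F c.
Proof. by move=> BB' h X /(definableW BB')/h. Qed.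

Lemma realizes_over_ex B I (F : set_system (I -> M)) : UltraFilter F ->
  small_type kappa I -> small kappa B ->
  exists c, realizes_over B F c.
Proof.
move=> FU sI sB.
have [X []//|l lF|c cP] := @saturation _ _ _ _ hM B I [set X | definable B X /\
  F X] sI sB.
  by apply: (@filter_ex _ F); apply: filter_cap => X /lF[].
by exists c => X dX FX; exact: cP.
Qed.

Lemma realizes_over_eqv B I (F : set_system (I -> M)) c c' : UltraFilter F ->
  small_type kappa I -> small kappa B -> realizes_over B F c ->
    realizes_over B F c' -> conjugate B c c'.
Proof.
move=> FU sI sB cF c'F; apply: (homogeneous hM) => // X dX.
by move=> /(realizes_overE FU cF dX)/c'F; apply.
Qed.

Lemma finite_instances (A : set M) I J (Y : set (I + J -> M)) : definable A Y ->
  exists n (h : 'I_n -> J + A) (psi : formula L (I + 'I_n)),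
    forall x b, Y (vcat x b) <-> holds psi (vcat x (vcat b val \o h)).
Proof.
move=> [psi psiP].
have [n [h [chi chiP]]] := formula_fin_right (fmap (fun z : (I + J) + A =>
  match z with
  | inl (inl i) => inl i | inl (inr j) => inr (inl j) | inr a =>
    inr (inr a) end) psi).
exists n, h, chi => x b; rewrite -chiP psiP holds_fmap.
by apply/propeqP; congr holds; apply/funext => -[[]|].
Qed.

(** The way back to the finite parameter tuples of [divides]: elements of [A] become coordinates, of
    which finitely many are kept. *)
Lemma set_divides_divides (A : set M) I (X : set (I -> M)) : small kappa A ->
  set_divides A X ->
  exists2 phi, divides A phi & forall x, sat x phi <-> X x.
Proof.
move=> sA [J [Y [b [sJ dY ib Xb [N bN]]]]].
have [n [h [psi psiP]]] := finite_instances dY.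
pose b' k := vcat (b k) (val : A -> M) \o h.
exists (subst_params psi (b' 0)); last by move=> x;
  rewrite sat_subst_params -psiP Xb.
exists n, psi, b'; split=> //.
  exact: (iffLR (indiscE hM b' (@small_countType _ kappa_nat _) sA)
    (indisc_pre h (indisc_params ib))).
move=> cons; have [||x xP] := cons ((fun k =>
  subst_params psi (b' k)) @` [set k | (k < N)%N]).
- by apply: finite_image; exact: finite_II.
- by move=> _ [k _ <-]; exists k.
apply: (bN x) => k kN; rewrite psiP -sat_subst_params; apply: xP.
by exists k.
Qed.

Lemma divides_sdiv (A : set M) I (phi : Mformula I) : small kappa A ->
  divides A phi ->
  set_divides A [set x | sat x phi].
Proof.
move=> sA [n [psi [b [-> ib nc]]]].
exists 'I_n, [set v | holds psi v], b; split.
- exact: (small_countType kappa_nat).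
- by exists (fmap inl psi) => v; rewrite holds_fmap.
- exact: (iffRL (indiscE hM b (@small_countType _ kappa_nat _) sA)).
- by move=> x /=; rewrite -sat_subst_params.
apply: contrapT => nN; apply: nc => q /finite_set_list[l lq] qr.
have [|ks [k1 k2]] := @In_choice _ _ (fun k phi =>
  phi = subst_params psi (b k)) l.
  by move=> phi' /lq/qr[k _ <-]; exists k.
have [N kN] := list_bound ks.
have [x xP] : exists x, forall k, (k < N)%N -> holds psi (vcat x (b k)).
  by apply: contrapT => nx; apply: nN; exists N => x hx; apply: nx; exists x.
by exists x => phi' /lq/k2[k /kN/xP hk ->]; rewrite sat_subst_params.
Qed.

(** This is where the extension base enters: if finitely many of the required sets had empty
    intersection, finitely many formulas of tp(d/A) would prove a disjunction of dividing ones. *)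
Lemma nonforking_ultra (A : set M) I (d : I -> M) : extension_base kappa A ->
  small kappa A -> small_type kappa I ->
  exists F : set_system (I -> M), [/\ UltraFilter F, nonforking A F &
    realizes_over A F d].
Proof.
move=> eA sA sI.
have tO : type_over A (tp d A).
  by split=> [phi []//|q _ qd]; exists d => phi /qd[].
have nfork : ~ type_forks A (tp d A) by apply: eA tO; exact/smallTE.
have [|F [FU GF]] := @fip_ultrafilter (I -> M)
  ([set X | definable A X /\ X d] `|` [set Z | exists2 X, set_divides A X &
    Z = ~` X]); last first.
  exists F; split=> // [X dX FX|X dX FX].
    have : F (~` X) by apply: GF; right; exists X.
    by move=> /ultraN.
  by apply: contrapT => nX; have /ultraN : F (~` X) by apply: GF; left;
    split=> //; exact: definableN.
move=> l lG; apply/set0P/negP => /eqP l0; apply: nfork.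
have [l1 [l2 [h1 h2 h12]]] := list_partition lG.
have [|q [q1 q2]] := @In_choice (Mformula I) _ (fun phi X =>
  tp d A phi /\ forall x, sat x phi <-> X x) l1.
  move=> X /h1[[psi psiP] Xd]; exists (subst_params psi val).
  have e x : sat x (subst_params psi val)
    <-> X x by rewrite sat_subst_params psiP.
  by split=> //; split; [exists psi|apply/e].
have [|G [G1 G2]] := @In_choice (Mformula I) _ (fun phi Z =>
  divides A phi /\ forall x, ~ sat x phi -> Z x) l2.
  move=> Z /h2[X /(set_divides_divides sA)[phi dphi e] ->]; exists phi;
    split=> // x.
  by rewrite e.
exists [set phi | List.In phi G]; split; first exact: list_finite.
  by move=> phi /G1[? _ []].
exists [set phi | List.In phi q]; split; first exact: list_finite.
  by move=> phi /q1[? _ []].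
move=> c cq; apply: contrapT => nG.
suff : cap_list l c by rewrite l0.
move=> X /h12[/q2[phi /cq ? [_ <-]]//|/G2[phi phiG [_]]]; apply.
by move=> ?; apply: nG; exists phi.
Qed.

(** Finitely many coordinates matter and the parameters from [A] become coordinates, which leads to
    a parameter-free formula as in [dependent]. The exchange [sw] is due to [has_IP], where the
    tuples indexed by integers come first. *)
Lemma nip (A : set M) I J (Y : set (I + J -> M)) (a : nat -> J ->
  M) (c : set nat -> I -> M) :
  dependent T -> definable A Y -> ~ forall k S, Y (vcat (c S) (a k)) <-> S k.
Proof.
move=> hdep dY h; have [n [g [psi psiP]]] := finite_instances dY.
pose sw X Z (z : X + Z) : Z + X := match z with inl x => inr x | inr z =>
  inl z end.
have [m [g' [chi chiP]]] := formula_fin_right (fmap (@sw I 'I_n) psi).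
apply: (hdep M (monster_model hM) n m chi).
exists (fun k => vcat (a k) val \o g), (fun S => c S \o g') => k S.
rewrite -h psiP; have := chiP M (vcat (a k) val \o g) (c S); rewrite holds_fmap.
rewrite (_ : vcat _ _ \o _ = vcat (c S) (vcat (a k) val \o g));
  last by apply/funext => -[].
move=> ->; apply/propeqP; congr holds; apply/funext => -[] //.
Qed.

(** For a set S, the subsequence taking the term 2k or 2k+1 according to whether k lies in S is
    conjugate to [e]; the automorphism takes [c] to a tuple that cuts out S. *)
Lemma no_alternation (A : set M) I J (Y : set (I + J -> M)) (e : nat -> J ->
  M) c :
  dependent T -> definable A Y -> indisc A e ->
  ~ forall k, Y (vcat c (e k.*2)) /\ ~ Y (vcat c (e k.*2.+1)).
Proof.
move=> hdep dY ie h.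
have /choice[c' c'P] : forall S : set nat, exists c', forall k,
  Y (vcat c' (e k)) <-> S k.
  move=> S; pose v k := if pselect (S k) then k.*2 else k.*2.+1.
  have iv : increasing v.
    by move=> k l kl; rewrite /v; case: pselect => ?; case: pselect => ? /=;
      lia.
  have [s as_ se] := conjugate_sym (ie v iv).
  exists (s \o c) => k; have := aut_dfn (vcat c (e (v k))) as_ dY.
  rewrite (_ : s \o _ = vcat (s \o c) (e k)); last first.
    apply/funext => -[i|j] //=; have /(congr1 (fun f => f (k, j))) := se; exact.
  move=> <-; rewrite /v; case: pselect => Sk /=; first by split=> // _;
    exact: (h k).1.
  by split=> // Yk; case: (h k).2.
exact: (nip hdep dY (fun k S => c'P S k)).
Qed.

End Dividing.

Arguments set_divides {L} kappa {M} A {I} X.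
Arguments nonforking {L} kappa {M} A {I} F.

(** * Non-forking and non-dividing types along indiscernible sequences *)

Section Independence.
Context {L : language} {T : set (sentence L)} {kappa : Type} {M : structure L}.
Hypothesis hM : monster T kappa M.
Hypothesis hdep : dependent T.

Let kappa_nat := monster_uncountable hM.
Let kappa_pow := monster_strong_limit hM.

Lemma definable_initial_right (A : set M) I J (Y : set (nat * J + I ->
  M)) : definable A Y ->
  exists N (Y1 : set (I + 'I_N.+1 * J -> M)), definable A Y1 /\
    forall v c, Y (vcat v c) <-> Y1 (vcat c (fun z => v (val z.1, z.2))).
Proof.
move=> /definable_fin_support[W [u [Y0 [dY0 Y0P]]]].
pose bnd w := match u w with inl z => z.1 | inr _ => 0 end.
pose N := \sum_w bnd w.
have /choice[g gP] : forall w, exists t : I + 'I_N.+1 * J, forall (v :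
  nat * J -> M) c,
    vcat v c (u w) = vcat c (fun z => v (val z.1, z.2)) t.
  move=> w; case E: (u w) => [[k j]|i]; last by exists (inl i).
  have kN : (k < N.+1)%N.
    have -> : k = bnd w by rewrite /bnd E.
    by rewrite ltnS /N (bigD1 w) //= leq_addr.
  by exists (inr (Ordinal kN, j)).
exists N, [set x : I + 'I_N.+1 * J -> M | Y0 (x \o g)]; split;
  first exact: (definable_pre g dY0).
move=> v c; rewrite Y0P; apply/propeqP; congr Y0; apply/funext => w /=;
  exact: gP.
Qed.

Lemma indisc_blocks (A : set M) J (s : nat -> J -> M) n : indisc A s ->
  indisc A (fun i (z : 'I_n.+1 * J) => s (i * n.+1 + z.1)%N z.2).
Proof.
(* [v] moves the block [i] onto the block [u i] and keeps the position within the block. *)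
move=> is_ u iu; pose v t := (u (t %/ n.+1) * n.+1 + t %% n.+1)%N.
have iv : increasing v.
  move=> t t' tt'; rewrite /v.
  have [e|lt] : (t %/ n.+1 = t' %/ n.+1)%N \/ (t %/ n.+1 < t' %/ n.+1)%N.
    by have := leq_div2r n.+1 (ltnW tt'); rewrite leq_eqVlt => /predU1P[]; auto.
    rewrite e ltn_add2l.
    by have := divn_eq t n.+1; have := divn_eq t' n.+1; rewrite e; lia.
  have := iu _ _ lt; rewrite -(leq_pmul2r (ltn0Sn n)) mulSn.
  by have := ltn_pmod t (ltn0Sn n); lia.
have [r ar rs] := is_ v iv; exists r => //; apply/funext => -[i [k j]].
have /(congr1 (fun f => f (i * n.+1 + k, j)%N)) := rs; rewrite /concat /= => ->.
by rewrite /v divnMDl // (divn_small (ltn_ord k))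
  addn0 modnMDl (modn_small (ltn_ord k)).
Qed.

(* Non-forking types do not split along indiscernible sequences: a formula of
   [F] with different truth values at two increasing tuples could be made to
   alternate along a whole indiscernible sequence, which contradicts NIP. *)
Lemma indisc_realize (A : set M) I J (F : set_system (I -> M)) (s : nat -> J ->
  M) c :
  UltraFilter F -> nonforking kappa A F -> small_type kappa I ->
    small_type kappa J -> small kappa A ->
  indisc A s -> realizes_over (A `|` range (concat s)) F c ->
    indisc (A `|` range c) s.
Proof.
move=> FU nF sI sJ sA is_ cF u iu.
have sIJ : small_type kappa (nat * J) by apply: (small_prod kappa_pow) => //;
  exact: small_nat kappa_nat.
apply: (homogeneous hM) => //; first by apply:
  (small_setU kappa_nat kappa_pow) => //; exact: small_range.
move=> X /definable_split[Y [/definable_initial_right[n [Y1 [dY1 Y1P]]] XY]].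
move=> /XY/Y1P Ys; apply/XY/Y1P; apply: contrapT => nYu.
pose blk (g : nat -> nat) (z : 'I_n.+1 * J) := s (g z.1) z.2.
have Fblk (Z : set (I + 'I_n.+1 * J -> M)) g : definable A Z ->
  Z (vcat c (blk g)) ->
    F [set x | Z (vcat x (blk g))].
  move=> dZ; have gs : range (blk g) `<=` A `|` range (concat s).
    by move=> _ [[k j] _ <-]; right; exists (g k, j).
  exact: (iffLR (realizes_overE FU cF (definable_vcat (@subsetUl _ _ _)
    gs dZ))).
have F1 : F [set x | Y1 (vcat x (blk id))] by exact: Fblk.
have F2 : F [set x | ~ Y1 (vcat x (blk u))] by exact:
  (Fblk _ _ (definableN dY1)).
(* [w] lies beyond both tuples; whichever truth value [F] gives at [w], it differs from the one at
   [id] or from the one at [u]. *)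
pose w k := (u n.+1 + n.+1 + k)%N.
suff key (Z : set (I + 'I_n.+1 * J -> M)) g : definable A Z -> increasing g ->
    (forall k, (k < n.+1)%N -> (g k < u n.+1)%N) ->
    F [set x | Z (vcat x (blk g))] -> F [set x | ~ Z (vcat x (blk w))] -> False.
  have [Fw|Fw] := in_ultra_setVsetC [set x | Y1 (vcat x (blk w))] FU.
    apply: (key _ u (definableN dY1) iu) => //; first by move=> k; exact: iu.
    by apply: filterS Fw => x h nh; exact: nh.
  apply: (key Y1 id dY1) => //; move=> k kn1;
    exact: leq_trans kn1 (increasing_ge _ iu).
move=> {Ys nYu F1 F2} dZ ig gN Fg Fw.
(* [h] starts with the block [g] and jumps beyond [u n.+1], so that its second block is [w]. *)
pose h t := if (t < n.+1)%N then g t else (u n.+1 + t)%N.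
have ih : increasing h.
  move=> k l kl; rewrite /h; case: ifP => kn1; case: ifP => ln1.
  - exact: ig.
  - by have := gN _ kn1; lia.
  - by lia.
  - by lia.
pose e i (z : 'I_n.+1 * J) := s (h (i * n.+1 + z.1)%N) z.2.
have ie : indisc A e by apply: (@indisc_blocks A J (s \o h)); exact: indisc_inc.
have e0 : e 0 = blk g by apply/funext => -[k j];
  rewrite /e /blk /= /h mul0n add0n ltn_ord.
have e1 : e 1 = blk w.
  apply/funext => -[k j]; rewrite /e /blk /= /h /w mul1n ltnNge leq_addr /=.
  by congr (s _ j); lia.
(* Consecutive blocks are paired, and [Z2] says that [Z] holds at the first and fails at the second.
   A common solution along all pairs would alternate; without one, Z2(x, p 0) divides over [A]
   although it lies in [F]. *)
pose p i (z : 'I_2 * ('I_n.+1 * J)) := e (i * 2 + z.1)%N z.2.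
have ip : indisc A p by exact: indisc_blocks.
pose Z2 := [set v : I + 'I_2 * ('I_n.+1 * J) -> M |
  Z (vcat (v \o inl) (fun z => v (inr (ord0, z)))) /\
  ~ Z (vcat (v \o inl) (fun z => v (inr (ord_max, z))))].
have dZ2 : definable A Z2.
  apply: definableI; last apply: definableN.
    apply: definable_subst dZ => // -[i|z]; left;
      [by exists (inl i)|by exists (inr (ord0, z))].
  apply: definable_subst dZ => // -[i|z]; left;
    [by exists (inl i)|by exists (inr (ord_max, z))].
have [[x xP]|nx] := pselect (exists x, forall k, Z2 (vcat x (p k))).
  apply: (no_alternation hM (c := x) hdep dZ ie) => k.
  have := xP k; rewrite /Z2 /= /p /=; rewrite addn0 addn1 muln2 => -[Zk nZk].
  by split.
apply: (nF [set x | Z2 (vcat x (p 0))]).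
  apply: (set_divides_intro hM) => //.
    by apply: (small_prod kappa_pow); [exact:
      (@small_countType _ kappa_nat)|apply: (small_prod kappa_pow) => //;
      exact: (@small_countType _ kappa_nat)].
  by move=> x xP; apply: nx; exists x.
apply: filterS (filterI Fg Fw) => x [Zg nZw].
by rewrite /Z2 /= /p /= mul0n !add0n -/(e 0) -/(e 1) e0 e1.
Qed.

(** Non-dividing gives one [t'] related to every [s k] as [t] is to [c]. A sequence extracted from
    [s] and indiscernible over [t'] keeps this relation and the type of [s] over [A]; then [t'] and
    its first term can be moved to [t] and [c]. *)
Lemma indisc_nondividing (A : set M) J K (t : K -> M) (c : J -> M) (s : nat ->
  J -> M) :
  small_type kappa J -> small_type kappa K -> small kappa A ->
  (forall Y : set (K + J -> M), definable A Y -> Y (vcat t c) ->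
    ~ set_divides kappa A [set y | Y (vcat y c)]) ->
  indisc A s -> s 0 = c ->
  exists2 r, aut (A `|` range c) r & indisc (A `|` range t) (fun k => r \o s k).
Proof.
move=> sJ sK sA nd is_ s0.
have sJn : small_type kappa (nat * J) by apply: (small_prod kappa_pow) => //;
  exact: small_nat kappa_nat.
have [||ls hls|t' t'P] := @saturation _ _ _ _ hM (A `|` range (concat s)) K
  [set X | exists (k : nat) (Y : set (K + J ->
    M)), [/\ definable A Y, Y (vcat t c) &
    X = [set y | Y (vcat y (s k))]]] sK.
- by apply: (small_setU kappa_nat kappa_pow) => //; exact: small_range.
- move=> _ [k [Y [dY _ ->]]]; apply: definable_vcat dY; first exact: subsetUl.
  by move=> _ [j _ <-]; right; exists (k, j).
- have [|l [l1 l2]] := @In_choice (nat * set (K + J -> M)) _ (fun z X =>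
      [/\ definable A z.2, z.2 (vcat t c) &
        X = [set y | z.2 (vcat y (s z.1))]]) ls.
    by move=> X /hls[k [Y h]]; exists (k, Y).
  pose Y := cap_list (map snd l).
  have Yl X' : List.In X' (map snd l) -> definable A X' /\ X' (vcat t c).
    by move=> X'l; have [[k Y'] /l1[X _ [/= dY' Y't _]] ->] := In_map X'l.
  have dY : definable A Y by apply: definable_cap => X' /Yl[].
  have [[x xP]|nx] := pselect (exists x, forall k, Y (vcat x (s k))).
    exists x => X /l2[[k Y'] kl [_ _ ->]]; apply: (xP k);
      exact: (map_In snd kl).
  case: (nd Y dY); first by move=> X' /Yl[].
  rewrite -s0; apply: (set_divides_intro hM) => // x xP; apply: nx; by exists x.
have {}t'P k (Y : set (K + J -> M)) : definable A Y -> Y (vcat t c) ->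
  Y (vcat t' (s k)).
  by move=> dY Yt; apply: (t'P [set y | Y (vcat y (s k))]); exists k, Y.
have sAt : small kappa (A `|` range t') by apply:
  (small_setU kappa_nat kappa_pow) => //; exact: small_range.
have [s' is' s'P] := @extraction_nat _ _ _ _ hM J s _ sJ sAt.
have [r0 ar0 r0s] : conjugate A (concat s) (concat s').
  apply: (homogeneous hM) => // X dX Xs;
    apply: (s'P X (definableW (@subsetUl _ _ _) dX)) => u iu.
  exact: (iffLR (conjugate_dfn (is_ u iu) dX) Xs).
have [r ar rt] : conjugate A (vcat t' (s' 0)) (vcat t c).
  apply: conjugate_sym; apply: (homogeneous hM) => //;
    first exact: (small_sum kappa_nat kappa_pow).
  move=> X dX Xt; apply: (s'P [set x : nat * J -> M | X (vcat t' (fun j =>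
    x (0, j)))]).
    apply: definable_subst dX; first exact: subsetUl.
    by move=> [k|j]; [right; exists (t' k) => //; right; exists k|left;
      exists (0, j)].
  by move=> u iu; exact: (t'P (u 0) X dX Xt).
exists (r \o r0).
  split; first exact: (aut_comp ar ar0).1.
  move=> m [Am|[j _ <-]] /=; first by rewrite ar0.2 // ar.2.
  have := congr1 (fun f => f (0, j)) r0s; rewrite /concat /= s0 => ->.
  exact: (congr1 (fun f => f (inr j)) rt).
have e : (fun k => r \o s' k) = (fun k => (r \o r0) \o s k).
  apply/funext => k; apply/funext => j /=; congr r.
  by have := congr1 (fun f => f (k, j)) r0s; rewrite /concat /= => ->.
rewrite -e; apply: indiscW (indisc_aut is' ar (@subsetUl _ _ _)).
move=> m [Am|[k _ <-]]; first by exists m; [left|exact: ar.2].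
exists (t' k); first by right; exists k.
exact: (congr1 (fun f => f (inl k)) rt).
Qed.

End Independence.

(** * Coheirs and quasi-dividing *)

Lemma dependent_choice_seq X (P : seq X -> X -> Prop) :
  (forall l, exists x, P l x) -> exists f : nat ->
    X, forall n, P (mkseq f n) (f n).
Proof.
move=> /choice[g gP].
pose pre := fix pre n := if n is n'.+1 then rcons (pre n') (g (pre n'))
  else [::].
exists (fun n => g (pre n)) => n.
suff -> : mkseq (fun n => g (pre n)) n = pre n by exact: gP.
by elim: n => //= n IH; rewrite mkseqS IH.
Qed.

Lemma mkseq_In X (f : nat -> X) n k : (k < n)%N -> List.In (f k) (mkseq f n).
Proof. by move=> kappa_nat; apply: map_In; apply/InP; rewrite mem_iota. Qed.

Lemma total_ultra X (F : set_system X) : ProperFilter F ->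
  (forall A, F A \/ F (~` A)) -> UltraFilter F.
Proof.
move=> FP tot; split=> // G GP FG; apply/seteqP; split=> A; last exact: FG.
move=> GA; have [//|/FG GnA] := tot A.
by have [x []] := filter_ex (filterI GA GnA).
Qed.

Section Coheirs.
Context {L : language} {T : set (sentence L)} {kappa : Type} {M : structure L}.
Hypothesis hM : monster T kappa M.

Let kappa_nat := monster_uncountable hM.
Let kappa_pow := monster_strong_limit hM.

Lemma definable_aut_pre (B B' : set M) t V (X : set (V ->
  M)) : automorphism t ->
  (forall m, B m -> exists2 m', B' m' & t m' = m) -> definable B X ->
  definable B' [set v | X (t \o v)].
Proof.
move=> ta BB' [psi psiP].
have /choice[g gP] : forall b : B, exists b' : B', t (val b') = val b.
  move=> b; have [m' B'm' e] := BB' _ (set_mem (valP b)).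
  by exists (SigSub (mem_set B'm')).
exists (fmap (fun z : V + B => match z with inl v => inl v | inr b =>
  inr (g b) end) psi).
move=> v; rewrite /= psiP holds_fmap [X in _ <-> X](holds_aut _ _ ta).
by apply/propeqP; congr holds; apply/funext => -[//|b] /=; rewrite gP.
Qed.

Lemma indisc_elt (B : set M) J (s : nat -> J -> M) (X : set (J -> M)) k :
  indisc B s -> definable B X -> X (s k) <-> X (s 0).
Proof.
move=> is_ dX; have [t at_ ts] := is_ _ (@increasing_addn k).
rewrite [X in _ <-> X](aut_dfn _ at_ dX) (_ : t \o s 0 = s k) //.
by apply/funext => j; have := congr1 (fun f => f (0, j)) ts;
  rewrite /concat /= addn0.
Qed.

Lemma small_list J (l : seq (J -> M)) : small_type kappa J ->
  small kappa [set m | exists2 y, List.In y l & exists j, m = y j].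
Proof.
move=> sJ; elim: l => [|y l IH].
  apply: (@small_sub _ _ _ (range (of_void M))); first by move=> m [y []].
  by apply: small_range; exact: (@small_countType _ kappa_nat void).
apply: (@small_sub _ _ _ _ _ (small_setU kappa_nat kappa_pow (@small_range kappa
  J M y sJ) IH)).
move=> m [y' [<-|y'l] [j ->]]; first by left; exists j.
by right; exists y' => //; exists j.
Qed.

Section Base.
Variable N : set M.
Hypothesis sN : small kappa N.

(* An ultrafilter concentrated on tuples from [N] is fixed by Aut(M/N). *)
Definition coheir I (F : set_system (I -> M)) : Prop :=
  F [set x | forall i, N (x i)].

Lemma coheir_inv I (F : set_system (I -> M)) t X : UltraFilter F -> coheir F ->
  aut N t -> F X <-> F [set x | X (t \o x)].
Proof.
move=> FU cF [_ tN].
have e (x : I -> M) : (forall i, N (x i)) -> t \o x = x.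
  by move=> Nx; apply/funext => i /=; exact: tN.
have h A B : (forall x, (forall i, N (x i)) -> A x -> B x) -> F A -> F B.
  have cF' : F [set x | forall i, N (x i)] by exact: cF.
  by move=> AB FA; apply: filterS (filterI cF' FA) => x [Nx]; exact: AB.
by split; apply: h => x Nx; rewrite /= (e _ Nx).
Qed.

Lemma realizes_over_aut I (F : set_system (I -> M)) E t c : UltraFilter F ->
  coheir F ->
  aut N t -> realizes_over (N `|` E) F c ->
    realizes_over (N `|` t @` E) F (t \o c).
Proof.
move=> FU cF at_ cE X dX FX; apply: (cE [set x | X (t \o x)]).
  apply: definable_aut_pre dX; first exact: at_.1.
  move=> m [Nm|[m' Em' <-]]; first by exists m; [left|exact: at_.2].
  by exists m' => //; right.
exact: (iffLR (coheir_inv _ FU cF at_) FX).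
Qed.

(** The type of [C] over [N] and [D] is finitely satisfiable in [N], stated for tuples of any length
    from [C]. *)
Definition fin_sat (C D : set M) : Prop := forall V (c : V -> M) (X : set (V ->
  M)),
  range c `<=` C -> definable (N `|` D) X -> X c ->
    exists2 z, range z `<=` N & X z.

Lemma fin_satS C C' D D' : C' `<=` C -> D' `<=` D -> fin_sat C D ->
  fin_sat C' D'.
Proof.
move=> CC DD h V c X cC dX; apply: h; first exact: subset_trans CC.
by apply: definableW dX; exact: setUS.
Qed.

Lemma fin_sat0 D : fin_sat set0 D.
Proof. by move=> V c X c0 _ Xc; exists c => // m /c0. Qed.

(** The coordinates in [C'] are replaced by elements of [N] while those in [C] act as parameters;
    the latter are replaced afterwards, with the new elements of [N] as parameters. *)
Lemma fin_sat_trans C C' D : fin_sat C D -> fin_sat C' (D `|` C) ->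
  fin_sat (C `|` C') D.
Proof.
move=> h h' V c X cC dX Xc.
pose V' := {v | C' (c v)}.
pose f (z : V' -> M) v := match pselect (C' (c v)) with
  left h => z (exist _ v h) | right _ => c v end.
have [|||z zN Xz] := h' V' (fun v => c (sval v)) [set z | X (f z)].
- by move=> _ [[v C'v] _ <-].
- apply: definable_subst dX; first by move=> m [Nm|Dm]; [left|right; left].
  move=> v; rewrite /f; case: pselect => [h1|nC]; first by left;
    exists (exist _ v h1).
  right; exists (c v) => //; right; right.
  by have [|//|//] := cC (c v); exists v.
- rewrite /= (_ : f _ = c); first exact: Xc.
  by apply/funext => v; rewrite /f; case: pselect.
pose V1 := {v | ~ C' (c v)}.
pose g (y : V1 -> M) v := match pselect (C' (c v)) with
  left h => z (exist _ v h) | right h => y (exist _ v h) end.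
have [|||y yN Xy] := h V1 (fun v => c (sval v)) [set y | X (g y)].
- by move=> _ [[v nC'v] _ <-]; have [|//|//] := cC (c v); exists v.
- apply: definable_subst dX => // v; rewrite /g; case: pselect => h1;
    last by left; exists (exist _ v h1).
  by right; exists (z (exist _ v h1)) => //; left; apply: zN;
    exists (exist _ v h1).
- rewrite /= (_ : g _ = f z); first exact: Xz.
  apply/funext => v; rewrite /f /g.
  by case: (pselect (C' (c v))).
exists (g y) => // _ [v _ <-]; rewrite /g; case: pselect => h1.
  by apply: zN; exists (exist _ v h1).
by apply: yN; exists (exist _ v h1).
Qed.

Lemma fin_sat_rlz I (F : set_system (I -> M)) D c : UltraFilter F -> coheir F ->
  realizes_over (N `|` D) F c -> fin_sat (range c) D.
Proof.
move=> FU cF cD V v X vc dX Xv.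
have /choice[h hP] : forall x, exists i, c i = v x.
  by move=> x; have [|i _ e] := vc (v x); [exists x|exists i].
have vch : v = c \o h by apply/funext => x /=; rewrite hP.
have FX : F [set x : I -> M | X (x \o h)].
  by apply/(realizes_overE FU cD (definable_pre h dX)); rewrite /= -vch.
have cF' : F [set x | forall i, N (x i)] by exact: cF.
have [x [xN Xx]] := filter_ex (filterI cF' FX).
by exists (x \o h) => // _ [y _ <-]; exact: xN.
Qed.

Definition before J (d : nat -> J -> M) (l : nat) : set M :=
  [set m | exists l' j, (l' < l)%N /\ m = d l' j].

Lemma before_le J (d : nat -> J -> M) l l' : (l <= l')%N ->
  before d l `<=` before d l'.
Proof. by move=> ll' m [k [j [kl ->]]]; exists k, j;
  rewrite (leq_trans kl). Qed.

Lemma small_before J (d : nat -> J -> M) l : small_type kappa J ->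
  small kappa (before d l).
Proof.
move=> sJ; apply: (@small_sub _ _ _ (range (concat d))).
  by move=> m [k [j [_ ->]]]; exists (k, j).
by apply: small_range; apply: (small_prod kappa_pow) => //;
  exact: small_nat kappa_nat.
Qed.

Definition morley J (F : set_system (J -> M)) (d : nat -> J -> M) : Prop :=
  forall l, realizes_over (N `|` before d l) F (d l).

Section Morley.
Variables (J : Type) (F : set_system (J -> M)).
Hypotheses (sJ : small_type kappa J) (FU : UltraFilter F) (cF : coheir F).

Lemma morley_aut t d : aut N t -> morley F d -> morley F (fun l => t \o d l).
Proof.
move=> at_ md l; apply: realizes_overS (realizes_over_aut FU cF at_ (md l));
  apply: setUS.
by move=> m [k [j [kl ->]]]; exists (d k j) => //; exists k, j.
Qed.

Lemma morley_ex : exists d, morley F d.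
Proof.
have [l|d dP] := @dependent_choice_seq (J -> M) (fun l x =>
    realizes_over (N `|` [set m | exists2 y, List.In y l & exists j,
      m = y j]) F x).
  by apply: (realizes_over_ex hM) => //;
    apply: (small_setU kappa_nat kappa_pow) => //; exact: small_list.
exists d => l; apply: realizes_overS (dP l); apply: setUS => m [k [j [kl ->]]].
by exists (d k); [exact: mkseq_In|exists j].
Qed.

(** Initial segments are matched by automorphisms that depend on [k]; homogeneity turns this into
    one automorphism for the whole sequences in [morley_eqv]. *)
Lemma morley_unique d e : morley F d -> morley F e ->
  forall k, exists2 t, aut N t & forall l, (l < k)%N -> t \o d l = e l.
Proof.
move=> md me; elim=> [|k [t at_ tde]]; first by exists id; [exact: aut_id|].
have sNe : small kappa (N `|` before e k) by apply:
  (small_setU kappa_nat kappa_pow) => //; exact: small_before.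
have te : before e k `<=` t @` before d k.
  by move=> m [l [j [lk ->]]]; rewrite -(tde _ lk); exists (d l j) => //;
    exists l, j.
have [r ar rde] : conjugate (N `|` before e k) (t \o d k) (e k).
  apply: (realizes_over_eqv hM FU) => //;
    apply: realizes_overS (realizes_over_aut FU cF at_ (md k)); exact: setUS.
exists (r \o t); first by apply: aut_comp at_; apply: autW ar; exact: subsetUl.
move=> l; rewrite ltnS leq_eqVlt => /predU1P[->//|lk].
rewrite -(tde _ lk); apply/funext => j /=; apply: ar.2; right.
by have := congr1 (fun f => f j) (tde _ lk) => /= ->; exists l, j.
Qed.

Lemma morley_eqv d e : morley F d -> morley F e ->
  conjugate N (concat d) (concat e).
Proof.
move=> md me; apply: (homogeneous hM) => //.
  by apply: (small_prod kappa_pow) => //; exact: small_nat kappa_nat.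
move=> X /definable_initial[k [Y [dY XY]]] /XY Yd; apply/XY.
have [t at_ tde] := morley_unique md me k.
have := iffLR (aut_dfn _ at_ dY) Yd; congr (Y _); apply/funext => -[l j] /=.
by rewrite /concat /= -tde.
Qed.

Lemma morley_from d0 : realizes_over N F d0 -> exists2 d, morley F d & d 0 = d0.
Proof.
move=> d0F; have [e me] := morley_ex.
have [t at_ te] : conjugate N (e 0) d0.
  by apply: (realizes_over_eqv hM FU) => //; apply: realizes_overS (me 0);
    exact: subsetUl.
by exists (fun l => t \o e l) => //; exact: morley_aut.
Qed.

(** This lets the broom argument keep the later members as parameters while it treats [d l]. It
    follows from transitivity, adding one later member at a time. *)
Lemma fin_sat_morley d l k : morley F d ->
  fin_sat [set m | exists q j, [/\ (l < q)%N, (q < k)%N &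
    m = d q j]] (before d l.+1).
Proof.
move=> md; elim: k => [|k IH].
  by apply: (fin_satS _ _ (@fin_sat0 (before d l.+1))) => // m [q [j []]].
have [lk|kl] := ltnP l k; last first.
  by apply: fin_satS IH => // m [q [j [lq qk ->]]]; exists q, j; split=> //;
    lia.
have h : fin_sat (range (d k)) (before d l.+1 `|`
    [set m | exists q j, [/\ (l < q)%N, (q < k)%N & m = d q j]]).
  apply: fin_satS (fin_sat_rlz FU cF (md k)) => // m [|[q [j [_ qk ->]]]];
    first exact: before_le.
  by exists q, j.
apply: fin_satS (fin_sat_trans IH h) => // m [q [j [lq + ->]]].
rewrite ltnS leq_eqVlt => /predU1P[->|qk]; first by right; exists j.
by left; exists q, j.
Qed.

(** The parameters [C] of the broom argument must stay finitely satisfiable when [d0] is multiplied.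
    A coheir [p] extending tp(C/N d0) achieves this: being invariant over [N], it does not
    distinguish the members of the sequence. *)
Lemma morley_extend C d0 : small kappa C -> fin_sat C (range d0) ->
  realizes_over N F d0 ->
  exists d, [/\ morley F d, d 0 = d0, fin_sat C (range (concat d)) &
    forall l, conjugate (N `|` C) d0 (d l)].
Proof.
move=> sC fC d0F; have [e me e0] := morley_from d0F.
have sCT : small_type kappa C by exact/small_setE.
have sJn : small_type kappa (nat * J) by apply: (small_prod kappa_pow) => //;
  exact: small_nat kappa_nat.
have rC : range (val : C -> M) = C.
  apply/seteqP; split=> [_ [c _ <-]|m Cm]; first exact/set_mem/valP.
  by exists (SigSub (mem_set Cm)).
have [|p [pU Gp]] := @fip_ultrafilter (C -> M)
    ([set X | definable (N `|` range d0) X /\ X val] `|` [set [set x | forall i,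
      N (x i)]]).
  move=> l /list_partition[l1 [l2 [h1 h2 h12]]].
  have [|||z zN cz] := fC C val (cap_list l1).
  - by rewrite rC.
  - by apply: definable_cap => X /h1[].
  - by move=> X /h1[].
  exists z => X /h12[/cz//|/h2 ->] c.
  by apply: zN; exists c.
have cp : coheir p by apply: Gp; right.
have vp : realizes_over (N `|` range d0) p val.
  move=> X dX pX; apply: contrapT => nX.
  have : p (~` X) by apply: Gp; left; split=> //; exact: definableN.
  by move=> /ultraN.
have sNd : small kappa (N `|` range d0) by apply:
  (small_setU kappa_nat kappa_pow) => //; exact: small_range.
(* [C] is given and has to stay, so a realization [c] over the sequence [e] is moved to [C]; [e]
   moves along, with [d0] fixed. *)
have [c cP] := @realizes_over_ex _ _ _ _ hM (N `|` range (concat e)) _ p pU sCT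
  (small_setU kappa_nat kappa_pow sN (small_range (f := concat e) sJn)).
have [t at_ tc] : conjugate (N `|` range d0) c val.
  apply: (realizes_over_eqv hM pU) => //; apply: realizes_overS cP;
    apply: setUS => _ [j _ <-].
  by rewrite -e0; exists (0, j).
have atN : aut N t by apply: autW at_; exact: subsetUl.
have vP : realizes_over (N `|` range (concat (fun l => t \o e l))) p val.
  rewrite -tc; apply: realizes_overS (realizes_over_aut pU cp atN cP);
    apply: setUS => _ [[l j] _ <-].
  by exists (e l j) => //; exists (l, j).
have mte := morley_aut atN me.
have te0 : t \o e 0 = d0.
  by rewrite e0; apply/funext => j /=; apply: at_.2; right; exists j.
exists (fun l => t \o e l); split=> //; first by rewrite -rC;
  exact: fin_sat_rlz vP.
move=> l; apply: (homogeneous hM) => //;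
  first exact: (small_setU kappa_nat kappa_pow).
move=> X; rewrite -{1}rC => /definable_split[Y [dY XY]] /XY Yd; apply/XY.
have [r ar rd] : conjugate N d0 (t \o e l).
  by apply: (realizes_over_eqv hM FU) => //; apply: realizes_overS (mte l);
    exact: subsetUl.
pose Z d : set (C -> M) := [set z | Y (vcat d z)].
have dZ k : definable (N `|` range (concat (fun l => t \o e l))) (Z (t \o e k)).
  apply: definable_subst dY; first exact: subsetUl.
  move=> [j|x]; last by left; exists x.
  by right; exists (t (e k j)) => //; right; exists (k, j).
have {}Yd : Z (t \o e 0) val by rewrite te0.
apply: (iffRL (realizes_overE pU vP (dZ l))).
apply/(coheir_inv _ pU cp ar).
have := iffLR (realizes_overE pU vP (dZ 0)) Yd; rewrite te0.
apply: filterS => z /= /(iffLR (aut_dfn _ ar dY)); congr (Y _).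
by apply/funext => -[j|x] //=; exact: (congr1 (fun f => f j) rd).
Qed.

End Morley.
End Base.
End Coheirs.

(** * The broom argument *)

Section Broom.
Context {L : language} {T : set (sentence L)} {kappa : Type} {M : structure L}.
Hypothesis hM : monster T kappa M.

Let kappa_nat := monster_uncountable hM.
Let kappa_pow := monster_strong_limit hM.

Variables (N : set M) (I J : Type) (n : nat).
Variables (r : nat -> set_system (J -> M)) (Phi : nat -> (J -> M) -> set (I ->
  M)).
Hypotheses (sN : small kappa N) (sJ : small_type kappa J).
Hypothesis rU : forall i, UltraFilter (r i).
Hypothesis rN : forall i, (i < n)%N -> coheir N (r i).
Hypothesis r_agree : forall i j X, (i < n)%N -> (j < n)%N -> definable N X ->
  r i X -> r j X.
Hypothesis Phi_aut : forall i t d x, (i < n)%N -> aut N t ->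
  Phi i d x -> Phi i (t \o d) (t \o x).
Hypothesis r_inc : forall i d, (i < n)%N -> morley N (r i) d ->
  exists k, forall x, ~ forall l, (l < k)%N -> Phi i (d l) x.
Variable E : set_system (I -> M).
Hypothesis EF : Filter E.
Hypothesis E_aut : forall t X, aut N t -> E X -> E [set x | X (t \o x)].

(* The induction removes the formulas [Phi i] one by one, from an arbitrary
   realization [d] of the common type of the [r i], at the expense of
   multiplying [d] to a Morley sequence, whose members are then treated one
   after the other, keeping the later ones as parameters. *)
Lemma broom j : (j <= n)%N -> forall (C : set M) (Psi : set (I -> M)) (d : J ->
  M),
  small kappa C -> fin_sat N C (range d) -> (forall i, (i < n)%N ->
    realizes_over N (r i) d) ->
  (forall t x, aut (N `|` C) t -> Psi x -> Psi (t \o x)) ->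
  E [set x | Psi x \/ exists2 i, (i < j)%N & Phi i d x] -> E Psi.
Proof.
elim: j => [|j IH] jn C Psi d sC fC dr PsiC EPsi.
  by apply: filterS EPsi => x [//|[]].
have [D [mD D0 fD Dd]] := morley_extend hM sN sJ (rU j) (rN jn) sC fC (dr j jn).
have [k kP] := r_inc jn mD.
(* [D l] has the type of [d] over [N] and [C]; as [Psi] is invariant over these and [E] over [N],
   the hypothesis about [d] holds for [D l]. *)
have ED l : E [set x | Psi x \/ exists2 i, (i < j.+1)%N & Phi i (D l) x].
  have [t at_ td] := conjugate_sym (Dd l).
  have [t' [at' tt' t't]] := aut_inv at_.
  have atN : aut N t by apply: autW at_; exact: subsetUl.
  have atN' : aut N t' by apply: autW at'; exact: subsetUl.
  have td' : t' \o d = D l by rewrite -td; apply/funext => y /=; rewrite tt'.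
  have ttx x : t' \o (t \o x) = x :> (I -> M) by apply/funext => y /=;
    rewrite tt'.
  apply: filterS (E_aut atN EPsi) => x [/(PsiC _ _ at')|[i ij]]; rewrite ?ttx.
    by left.
  move=> /(Phi_aut (leq_trans ij jn) atN'); rewrite td' ttx; by right; exists i.
have Dr l i : (i < n)%N -> realizes_over N (r i) (D l).
  move=> ni X dX riX; have : realizes_over N (r j) (D l) by apply:
    realizes_overS (mD l); exact: subsetUl.
  by apply => //; exact: r_agree riX.
pose rest l0 := [set x : I -> M | Psi x \/
  exists i l, [/\ (i < j)%N, (l0 <= l)%N, (l < k)%N & Phi i (D l) x]].
(* [Phi j] cannot hold at all [D l] with [l < k], so at one of them a formula of smaller index
   holds, or else [Psi]. *)
have step : E (rest 0).
  have : E (cap_list [seq [set x | Psi x \/ exists2 i, (i < j.+1)%N &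
    Phi i (D l) x] | l <- iota 0 k]).
    by apply: filter_cap => X X'l; have [l _ ->] := In_map X'l; exact: ED.
  apply: filterS => x cx; apply: contrapT => nx; apply: (kP x) => l lk.
  have : List.In [set x | Psi x \/ exists2 i, (i < j.+1)%N & Phi i (D l) x]
     [seq [set x | Psi x \/ exists2 i, (i < j.+1)%N &
       Phi i (D l) x] | l <- iota 0 k].
    by apply: (map_In (fun l => [set x | Psi x \/ exists2 i, (i < j.+1)%N &
      Phi i (D l) x]));
      apply/InP; rewrite mem_iota.
  move=> /cx[Px|[i]]; first by case: nx; left.
  rewrite ltnS leq_eqVlt => /predU1P[->//|ij] h.
  by case: nx; right; exists i, l.
suff main l0 : (l0 <= k)%N -> E (rest l0).
  by apply: filterS (main k (leqnn k)) => x [//|[i [l [_ kl lk _]]]]; lia.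
elim: l0 => [//|l0 IHl] l0k.
(* The members after [l0] become parameters: what [rest] says about them is absorbed in [Psi], and
   the induction on [j] removes the formulas at [D l0]. *)
pose C' := [set m | exists q y, [/\ (l0 < q)%N, (q < k)%N & m = D q y]].
have sC' : small kappa C'.
  apply: (@small_sub _ _ _ (range (concat D))).
    by move=> m [q [y [_ _ ->]]]; exists (q, y).
  by apply: small_range; apply: (small_prod kappa_pow) => //;
    exact: small_nat kappa_nat.
apply: (IH (ltnW jn) (C' `|` C) _ (D l0)) => //.
- exact: (small_setU kappa_nat kappa_pow).
- have h1 : fin_sat N C' (range (D l0)).
    apply: (fin_satS _ _ (@fin_sat_morley _ _ _ _ _ (rU j) (rN jn) D l0 k mD))
      => // m [y _ <-].
    by exists l0, y.
  apply: (fin_sat_trans h1); apply: (fin_satS _ _ fD) =>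
    // m [[y _ <-]|[q [y [_ _ ->]]]].
    by exists (l0, y).
  by exists (q, y).
- by move=> i; exact: Dr.
- move=> t x at_ [Px|[i [l [ij l0l lk h]]]].
    by left; apply: PsiC => //; apply: autW at_ => m [|Cm]; [left|right; right].
  right; exists i, l; split=> //.
  have -> : D l = t \o D l.
    apply/funext => y /=; rewrite at_.2 //; right; left; by exists l, y.
  by apply: Phi_aut => //; [exact: ltn_trans ij jn|apply: autW at_;
    exact: subsetUl].
apply: filterS (IHl (ltnW l0k)) => x [Px|[i [l [ij]]]]; first by left; left.
rewrite leq_eqVlt => /predU1P[<- _ h|l0l lk h]; first by right; exists i.
by left; right; exists i, l.
Qed.

End Broom.

(** * Finitely many conjugates of a disjunction of dividing formulas *)

Section QuasiDividing.
Context {L : language} {T : set (sentence L)} {kappa : Type} {M : structure L}.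
Hypothesis hM : monster T kappa M.
Hypothesis hdep : dependent T.

Let kappa_nat := monster_uncountable hM.
Let kappa_pow := monster_strong_limit hM.

(* The choice of an entry violating [Y] in each row makes [Y] shatter the first
   column. *)
Lemma array_nip (A : set M) I J (Y : set (I + J -> M)) (e : nat -> nat -> J ->
  M) g :
  definable A Y ->
  (forall eta : nat -> nat,
    conjugate A (concat (fun l => e l 0)) (concat (fun l => e l (eta l)))) ->
  (forall l x, ~ forall m, Y (vcat x (e l m))) ->
  ~ forall l, Y (vcat g (e l 0)).
Proof.
move=> dY paths rows gY.
have /choice[eta0 etaP] : forall l, exists m, ~ Y (vcat g (e l m)).
  by move=> l; apply/existsNP; exact: rows.
have /choice[c cP] : forall S : set nat, exists c, forall l,
  Y (vcat c (e l 0)) <-> S l.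
  move=> S; pose eta l := if pselect (S l) then 0 else eta0 l.
  have [t at_ te] := conjugate_sym (paths eta).
  exists (t \o g) => l; have := aut_dfn (vcat g (e l (eta l))) at_ dY.
  rewrite (_ : t \o _ = vcat (t \o g) (e l 0)); last first.
    by apply/funext => -[i|j] //=; exact: (congr1 (fun f => f (l, j)) te).
  move=> <-; rewrite /eta; case: pselect => Sl /=; first by split=> // _;
    exact: gY.
  by split=> // Yl; case: (etaP l).
exact: (nip hM hdep dY (fun k S => cP S k)).
Qed.

Lemma iter_ultra (U : set_system nat) X (f : nat -> nat -> X) : UltraFilter U ->
  UltraFilter ([set Z | U [set m | U [set k | Z (f m k)]]] : set_system X).
Proof.
move=> UU; apply: total_ultra.
  apply: Build_ProperFilter_ex.
    move=> Z ZU; have [m mU] := @filter_ex _ U _ _ ZU.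
    by have [k Zk] := @filter_ex _ U _ _ mU; exists (f m k).
  split.
  - exact: (@filterE _ U _ _ (fun m => @filterT _ U _)).
  - move=> Z Z' h h'; apply: (@filterS _ U _ _ _ _ (@filterI _ U _ _ _ h h')) =>
      m [a a'].
    exact: (@filterI _ U _ _ _ a a').
  - move=> Z Z' ZZ'; apply: (@filterS _ U _) => m; apply: (@filterS _ U _) => k.
    exact: ZZ'.
move=> Z; have [|h] := in_ultra_setVsetC [set m | U [set k | Z (f m k)]] UU;
  first by left.
right; apply: filterS h => m /= nm.
by have [] := in_ultra_setVsetC [set k | Z (f m k)] UU.
Qed.

Lemma definable_before (A : set M) V J (e : nat -> J -> M) (X : set (V -> M)) :
  definable (A `|` range (concat e)) X ->
    exists k, definable (A `|` before e k) X.
Proof.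
move=> /definable_split[Y [dY XY]].
pose sw (z : V + nat * J) : nat * J + V := match z with inl v =>
  inr v | inr w => inl w end.
have [k [Y1 [dY1 Y1P]]] := definable_initial_right (definable_pre sw dY).
have e' v x : Y (vcat x v) <-> Y1 (vcat x (fun z => v (val z.1, z.2))).
  rewrite -Y1P /=; apply/propeqP; congr Y; apply/funext => -[] //.
exists k.+1; apply: definable_ext (definable_vcat (b := fun z : 'I_k.+1 * J =>
  e (val z.1) z.2) _ _ dY1).
- by move=> x /=; rewrite XY e'.
- exact: subsetUl.
by move=> _ [[l j] _ <-]; right; exists l, j.
Qed.

Section OverBase.
Variable A : set M.
Hypotheses (sA : small kappa A) (eA : extension_base kappa A).

(* Instead of moving [t] to a realization of its non-forking extension over [c],
   move [c]. *)
Lemma nonforking_conj J K (c : J -> M) (t : K -> M) : small_type kappa J ->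
  small_type kappa K ->
  exists r, aut A r /\ forall J' (h : nat -> J' -> J), small_type kappa J' ->
    indisc A (fun m => c \o h m) -> indisc (A `|` range t) (fun m =>
      r \o (c \o h m)).
Proof.
move=> sJ sK; have [F [FU nF tF]] := nonforking_ultra hM t eA sA sK.
have sAc : small kappa (A `|` range c) by apply:
  (small_setU kappa_nat kappa_pow) => //; exact: small_range.
have [t' t'F] := realizes_over_ex hM FU sK sAc.
have [r ar rt] : conjugate A t' t.
  by apply: (realizes_over_eqv hM FU) => //; apply: realizes_overS t'F;
    exact: subsetUl.
exists r; split=> // J' h sJ' ih.
have : indisc (A `|` range t') (fun m => c \o h m).
  apply: (indisc_realize hM hdep FU nF) => //; apply: realizes_overS t'F;
    apply: setUS.
  by move=> _ [[m j] _ <-]; exists (h m j).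
move=> /(indisc_aut (A := A))/(_ ar (@subsetUl _ _ _)); apply: indiscW.
move=> m [Am|[k _ <-]]; first by exists m; [left|exact: ar.2].
by exists (t' k); [right; exists k|exact: (congr1 (fun f => f k) rt)].
Qed.

(** Each copy is chosen non-forking from the previous ones. The maps [h] select the indiscernible
    sequences hidden in [c], so that one copy preserves all of them at the same time. *)
Lemma nonforking_copies J (c : J -> M) : small_type kappa J ->
  exists sigma : nat -> M -> M, (forall k, aut A (sigma k)) /\
    forall k J' (h : nat -> J' -> J), small_type kappa J' -> indisc A (fun m =>
      c \o h m) ->
      indisc (A `|` before (fun k => sigma k \o c) k) (fun m =>
        sigma k \o (c \o h m)).
Proof.
move=> sJ; have [l|sigma sP] := @dependent_choice_seq (M -> M) (fun l r =>
  aut A r /\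
    forall J' (h : nat -> J' -> J), small_type kappa J' -> indisc A (fun m =>
      c \o h m) ->
      indisc (A `|` [set m | exists2 q, List.In q l & exists j, m = q (c j)])
          (fun m => r \o (c \o h m))).
  have [|r [ar rP]] := @nonforking_conj J ('I_(size l) * J) c
      (fun z => nth id l z.1 (c z.2)) sJ.
    by apply: (small_prod kappa_pow) => //;
      exact: (@small_countType _ kappa_nat).
  exists r; split=> // J' h sJ' ih; apply: indiscW (rP _ h sJ' ih);
    apply: setUS.
  move=> m [q ql [j ->]].
  have [i il <-] : exists2 i, (i < size l)%N & nth id l i = q.
    elim: l ql {rP} => //= q' l IH [->|/IH[i il e]]; first by exists 0.
    by exists i.+1.
  by exists (Ordinal il, j).
exists sigma; split=> [k|k J' h sJ' ih]; first exact: (sP k).1.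
apply: indiscW ((sP k).2 _ _ sJ' ih); apply: setUS.
move=> m [l [j [lk ->]]]; exists (sigma l); [exact: mkseq_In|by exists j].
Qed.

Section Orbit.
Variables (I J : Type) (n : nat) (d : J -> M).
Variables (Y : nat -> set (I + J -> M)) (s : nat -> nat -> J -> M).
Hypotheses (sI : small_type kappa I) (sJ : small_type kappa J).
Hypothesis dY : forall i, (i < n)%N -> definable A (Y i).
Hypothesis s_ind : forall i, (i < n)%N -> indisc A (s i).
Hypothesis s0 : forall i, (i < n)%N -> s i 0 = d.
Hypothesis s_inc : forall i x, (i < n)%N -> ~ forall m, Y i (vcat x (s i m)).

(* Over a base [N] made of independent copies of all the witnesses [s i],
   each [s i] gives rise to a coheir whose Morley sequences witness the
   dividing of [Y i], and these coheirs coincide over [N]. *)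
Theorem quasi_dividing : exists2 l : seq (M -> M),
  (forall t, List.In t l -> aut A t) &
  forall x, exists2 t, List.In t l & forall i, (i < n)%N ->
    ~ Y i (vcat x (t \o d)).
Proof.
have [U [UU Uc]] := nonprincipal_ultra.
have sN := small_nat kappa_nat.
(* All witnesses are gathered in one tuple, to be copied together. *)
pose c (z : nat * (nat * J)) := s z.1 z.2.1 z.2.2.
have [|sigma [sga sgi]] := @nonforking_copies (nat * (nat * J)) c.
  by apply: (small_prod kappa_pow) => //; exact: small_prod.
pose e k z := sigma k (c z).
pose N := A `|` range (concat e).
have smN : small kappa N.
  apply: (small_setU kappa_nat kappa_pow) => //; apply: small_range.
  by do 3! apply: (small_prod kappa_pow) => //.
have AN : A `<=` N by exact: subsetUl.
(* The limit along the copies is taken inside, that along the witness outside. *)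
pose r i : set_system (J -> M) := [set X | U [set m | U [set k | X (sigma k \o s
  i m)]]].
have rU i : UltraFilter (r i) by exact: (@iter_ultra U _ (fun m k =>
  sigma k \o s i m)).
have rN i : coheir N (r i).
  apply: (@filterE _ U) => m; apply: (@filterE _ U) => k j.
  by right; exists (k, (i, (m, j))).
(* From [k0] on the copies are indiscernible over the parameters of [X], which therefore does not
   see [m]. The limit that remains mentions [d] alone, so all [r i] agree over [N]. *)
have rE i X : (i < n)%N -> definable N X ->
  r i X <-> U [set k | X (sigma k \o d)].
  move=> ni /definable_before[k0 dX].
  have e0 k m : (k0 <= k)%N -> X (sigma k \o s i m) <-> X (sigma k \o d).
    move=> k0k; rewrite -(s0 ni).
    have is_ := sgi k J (fun m j => (i, (m, j))) sJ (s_ind ni).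
    by apply: (indisc_elt m is_); apply: definableW dX; apply: setUS;
      exact: before_le.
  split=> h.
    have [m hm] := @filter_ex _ U _ _ h.
    by apply: (@filterS _ U _ _ _ _ (@filterI _ U _ _ _ hm (Uc k0))) =>
      k [/= Xk k0k]; apply/(e0 _ m).
  apply: (@filterE _ U) => m /=.
  by apply: (@filterS _ U _ _ _ _ (@filterI _ U _ _ _ h (Uc k0))) =>
    k [/= Xk k0k]; apply/(e0 _ m).
(* A conjugate of the witness all of whose members realize [r i] over [B]: finitely many conditions
   hold along a subsequence inside a single copy [sigma k]. *)
have row i (B : set M) : (i < n)%N -> small kappa B -> A `<=` B ->
    exists x : nat -> J -> M, (forall m, realizes_over B (r i) (x m)) /\
      conjugate A (concat (s i)) (concat x).
  move=> ni sB AB.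
  have [|||x xP] := @saturation _ _ _ _ hM B (nat * J)%type
     ([set Z | exists (m : nat) (X : set (J -> M)),
        [/\ definable B X, r i X & Z = [set x : nat * J -> M | X (fun j =>
          x (m, j))]]] `|`
      [set Z | definable A Z /\ Z (concat (s i))]) _ sB.
  - by apply: (small_prod kappa_pow).
  - move=> Z [[m [X [dX _ ->]]]|[dZ _]]; last exact: definableW dZ.
    exact: (definable_pre (fun j => (m, j)) dX).
  - move=> l /list_partition[l1 [l2 [h1 h2 h12]]].
    have [|q [q1 q2]] := @In_choice (nat * set (J -> M)) _ (fun z Z =>
        [/\ definable B z.2, r i z.2 & Z = [set x : nat * J -> M | z.2 (fun j =>
          x (z.1, j))]]) l1.
      by move=> Z /h1[m [X h]]; exists (m, X).
    have rq : r i (cap_list (map snd q)).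
      apply: filter_cap => X Xq; have [z /q1[Z _ [_ rz _]] ->] := In_map Xq;
        exact: rz.
    have [u iu uP] := @infinite_increasing (fun m =>
      U [set k | cap_list (map snd q) (sigma k \o s i m)])
      (fun M0 => let: ex_intro m (conj h h') :=
        @filter_ex _ U _ _ (@filterI _ U _ _ _ rq (Uc M0)) in
         ex_intro2 _ _ m h' h).
    have [b bP] := list_bound (map fst q).
    have [k kP] : exists k, forall j, (j < b)%N ->
      cap_list (map snd q) (sigma k \o s i (u j)).
      have : U (cap_list [seq [set k | cap_list (map snd q)
        (sigma k \o s i (u j))] | j <- iota 0 b]).
        by apply: filter_cap => X Xl; have [j _ ->] := In_map Xl; exact: uP.
      move=> /filter_ex[k kP]; exists k => j jb.
      have := kP [set k | cap_list (map snd q) (sigma k \o s i (u j))]; apply.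
      apply: (map_In (fun j => [set k | cap_list (map snd q)
        (sigma k \o s i (u j))])).
      by apply/InP; rewrite mem_iota.
    exists (concat (fun j => sigma k \o s i (u j))) =>
      Z /h12[/q2[[m X] zq [_ _ ->]]|/h2[dZ Zs]].
      exact: (kP m (bP _ (map_In fst zq)) _ (map_In snd zq)).
    have /(aut_dfn _ (sga k) dZ) := iffLR (conjugate_dfn (s_ind ni iu) dZ) Zs.
    exact.
  exists (fun m j => x (m, j)); split=> [m X dX rX|].
    by apply: (xP [set x : nat * J -> M | X (fun j => x (m, j))]); left;
      exists m, X.
  apply: (homogeneous hM) => //; first by apply: (small_prod kappa_pow).
  move=> Z dZ Zs; rewrite (_ : concat _ = x); last by apply/funext => -[].
  by apply: xP; right.
(* Rows are piled up over [N] so that every path is a Morley sequence of [r i]. The paths are then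
   conjugate while each row is inconsistent, and [array_nip] excludes a solution of the first
   column. *)
have good i f : (i < n)%N -> morley N (r i) f ->
  forall x, ~ forall l, Y i (vcat x (f l)).
  move=> ni mf.
  have [l|R RP] := @dependent_choice_seq (nat -> J -> M) (fun l x =>
      (forall m, realizes_over (N `|` [set a | exists2 y, List.In y l &
        exists m j, a = y m j]) (r i) (x m)) /\
      conjugate A (concat (s i)) (concat x)).
    apply: row => //; last by apply: subset_trans AN _; exact: subsetUl.
    apply: (small_setU kappa_nat kappa_pow) => //.
    have := @small_list _ _ _ _ hM _ (map (fun y =>
      concat y) l) (small_prod kappa_pow sN sJ).
    apply: small_sub => a [y yl [m [j ->]]].
    by exists (concat y); [exact: (map_In (fun y => concat y))|exists (m, j)].
  have mor eta : morley N (r i) (fun l => R l (eta l)).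
    move=> l; apply: realizes_overS ((RP l).1 (eta l));
      apply: setUS => a [k [j [kl ->]]].
    by exists (R k); [exact: mkseq_In|exists (eta k), j].
  have nog x : ~ forall l, Y i (vcat x (R l 0)).
    apply: (array_nip (dY ni)) => [eta|l y yY].
      apply: conjugateW AN _.
      exact: (morley_eqv hM smN sJ (rU i) (rN i) (mor (fun=> 0)) (mor eta)).
    have [t at_ tR] := conjugate_sym (RP l).2.
    apply: (s_inc (x := t \o y) ni) => m.
    have := iffLR (aut_dfn _ at_ (dY ni)) (yY m); congr (Y i _).
    by apply/funext => -[a|j] //=; exact: (congr1 (fun f => f (m, j)) tR).
  move=> x xY.
  have [t at_ tf] := conjugateW AN (morley_eqv hM smN sJ (rU i) (rN i)
    mf (mor (fun=> 0))).
  apply: (nog (t \o x)) => l.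
  have := iffLR (aut_dfn _ at_ (dY ni)) (xY l); congr (Y i _).
  by apply/funext => -[a|j] //=; exact: (congr1 (fun f => f (l, j)) tf).
have [->|n0] := posnP n.
  exists [:: id]; first by move=> t [<-|//]; exact: aut_id.
  by move=> x; exists id; [left|].
have [d' d'r] := realizes_over_ex hM (rU 0) sJ smN.
have d'r' i : (i < n)%N -> realizes_over N (r i) d'.
  move=> ni X dX /(iffLR (rE _ _ ni dX))/(iffRL (rE _ _ n0 dX)); exact: d'r.
have [t0 at0 td'] : conjugate A d d'.
  apply: (homogeneous hM) => // X dX Xd; apply: (d'r _ (definableW AN dX)).
  apply/(rE _ _ n0 (definableW AN dX)); apply: (@filterE _ U) => k /=.
  exact: (iffLR (aut_dfn d (sga k) dX) Xd).
(* [E] consists of the sets containing a finite intersection of conjugates over [A] of the union of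
   the Y i. It is an invariant filter, and the claim is that it contains the empty set. *)
pose orbit l x := forall t, List.In t l ->
  exists2 i, (i < n)%N & Y i (vcat x (t \o d)).
pose E : set_system (I -> M) := [set X | exists2 l : seq (M -> M),
  (forall t, List.In t l -> aut A t) & orbit l `<=` X].
have EF : Filter E.
  split; first by exists [::].
    move=> X X' [l la lX] [l' l'a l'X']; exists (l ++ l').
      by move=> t /In_cat[/la|/l'a].
    by move=> x xo; split; [apply: lX|apply: l'X'] => t tl; apply: xo;
      apply/In_cat; auto.
  by move=> X X' XX' [l la lX]; exists l => //; exact: subset_trans XX'.
have : E set0.
  apply: (@broom _ _ _ _ hM N I J n r (fun i d =>
    [set x | Y i (vcat x d)]) smN sJ rU
    (fun i _ => rN i) _ _ _ E EF _ n (leqnn n) set0 set0 d') => //.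
  - by move=> i j X ni nj dX /(rE _ _ ni dX)/(rE _ _ nj dX).
  - move=> i t y x ni at_ /=.
    move=> /(iffLR (aut_dfn _ (autW AN at_) (dY ni))); congr (Y i _).
    by apply/funext => -[].
  - move=> i f ni mf; apply: contrapT => nk.
    have [x xP] : exists x, forall l, Y i (vcat x (f l)).
      apply: (compactness_seq hM sI sJ sA (dY ni)) => k; apply: contrapT => nx.
      by apply: nk; exists k => x xk; apply: nx; exists x.
    exact: (good i f ni mf x).
  - move=> t X at_ [l la lX].
    have [t' [at' tt' t't]] := aut_inv (autW AN at_).
    exists (map (fun q => t' \o q) l).
      move=> q' q'l; have [q ql ->] := In_map q'l.
      by apply: aut_comp => //; exact: la.
    move=> x xo /=; apply: lX => q ql.
    have [i ni Yi] := xo _ (map_In (fun q => t' \o q) ql); exists i => //.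
    have := iffLR (aut_dfn _ (autW AN at_) (dY ni)) Yi; congr (Y i _).
    by apply/funext => -[a|j] //=; rewrite t't.
  - apply: (@small_sub _ _ _ N) => //.
  - exact: fin_sat0.
  exists [:: t0]; first by move=> t [<-|].
  move=> x /(_ t0 (or_introl erefl))[i ni Yi]; right; exists i => //.
  by rewrite /= -td'.
move=> [l la l0]; exists l => // x.
apply: contrapT => nx; apply: (l0 x) => t tl.
apply: contrapT => ni; apply: nx; exists t => // i i_n Yi.
by apply: ni; exists i.
Qed.

End Orbit.
End OverBase.
End QuasiDividing.

(** * Strictly non-forking types *)

Section Strict.
Context {L : language} {T : set (sentence L)} {kappa : Type} {M : structure L}.
Hypothesis hM : monster T kappa M.
Hypothesis hdep : dependent T.

Let kappa_nat := monster_uncountable hM.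
Let kappa_pow := monster_strong_limit hM.

Variable A : set M.
Hypotheses (sA : small kappa A) (eA : extension_base kappa A).

Lemma set_divides_pre K K' (h : K -> K') (X : set (K ->
  M)) : set_divides kappa A X ->
  set_divides kappa A [set y : K' -> M | X (y \o h)].
Proof.
move=> [J [Y [b [sJ dY ib Xb [N bN]]]]].
pose g (v : K' + J -> M) (z : K + J) := match z with
  inl k => v (inl (h k)) | inr j => v (inr j) end.
have gE x y : g (vcat x y) = vcat (x \o h) y by apply/funext => -[].
exists J, [set v | Y (g v)], b; split=> //.
- by apply: definable_subst dY => // -[k|j]; left;
    [exists (inl (h k))|exists (inr j)].
- by move=> x /=; rewrite gE Xb.
- by exists N => x xY; apply: (bN (x \o h)) => k kN; have := xY k kN;
    rewrite /= gE.
Qed.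

Lemma set_divides_aut I t (X : set (I -> M)) : aut A t ->
  set_divides kappa A X ->
  set_divides kappa A [set x | X (t \o x)].
Proof.
move=> at_ [J [Y [b [sJ dY ib Xb [N bN]]]]].
have [t' [at' tt' t't]] := aut_inv at_.
have e x y : Y (vcat x (t' \o y)) <-> Y (vcat (t \o x) y).
  rewrite (aut_dfn _ at_ dY); apply/propeqP; congr Y.
  by apply/funext => -[i|j] //=; rewrite t't.
exists J, Y, (fun k => t' \o b k); split=> //.
- exact: indisc_autA.
- by move=> x; rewrite /= Xb e.
- by exists N => x xY; apply: (bN (t \o x)) => k kN; apply/e; exact: xY.
Qed.

Lemma small_bigU (l : seq (set M)) : (forall S, List.In S l -> small kappa S) ->
  small kappa [set m | exists2 S, List.In S l & S m].
Proof.
elim: l => [|S l IH] h.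
  apply: (@small_sub _ _ _ (range (of_void M))); first by move=> m [S []].
  by apply: small_range; exact: (@small_countType _ kappa_nat void).
have sS := h S (or_introl erefl).
have {}IH : small kappa [set m | exists2 S, List.In S l & S m].
  by apply: IH => S' S'l; apply: h; right.
apply: (@small_sub _ _ _ _ _ (small_setU kappa_nat kappa_pow sS IH)).
by move=> m [S' [<-|S'l] S'm]; [left|right; exists S'].
Qed.

Lemma small_image (S : set M) (t : M -> M) : small kappa S ->
  small kappa (t @` S).
Proof.
move=> /small_setE sS; apply: (@small_sub _ _ _ (range (fun x : S =>
  t (val x)))).
  by move=> _ [m Sm <-]; exists (SigSub (mem_set Sm)).
exact: small_range.
Qed.

(** The finitely many parameter tuples are concatenated, since the later arguments treat dividing
    formulas with a common parameter tuple. *)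
Lemma set_divides_join I (l : seq (set (I -> M))) :
  (forall X, List.In X l -> set_divides kappa A X) ->
  exists (K : Type) (w : K -> M) (lz : seq (set (I + K ->
    M))), [/\ small_type kappa K,
    forall Z, List.In Z lz -> definable A Z /\
      set_divides kappa A [set x | Z (vcat x w)] &
    forall X, List.In X l -> exists2 Z, List.In Z lz & forall x,
      X x <-> Z (vcat x w)].
Proof.
elim: l => [|X l IH] h.
  exists void, (of_void _), [::]; split=> //;
    exact: (@small_countType _ kappa_nat).
have [|K [w [lz [sK lz1 lz2]]]] := IH; first by move=> X' ?; apply: h; right.
have dX := h X (or_introl erefl); have [J [Y [b [sJ dY ib Xb _]]]] := dX.
pose f1 (v : I + (J + K) -> M) (z : I + J) := match z with
  inl i => v (inl i) | inr j => v (inr (inl j)) end.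
pose f2 (v : I + (J + K) -> M) (z : I + K) := match z with
  inl i => v (inl i) | inr k => v (inr (inr k)) end.
have e1 x : f1 (vcat x (vcat (b 0) w)) = vcat x (b 0) by apply/funext => -[].
have e2 x : f2 (vcat x (vcat (b 0) w)) = vcat x w by apply/funext => -[].
exists (J + K)%type, (vcat (b 0) w),
  ([set v | Y (f1 v)] :: map (fun Z => [set v | Z (f2 v)]) lz); split.
- exact: (small_sum kappa_nat kappa_pow).
- move=> Z [<-|Zl].
    split; first by apply: definable_subst dY => // -[i|j]; left;
      [exists (inl i)|exists (inr (inl j))].
    have -> : [set x | [set v | Y (f1 v)] (vcat x (vcat (b 0) w))] = X.
      by apply/funext => x; apply/propext; rewrite /= e1 Xb.
    exact: dX.
  have [Z' /lz1[dZ' sZ'] ->] := In_map Zl; split.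
    by apply: definable_subst dZ' => // -[i|j]; left;
      [exists (inl i)|exists (inr (inr j))].
  have -> // : [set x | [set v | Z' (f2 v)] (vcat x (vcat (b 0)
    w))] = [set x | Z' (vcat x w)].
  by apply/funext => x; apply/propext; rewrite /= e2.
- move=> X' [<-|/lz2[Z Zl ZP]].
    by exists [set v | Y (f1 v)]; [left|move=> x /=; rewrite e1 Xb].
  exists [set v | Z (f2 v)]; first by right;
    exact: (map_In (fun Z => [set v | Z (f2 v)])).
  by move=> x /=; rewrite e2 ZP.
Qed.

Lemma In_nth X x0 (l : seq X) i : (i < size l)%N -> List.In (nth x0 l i) l.
Proof. by elim: l i => // x l IH [|i] /=; [left|right; exact: IH]. Qed.

Lemma nth_In X x0 (l : seq X) x : List.In x l ->
  exists2 i, (i < size l)%N & nth x0 l i = x.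
Proof. by elim: l => //= y l IH [->|/IH[i ? ?]]; [exists 0|exists i.+1]. Qed.

Lemma quasi_dividing_list I K (w : K -> M) (lz : seq (set (I + K -> M))) :
  small_type kappa I -> small_type kappa K ->
  (forall Z, List.In Z lz -> definable A Z /\
    set_divides kappa A [set x | Z (vcat x w)]) ->
  exists2 l : seq (M -> M), (forall t, List.In t l -> aut A t) &
    forall x, exists2 t, List.In t l & forall Z, List.In Z lz ->
      ~ Z (vcat x (t \o w)).
Proof.
move=> sI sK h.
have /choice[s sP] : forall i, exists s, (i < size lz)%N ->
  [/\ indisc A s, s 0 = w &
    forall x, ~ forall k, nth set0 lz i (vcat x (s k))].
  move=> i; have [il|_] := ltnP i (size lz); last by exists (fun=> w).
  have [dZ sZ] := h _ (In_nth set0 il).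
  by have [s sP] := set_divides_witness hM sI sK sA sZ dZ (fun _ h => h);
    exists s.
have [||i il|i x il|l la lP] := @quasi_dividing _ _ _ _ hM hdep A sA eA I K
  (size lz) w
    (nth set0 lz) s sI sK.
- by move=> i /(In_nth set0)/h[].
- by move=> i /sP[].
- by have [] := sP i il.
- by have [_ _ sx] := sP i il; exact: sx.
exists l => // x; have [t tl tx] := lP x;
  exists t => // Z /(nth_In set0)[i il <-].
exact: tx.
Qed.

(* The last sets express that tp(S/Ac) does not divide over A when c realizes the
   type: the dividing of [Y(y, c)] over A only depends on tp(c/A). *)
Definition strict_family J (B : set M) (d : J -> M) : set (set (J -> M)) :=
  [set X | definable B X /\ X d] `|` [set Z | exists2 X, set_divides kappa A X &
    Z = ~` X] `|`
  [set Z | exists (S : set M) (Y : set (S + J -> M)),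
    [/\ small kappa S, definable A Y, set_divides kappa A [set y | Y (vcat y d)]
      &
      Z = [set x | ~ Y (vcat val x)]]].

Definition strict_type J (B : set M) (d : J -> M) (F : set_system (J ->
  M)) : Prop :=
  [/\ UltraFilter F, nonforking kappa A F, realizes_over B F d &
    forall (S : set M) (Y : set (S + J -> M)), small kappa S -> definable A Y ->
      set_divides kappa A [set y | Y (vcat y d)] ->
        F [set x | ~ Y (vcat val x)]].

Lemma strict_type_fip J (B : set M) (d : J -> M) : fip (strict_family B d) ->
  exists F, strict_type B d F.
Proof.
move=> /fip_ultrafilter[F [FU GF]]; exists F; split=> //.
- move=> X dX FX; have : F (~` X) by apply: GF; left; right; exists X.
  by move=> /ultraN.
- move=> X dX FX; apply: contrapT => nX.
  have : F (~` X) by apply: GF; left; left; split=> //; exact: definableN.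
  by move=> /ultraN.
- by move=> S Y sS dY sY; apply: GF; right; exists S, Y.
Qed.

(** Quasi-dividing yields finitely many conjugates of the parameters [w] such that every tuple
    avoids the dividing sets at one of them, unknown in advance. The small sets of the third kind
    are therefore replaced by the union [K] of their images under all these automorphisms. Once
    tp(K/A) is realized over [d] without forking, the automorphism that fits is undone. *)
Lemma strict_ex J (d : J -> M) : small_type kappa J ->
  exists F, strict_type A d F.
Proof.
move=> sJ; apply: strict_type_fip => l.
move=> /list_partition[l12 [l3 [/list_partition[l1 [l2 [h1 h2 h12]]] h3 h]]].
have [|Xs [Xs1 Xs2]] := @In_choice _ _ (fun X Z =>
  set_divides kappa A X /\ Z = ~` X) l2.
  by move=> Z /h2[X ? ->]; exists X.
have [|K0 [w [lz [sK0 lz1 lz2]]]] := @set_divides_join J Xs;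
  first by move=> X /Xs1[? _ []].
have [ts tsa tsP] := quasi_dividing_list sJ sK0 lz1.
pose ent := {S : set M & set (S + J -> M)}.
have [|es [es1 es2]] := @In_choice ent _ (fun p Z => let: existT D Y := p in
    [/\ small kappa D, definable A Y, set_divides kappa A [set y | Y (vcat y d)]
      &
      Z = [set x | ~ Y (vcat val x)]]) l3.
  by move=> Z /h3[S [Y P]]; exists (existT _ S Y).
pose moved (t : M -> M) (p : ent) : set M := t @` projT1 p.
pose K := [set m | exists2 S, List.In S (flatten (map (fun t =>
  map (moved t) es) ts)) & S m].
have sKs : small kappa K.
  apply: small_bigU => S /In_flatten[q qts]; have [t _ ->] := In_map qts => St.
  have [[S' Y'] /es1[Z _ [sS' _ _ _]] ->] := In_map St; exact: small_image.
have sK : small_type kappa K by exact/small_setE.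
pose E : K -> M := val.
have [G [GU nG EG]] := nonforking_ultra hM E eA sA sK.
have sAd : small kappa (A `|` range d) by apply:
  (small_setU kappa_nat kappa_pow) => //; exact: small_range.
have [E' E'G] := realizes_over_ex hM GU sK sAd.
have [r ar rE] : conjugate A E E'.
  by apply: (realizes_over_eqv hM GU) => //; apply: realizes_overS E'G;
    exact: subsetUl.
have [r' [ar' rr' r'r]] := aut_inv ar.
have [t tts tx] := tsP (r' \o d).
have [t' [at' tt' t't]] := aut_inv (tsa t tts).
have move_in V (Z : set (V -> M)) x y : definable A Z -> t \o x = y ->
  Z x <-> Z y.
  by move=> dZ <-; exact: aut_dfn (tsa t tts) dZ.
exists (t' \o (r' \o d)) => Z /h[/h12[/h1[dZ Zd]|/Xs2[X /lz2[Z' Z'l XZ'] [_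
  ->]]]|].
- exact: (iffLR (aut_dfn _ at' dZ) (iffLR (aut_dfn _ ar' dZ) Zd)).
- have [dZ' _] := lz1 _ Z'l; move=> /XZ';
    rewrite (move_in _ _ _ (vcat (r' \o d) (t \o w)) dZ').
    exact: tx.
  by apply/funext => -[j|k] //=; rewrite t't.
move=> /es2[[S Y] pes [sS dY sY ->]] /= Yd.
have /choice[h' h'E] : forall x : S, exists k : K, t (val x) = E k.
  move=> x; have Kx : K (t (val x)).
    exists (t @` S); last by exists (val x) => //; exact/set_mem/valP.
    apply/In_flatten; exists (map (moved t) es).
      exact: (map_In (fun t => map (moved t) es)).
    exact: (map_In (moved t) pes).
  by exists (SigSub (mem_set Kx)).
have {}Yd : Y (vcat (E' \o h') d).
  have {}Yd : Y (vcat (t \o val) (r' \o d)).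
    apply: (iffLR (move_in _ _ _ _ dY _) Yd).
    by apply/funext => -[k|j] //=; rewrite t't.
  have := iffLR (aut_dfn _ ar dY) Yd; congr (Y _); apply/funext => -[k|j] /=;
    last by rewrite r'r.
  rewrite h'E.
  exact: (congr1 (fun f => f (h' k)) rE).
have := set_divides_pre h' sY; move=> /nG; apply.
have dYd : definable (A `|` range d) [set y : K -> M | Y (vcat (y \o h') d)].
  apply: definable_subst dY; first exact: subsetUl.
  by move=> [k|j]; [left; exists (h' k)|right; exists (d j) => //; right;
    exists j].
exact: (iffLR (realizes_overE GU E'G dYd) Yd).
Qed.

End Strict.

(** * A single witness for several dividing formulas *)

Section Witness.
Context {L : language} {T : set (sentence L)} {kappa : Type} {M : structure L}.
Hypothesis hM : monster T kappa M.
Hypothesis hdep : dependent T.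

Let kappa_nat := monster_uncountable hM.
Let kappa_pow := monster_strong_limit hM.

Variable A : set M.
Hypotheses (sA : small kappa A) (eA : extension_base kappa A).

(** By strictness tp(S/Ad') does not divide over [A]. The tuple [d'] is chosen before the sequence
    [t], so that the rows of all witnesses can start with it. *)
Lemma strict_row J (d : J -> M) (F : set_system (J -> M)) (S : set M) :
  small_type kappa J -> strict_type (kappa := kappa) A A d F -> small kappa S ->
  exists d', realizes_over (A `|` S) F d' /\
    forall t : nat -> J -> M, indisc A t -> t 0 = d ->
      exists t', [/\ t' 0 = d', conjugate A (concat t) (concat t') &
        indisc (A `|` S) t'].
Proof.
move=> sJ [FU nF dF Fst] sS.
have sAS : small kappa (A `|` S) by exact: (small_setU kappa_nat kappa_pow).
have [d' d'F] := realizes_over_ex hM FU sJ sAS; exists d'; split=> // t it t0.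
have [r ar rd] : conjugate A d d'.
  by apply: (realizes_over_eqv hM FU) => //; apply: realizes_overS d'F;
    exact: subsetUl.
have sST : small_type kappa S by exact/small_setE.
have rS : range (val : S -> M) = S.
  apply/seteqP; split=> [_ [c _ <-]|m Sm]; first exact/set_mem/valP.
  by exists (SigSub (mem_set Sm)).
have nd (Y : set (S + J -> M)) : definable A Y -> Y (vcat val d') ->
    ~ set_divides kappa A [set y | Y (vcat y d')].
  move=> dY Yd' sY.
  have /(Fst S Y sS dY) FY : set_divides kappa A [set y | Y (vcat y d)].
    have := set_divides_aut ar sY; congr (set_divides _ _ _); apply/funext => y;
      apply/propext.
    rewrite /= (aut_dfn (vcat y d) ar dY); apply/propeqP; congr Y.
    by apply/funext => -[i|j] //=; rewrite -rd.
  apply: (d'F [set x | ~ Y (vcat val x)]) FY Yd'.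
  apply: definableN; apply: definable_subst dY; first exact: subsetUl.
  by move=> [c|j]; [right; exists (val c) => //; right; exact/set_mem/valP|left;
    exists j].
have irt : indisc A (fun k => r \o t k) by exact: indisc_autA.
have rt0 : r \o t 0 = d' by rewrite t0.
have [q aq iq] := indisc_nondividing hM sJ sST sA nd irt rt0.
have aqA : aut A q by apply: autW aq; exact: subsetUl.
exists (fun k => q \o (r \o t k)); split.
- by rewrite rt0; apply/funext => j /=; apply: aq.2; right; exists j.
- by exists (q \o r) => //; exact: aut_comp.
- by move: iq; rewrite rS.
Qed.

Section Rows.
Variables (J : Type) (d : J -> M) (F : set_system (J -> M)).
Hypotheses (sJ : small_type kappa J) (Fst : strict_type (kappa :=
  kappa) A A d F).
Variable f : nat -> nat -> nat -> J -> M.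

(* [f l i] is the i-th row at stage [l]; all rows of a stage start with the same
   tuple [f l 0 0], which realizes [F] over the earlier stages. *)
Definition earlier l : set M := [set m | exists k i j x, (k < l)%N /\
  m = f k i j x].

Hypothesis f_rlz : forall l, realizes_over (A `|` earlier l) F (f l 0 0).
Hypothesis f_0 : forall l i, f l i 0 = f l 0 0.
Hypothesis f_ind : forall l i, indisc (A `|` earlier l) (f l i).

Lemma small_earlier l : small kappa (earlier l).
Proof.
apply: (@small_sub _ _ _ (range (fun z : nat * (nat * (nat * J)) =>
    f z.1 z.2.1 z.2.2.1 z.2.2.2))).
  by move=> m [k [i [j [x [_ ->]]]]]; exists (k, (i, (j, x))).
by apply: small_range; do 3! (apply: (small_prod kappa_pow);
  first exact: small_nat kappa_nat).
Qed.

(** Each later [f k 0 0] realizes the non-forking type [F] over everything before it, and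
    [indisc_realize] adds it to the parameters. *)
Lemma rows_ind s i l :
  indisc (A `|` earlier s `|` [set m | exists k j, [/\ (s < k)%N, (k < l)%N &
    m = f k 0 0 j]])
    (f s i).
Proof.
have [FU nF _ _] := Fst.
elim: l => [|l IH].
  by apply: indiscW (f_ind s i) => m [//|[k [j []]]].
have [sl|ls] := ltnP s l; last first.
  apply: indiscW IH; apply: setUS => m [k [j [sk kl ->]]]; exists k, j;
    split=> //; lia.
set A' := (X in indisc X _) in IH.
have A'l : A' `<=` A `|` earlier l.
  move=> m [[Am|[k [i' [j [x [ks ->]]]]]]|[k [j [sk kl ->]]]]; first by left.
    by right; exists k, i', j, x; split=> //; lia.
  by right; exists k, 0, 0, j.
have sA' : small kappa A'.
  by apply: small_sub A'l _; apply: (small_setU kappa_nat kappa_pow) => //;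
    exact: small_earlier.
have AA' : A `<=` A' by move=> m Am; left; left.
have : indisc (A' `|` range (f l 0 0)) (f s i).
  apply: (indisc_realize hM hdep FU (nonforkingS hM sA' AA' nF)) => //.
  have fl := @f_rlz l.
  have h : A' `|` range (concat (f s i)) `<=` A `|` earlier l.
    move=> m [/A'l//|[[m' x] _ <-]].
    by right; exists s, i, m', x.
  exact: realizes_overS h fl.
apply: indiscW => m [[Am|em]|[k [j [sk + ->]]]]; first by left; left; left.
  by left; left; right.
rewrite ltnS leq_eqVlt => /predU1P[->|kl]; first by right; exists j.
by left; right; exists k, j.
Qed.

(** The first column is exchanged for the path one stage at a time: row [q] is indiscernible over
    the changed entries before it and the unchanged ones after it. *)
Lemma rows_path_fin i (eta : nat -> nat) k q : (q <= k)%N ->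
  conjugate A (fun z : 'I_k * J => f z.1 0 0 z.2)
    (fun z : 'I_k * J => if (z.1 < q)%N then f z.1 i (eta z.1)
      z.2 else f z.1 0 0 z.2).
Proof.
elim: q => [|q IH] qk; first exact: conjugate_refl.
apply: conjugate_trans (IH (ltnW qk)) _.
have [t at_ tq] := rows_ind q i k (@increasing_addn (eta q)).
exists t; first by apply: autW at_; move=> m Am; left; left.
apply/funext => -[l j] /=; rewrite ltnS (leq_eqVlt l q).
have [lq|ql|lq] /= := ltngtP l q.
- by apply: at_.2; left; right; exists l, i, (eta l), j.
- by apply: at_.2; right; exists l, j.
- have := congr1 (fun g => g (0, j)) tq; rewrite /concat /= addn0 f_0.
  by rewrite (_ : l = Ordinal qk) //; exact/val_inj.
Qed.

Lemma rows_path i (eta : nat -> nat) :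
  conjugate A (concat (fun l => f l 0 0)) (concat (fun l => f l i (eta l))).
Proof.
apply: (homogeneous hM) => //.
  by apply: (small_prod kappa_pow) => //; exact: small_nat kappa_nat.
move=> X /definable_initial[k [Y [dY XY]]] /XY Y0; apply/XY.
have := iffLR (conjugate_dfn (rows_path_fin i eta (leqnn k)) dY) Y0;
  congr (Y _).
by apply/funext => -[l j] /=; rewrite ltn_ord.
Qed.

Lemma rows_path_inc i (u eta : nat -> nat) : increasing u ->
  conjugate A (concat (fun l => f (u l) 0 0)) (concat (fun l =>
    f (u l) i (eta l))).
Proof.
move=> iu; have /choice[eta' etaP] : forall m, exists k, forall l, u l = m ->
  k = eta l.
  move=> m; have [[l ul]|n] := pselect (exists l, u l = m); last first.
    by exists 0 => l ul; case: n; exists l.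
  exists (eta l) => l'; rewrite -ul; case: (ltngtP l l') => [/iu|/iu|->//] + e;
    by rewrite e ltnn.
have := conjugate_pre (fun z : nat * J => (u z.1, z.2)) (rows_path i eta').
by congr conjugate; apply/funext => -[l j]; rewrite /concat /= (etaP _ l).
Qed.

End Rows.

(** The first column of the array is the witness. For each [i], the rows are conjugate to the given
    sequence, hence inconsistent, and the paths are conjugate to the first column, so [array_nip]
    applies. *)
Theorem universal_witness J (d : J -> M) n (I : nat -> Type)
    (Y : forall i, set (I i + J -> M)) (t : nat -> nat -> J ->
      M) : small_type kappa J ->
  (forall i, (i < n)%N -> [/\ definable A (Y i), indisc A (t i), t i 0 = d &
    forall x, ~ forall m, Y i (vcat x (t i m))]) ->
  exists s, [/\ indisc A s, s 0 = d &
    forall i x, (i < n)%N -> ~ forall l, Y i (vcat x (s l))].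
Proof.
move=> sJ tP.
(* Constant rows are added so that rows are indexed by all natural numbers. *)
have {tP} [t' [it' t'0 t'P]] : exists t' : nat -> nat -> J -> M,
    [/\ forall i, indisc A (t' i), forall i, t' i 0 = d &
    forall i, (i < n)%N -> definable A (Y i) /\ forall x, ~ forall m,
      Y i (vcat x (t' i m))].
  exists (fun i => if (i < n)%N then t i else fun=> d).
  split=> i.
  - case: ifP => [/tP[]//|_]; by move=> u iu; exact: conjugate_refl.
  - by case: ifP => [/tP[]|].
  - by move=> ni; rewrite ni; have [] := tP i ni.
have sn := small_nat kappa_nat.
have [F Fst] := strict_ex hM hdep sA eA d sJ.
have [FU nF dF _] := Fst.
have [l|f fP] := @dependent_choice_seq (nat -> nat -> J -> M) (fun l w =>
  let S := [set m | exists2 w', List.In w' l & exists i k j, m = w' i k j] in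
  [/\ realizes_over (A `|` S) F (w 0 0), forall i, w i 0 = w 0 0,
      forall i, conjugate A (concat (t' i)) (concat (w i)) & forall i,
        indisc (A `|` S) (w i)]).
  set S := [set m | _].
  have sS : small kappa S.
    have := @small_list _ _ _ _ hM (nat * (nat * J))
      (map (fun w z => w z.1 z.2.1 z.2.2) l)
        (small_prod kappa_pow sn (small_prod kappa_pow sn sJ)).
    apply: small_sub => m [w wl [i [k [j ->]]]].
    exists (fun z => w z.1 z.2.1 z.2.2).
      exact: (map_In (fun w z => w z.1 z.2.1 z.2.2)).
    by exists (i, (k, j)).
  have [d' [d'F rows]] := strict_row sJ Fst sS.
  have /choice[w wP] := fun i => rows (t' i) (it' i) (t'0 i).
  exists w; split=> [|i|i|i]; do ?by have [] := wP i.
    by have [-> _ _] := wP 0.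
  by have [-> _ _] := wP i; have [-> _ _] := wP 0.
have eS l : earlier f l `<=`
    [set m | exists2 w', List.In w' (mkseq f l) & exists i k j, m = w' i k j].
  by move=> m [k [i [j [x [kl ->]]]]]; exists (f k);
    [exact: mkseq_In|exists i, j, x].
have f_rlz l : realizes_over (A `|` earlier f l) F (f l 0 0).
  by have [h _ _ _] := fP l; apply: realizes_overS h; exact: setUS.
have f_0 l i : f l i 0 = f l 0 0 by have [] := fP l.
have f_t l i : conjugate A (concat (t' i)) (concat (f l i)) by have [] := fP l.
have f_ind l i : indisc (A `|` earlier f l) (f l i).
  by have [_ _ _ h] := fP l; apply: indiscW (h i); exact: setUS.
pose W l (z : nat * (nat * J)) := f l z.1 z.2.1 z.2.2.
have sV : small_type kappa (nat * (nat * J)) by apply: (small_prod kappa_pow) =>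
  //; exact: (small_prod kappa_pow).
(* Whole stages are extracted at once: the first column becomes indiscernible over [A], while the
   types of rows and paths are kept. *)
have [W' iW' W'P] := @extraction_nat _ _ _ _ hM _ W A sV sA.
pose s l j := W' l (0, (0, j)).
pose e i l m j := W' l (i, (m, j)).
have is_ : indisc A s by exact: (indisc_pre (fun j => (0, (0, j))) iW').
have e_t i l : conjugate A (concat (t' i)) (concat (e i l)).
  apply: (homogeneous hM) => //; first exact: (small_prod kappa_pow).
  move=> Z dZ Zt; have dZ' := definable_pre (fun z : nat * J =>
    (l, (i, (z.1, z.2)))) dZ.
  have := W'P _ dZ'; apply => u iu.
  have := iffLR (conjugate_dfn (f_t (u l) i) dZ) Zt.
  by congr (Z _); apply/funext => -[].
have paths i eta : conjugate A (concat (fun l => s l)) (concat (fun l =>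
  e i l (eta l))).
  apply: (homogeneous hM) => //; first exact: (small_prod kappa_pow).
  move=> Z dZ.
  have d1 := definable_pre (fun z : nat * J => (z.1, (0, (0, z.2)))) dZ.
  have d2 := definable_pre (fun z : nat * J => (z.1, (i, (eta z.1, z.2)))) dZ.
  have := W'P _ (definableimp d1 d2); apply => u iu.
  have [+ _] := conjugate_dfn (rows_path_inc sJ Fst f_rlz f_0 f_ind i eta iu)
    dZ.
  exact.
have s_inc i x : (i < n)%N -> ~ forall l, Y i (vcat x (s l)).
  move=> ni; have [dY tY] := t'P i ni.
  have [r ar rs] := paths i (fun=> 0) => xY.
  apply: (@array_nip _ _ _ _ hM hdep A _ _ (Y i) (e i) (r \o x) dY).
  - move=> eta; exact: conjugate_trans (conjugate_sym (paths i (fun=> 0)))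
      (paths i eta).
  - move=> l y yY; have [q aq qe] := conjugate_sym (e_t i l).
    apply: (tY (q \o y)) => m.
    have := iffLR (aut_dfn _ aq dY) (yY m); congr (Y i _).
    by apply/funext => -[a|j] //=; exact: (congr1 (fun g => g (m, j)) qe).
  - move=> l; have := iffLR (aut_dfn _ ar dY) (xY l); congr (Y i _).
    by apply/funext => -[a|j] //=; exact: (congr1 (fun g => g (l, j)) rs).
have [r ar rs] : conjugate A (s 0) d.
  have h := conjugate_pre (fun j : J => (0, j)) (e_t 0 0).
  apply: conjugate_sym; rewrite -(t'0 0).
  exact: h.
have [r' [ar' rr' r'r]] := aut_inv ar.
exists (fun l => r \o s l); split=> //; first exact: indisc_autA.
move=> i x ni xY; apply: (s_inc i (r' \o x) ni) => l.
have [dY _] := t'P i ni.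
have := iffLR (aut_dfn _ ar' dY) (xY l); congr (Y i _).
by apply/funext => -[a|j] //=; rewrite rr'.
Qed.

End Witness.

(** * Mutually indiscernible sequences *)

Section Mutual.
Context {L : language} {T : set (sentence L)} {kappa : Type} {M : structure L}.
Hypothesis hM : monster T kappa M.
Hypothesis hdep : dependent T.

Let kappa_nat := monster_uncountable hM.
Let kappa_pow := monster_strong_limit hM.

Variable A : set M.
Hypothesis sA : small kappa A.

Lemma range_val (S : set M) : range (val : S -> M) = S.
Proof.
apply/seteqP; split=> [_ [c _ <-]|m Sm]; first exact/set_mem/valP.
by exists (SigSub (mem_set Sm)).
Qed.

Lemma indisc_move (B B' : set M) J (s : nat -> J -> M) t : aut A t ->
  A `<=` B ->
  B' `<=` t @` B -> indisc B s -> indisc B' (fun k => t \o s k).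
Proof. by move=> at_ AB B'B is_; apply:
  indiscW B'B (indisc_aut is_ at_ AB). Qed.

Lemma range_move O J (s : O -> J -> M) t : aut A t ->
  A `|` range (concat (fun k => t \o s k)) `<=` t @` (A `|` range (concat s)).
Proof.
move=> at_ m [Am|[[k j] _ <-]]; first by exists m; [left|exact: at_.2].
by exists (s k j) => //; right; exists (k, j).
Qed.

Lemma conjugate_move V (a : V -> M) t : aut A t -> conjugate A a (t \o a).
Proof. by move=> at_; exists t. Qed.

Lemma mutually_indiscernible I J (a : I -> M) (b : J -> M) (F : set_system (I ->
  M))
    (s : nat -> I -> M) (t : nat -> J -> M) :
  small_type kappa I -> small_type kappa J -> UltraFilter F ->
    nonforking kappa A F ->
  realizes_over (A `|` range b) F a ->
  (forall (D : set M) c (Y : set (D + I -> M)), small kappa D ->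
    A `|` range b `<=` D ->
    realizes_over D F c -> definable A Y -> Y (vcat val c) ->
      ~ set_divides kappa A [set y | Y (vcat y c)]) ->
  indisc A s -> s 0 = a -> indisc A t -> t 0 = b ->
  exists s' t', [/\ conjugate A (concat s) (concat s'),
    conjugate A (concat t) (concat t'),
    s' 0 = a /\ t' 0 = b, indisc (A `|` range (concat t')) s' &
    indisc (A `|` range (concat s')) t'].
Proof.
move=> sI sJ FU nF aF nd is_ s0 it t0.
have sn := small_nat kappa_nat.
have sJn : small_type kappa (nat * J) by exact: (small_prod kappa_pow).
have sIn : small_type kappa (nat * I) by exact: (small_prod kappa_pow).
pose D := A `|` range (concat t).
have sD : small kappa D by apply: (small_setU kappa_nat kappa_pow) => //;
  exact: small_range.
have bD : A `|` range b `<=` D.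
  by apply: setUS => _ [j _ <-]; exists (0, j) => //; rewrite /concat /= t0.
have sDT : small_type kappa D by exact/small_setE.
have [c cF] := realizes_over_ex hM FU sI sD.
have [q aq qa] : conjugate (A `|` range b) a c.
  apply: (realizes_over_eqv hM FU) => //; last exact: realizes_overS cF.
  by apply: (small_setU kappa_nat kappa_pow) => //; exact: small_range.
have aqA : aut A q by apply: autW aq; exact: subsetUl.
have ict : indisc (A `|` range c) t by exact: (indisc_realize hM hdep FU nF).
have iqs : indisc A (fun k => q \o s k) by exact: indisc_autA.
have qs0 : q \o s 0 = c by rewrite s0.
have [r ar irs] := indisc_nondividing hM sI sDT sA (fun Y =>
  nd D c Y sD bD cF) iqs qs0.
have arA : aut A r by apply: autW ar; exact: subsetUl.
pose s2 k := r \o (q \o s k).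
have s20 : s2 0 = c.
  by rewrite /s2 qs0; apply/funext => i /=; apply: ar.2; right; exists i.
have is2 : indisc (A `|` range (concat t)) s2.
  by apply: indiscW irs; rewrite range_val => m Dm; right.
have sB : small kappa (A `|` range (concat s2)).
  by apply: (small_setU kappa_nat kappa_pow) => //; exact: small_range.
have [t3 it3 t3P] := @extraction_nat _ _ _ _ hM J t _ sJ sB.
have cB : A `|` range c `<=` A `|` range (concat s2).
  by apply: setUS => _ [i _ <-]; exists (0, i) => //; rewrite /concat /= s20.
(* [t] is indiscernible over [c], so extraction kept its type over [c], and [t3] can be moved back
   to [t] with [c] fixed. *)
have [p ap pt] : conjugate (A `|` range c) (concat t3) (concat t).
  apply: conjugate_sym; apply: (homogeneous hM) => //.
    by apply: (small_setU kappa_nat kappa_pow) => //; exact: small_range.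
  move=> X dX Xt; apply: (t3P X (definableW cB dX)) => u iu.
  exact: (iffLR (conjugate_dfn (ict u iu) dX) Xt).
have apA : aut A p by apply: autW ap; exact: subsetUl.
have pt3 : (fun k => p \o t3 k) = t.
  by apply/funext => k; apply/funext => j;
    exact: (congr1 (fun f => f (k, j)) pt).
have is3 : indisc (A `|` range (concat t3)) s2.
  move=> u iu; apply: (homogeneous hM) => //.
    by apply: (small_setU kappa_nat kappa_pow) => //; exact: small_range.
  move=> Z /definable_split[Y [dY ZY]] /ZY Y2; apply/ZY.
  (* As [s2] is indiscernible over [t], this implication holds for every subsequence of [t]; its
     parameters lie in [s2], so it passes to [t3]. *)
  pose W := [set x : nat * J -> M | Y (vcat (concat s2) x) ->
    Y (vcat (concat (s2 \o u)) x)].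
  have dW : definable (A `|` range (concat s2)) W.
    apply: definableimp; apply: definable_subst dY; try exact: subsetUl.
      move=> [[k i]|z]; last by left; exists z.
      by right; exists (s2 k i) => //; right; exists (k, i).
    move=> [[k i]|z]; last by left; exists z.
    by right; exists (s2 (u k) i) => //; right; exists (u k, i).
  apply: (t3P W dW) Y2 => v iv Yv.
  have dYv : definable (A `|` range (concat t)) [set x : nat * I ->
    M | Y (vcat x (concat (t \o v)))].
    apply: definable_vcat dY; first exact: subsetUl.
    by move=> _ [[k j] _ <-]; right; exists (v k, j).
  exact: (iffLR (conjugate_dfn (is2 u iu) dYv) Yv).
have is4 : indisc (A `|` range (concat t)) (fun k => p \o s2 k).
  rewrite -pt3; exact: (indisc_move apA (@subsetUl _ A _)
    (@range_move _ _ t3 p apA) is3).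
have it4 : indisc (A `|` range (concat (fun k => p \o s2 k))) t.
  rewrite -pt3; exact: (indisc_move apA (@subsetUl _ A _)
    (@range_move _ _ s2 p apA) it3).
(* The whole configuration is moved back from [c] to [a] over [b]. *)
have [q' [aq' qq' q'q]] := aut_inv aq.
have aq'A : aut A q' by apply: autW aq'; exact: subsetUl.
exists (fun k => q' \o (p \o s2 k)), (fun k => q' \o t k); split.
- exists (q' \o (p \o (r \o q))) => //.
  by do 2! apply: aut_comp => //; exact: aut_comp.
- exact: conjugate_move.
- split.
    rewrite s20; apply/funext => i /=; rewrite ap.2; last by right; exists i.
    by have := congr1 (fun f => f i) qa => /= <-; rewrite qq'.
  by rewrite t0; apply/funext => j /=; apply: aq'.2; right; exists j.
- exact: (indisc_move aq'A (@subsetUl _ A _) (@range_move _ _ t q' aq'A) is4).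
- exact: (indisc_move aq'A (@subsetUl _ A _) (@range_move _ _ (fun k =>
    p \o s2 k) q' aq'A) it4).
Qed.

Lemma indiscernible_aut (B B' : set M) d (O : orderType d) J (s : O -> J ->
  M) t :
  automorphism t -> B' `<=` t @` B -> indiscernible B s ->
  indiscernible B' (fun k => t \o s k).
Proof.
move=> ta B'B is_ n u v iu iv; apply/equiv_overE => X dX.
have dX' : definable B [set w | X (t \o w)].
  by apply: definable_aut_pre dX => // m /B'B[m' Bm' <-]; exists m'.
exact: (iffLR (equiv_overE _ _ _) (is_ n u v iu iv) _ dX').
Qed.

Lemma indiscernibleW (B B' : set M) d (O : orderType d) J (s : O -> J -> M) :
  B `<=` B' -> indiscernible B' s -> indiscernible B s.
Proof.
move=> BB' is_ n u v iu iv; apply/equiv_overE => X dX.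
exact: (iffLR (equiv_overE _ _ _) (is_ n u v iu iv) _ (definableW BB' dX)).
Qed.

Lemma same_EM_transfer (B : set M) d (O : orderType d) J (t : nat -> J -> M)
    (tO : O -> J -> M) (X : set (O * J -> M)) : same_EM B t tO ->
      definable B X ->
  (forall f : O -> nat, X (fun z => t (f z.1) z.2)) -> X (concat tO).
Proof.
move=> et /definable_ordered_support[n [v [Y [iv dY XY]]]] h; apply/XY.
have /choice[f fP] : forall o, exists m, forall k, v k = o -> m = val k.
  move=> o; have [[k vk]|nk] := pselect (exists k, v k = o); last first.
    by exists 0 => k vk; case: nk; exists k.
  exists (val k) => k' vk'; case: (ltngtP k k') => // kk'.
    by have := iv _ _ kk'; rewrite vk vk' ltxx.
  by have := iv _ _ kk'; rewrite vk vk' ltxx.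
have iid : increasing_tuple (fun k : 'I_n => val k) by [].
have /XY Yf := h f.
apply: (iffLR (iffLR (equiv_overE _ _ _) (et n val v iid iv) Y dY)).
by congr (Y _): Yf; apply/funext => -[k j]; rewrite /concat /= (fP _ k).
Qed.

Lemma same_EM_first (B : set M) d (O : orderType d) d' (O' : orderType d') J
    (s : O -> J -> M) (s' : O' -> J -> M) o o' (X : set (J -> M)) :
  same_EM B s s' -> definable B X -> X (s o) -> X (s' o').
Proof.
move=> es dX.
have i1 dd (OO : orderType dd) (x : OO) : increasing_tuple (fun _ : 'I_1 =>
  x) by move=> [[|//] ?] [[|//] ?].
have := es 1 _ _ (i1 _ _ o) (i1 _ _ o') => /equiv_overE e.
exact: (iffLR (e _ (definable_pre (fun j => (ord0 : 'I_1, j)) dX))).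
Qed.

Lemma same_EM_trans (B : set M) d (O : orderType d) d' (O' : orderType d') J
    (s : O -> J -> M) (t : nat -> J -> M) (s' : O' -> J -> M) :
  same_EM B s t -> same_EM B t s' -> same_EM B s s'.
Proof.
move=> est ets n v v' iv iv'; have iid : increasing_tuple (fun k : 'I_n =>
  val k) by [].
by rewrite /equiv_over (est n v _ iv iid) (ets n _ v' iid iv').
Qed.

Lemma same_EM_aut (B : set M) d (O : orderType d) d' (O' : orderType d') J
    (s : O -> J -> M) (s' : O' -> J -> M) t :
  aut B t -> same_EM B s s' -> same_EM B s (fun k => t \o s' k).
Proof.
move=> at_ es n v v' iv iv'; apply/equiv_overE => X dX.
rewrite (iffLR (equiv_overE _ _ _) (es n v v' iv iv') X dX).
exact: aut_dfn at_ dX.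
Qed.

Lemma same_EMW (B B' : set M) d (O : orderType d) d' (O' : orderType d') J
    (s : O -> J -> M) (s' : O' -> J -> M) : B `<=` B' -> same_EM B' s s' ->
      same_EM B s s'.
Proof.
move=> BB' es n v v' iv iv'; apply/equiv_overE => X dX.
exact: (iffLR (equiv_overE _ _ _) (es n v v' iv iv') X (definableW BB' dX)).
Qed.

Lemma conjugate_emeq (B : set M) d (O : orderType d) J (s s' : nat -> J ->
  M) (sO : O -> J -> M) :
  same_EM B sO s -> conjugate B (concat s) (concat s') -> same_EM B sO s'.
Proof.
move=> es [r ar rs]; rewrite (_ : s' = (fun k => r \o s k));
  first exact: same_EM_aut.
by apply/funext => k; apply/funext => j; have := congr1 (fun f => f (k, j)) rs.
Qed.

Lemma same_EM_nat d (O : orderType d) J (s : O -> J ->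
  M) o : small_type kappa J ->
  infinite_set [set: O] -> indiscernible A s ->
  exists s', [/\ indisc A s', s' 0 = s o & same_EM A s s'].
Proof.
move=> sJ infO is_.
have [s' is' es] := @stretch _ _ _ _ hM J A d O o s _ nat infO is_ sJ (small_nat
  kappa_nat) sA.
have [r ar rs] : conjugate A (s' 0) (s o).
  by apply: conjugate_sym; apply: (homogeneous hM) => // X dX; move=> Xs;
    exact: (@same_EM_first _ _ _ _ _ _ _ _ o 0 X es dX Xs).
exists (fun k => r \o s' k); split=> //; last exact: same_EM_aut.
by apply: indisc_autA => //; exact/(indiscE hM).
Qed.

Lemma equiv_over_from d (O : orderType d) J (s s' : O -> J -> M) o (a : J ->
  M) :
  small_type kappa J -> small_type kappa O -> same_EM A s s' -> s o = a ->
    s' o = a ->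
  equiv_over (A `|` range a) (concat s') (concat s).
Proof.
move=> sJ sO es so s'o; have [r ar rs] := same_EM_eqv hM sJ sO sA es.
apply/equiv_overE => X dX; rewrite -rs; apply: iff_sym; apply: aut_dfn dX.
split; first exact: ar.1.
move=> m [Am|[j _ <-]]; first exact: ar.2.
have := congr1 (fun f => f (o, j)) rs; rewrite /concat /=.
by rewrite so s'o.
Qed.

(** The definitions admit arbitrary infinite orders. Sequences along the natural numbers with the
    same Ehrenfeucht-Mostowski types are made mutually indiscernible and stretched in turn, each
    over the other: the indiscernibility of the fixed one is expressed by formulas with parameters
    in it, which stretching preserves. *)
Theorem mutually_indiscernible_orders I J (a : I -> M) (b : J ->
  M) (F : set_system (I -> M))
    d (O : orderType d) o d' (O' : orderType d') o' (s : O -> I -> M) (t : O' ->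
      J -> M) :
  small_type kappa I -> small_type kappa J -> UltraFilter F ->
    nonforking kappa A F ->
  realizes_over (A `|` range b) F a ->
  (forall (D : set M) c (Y : set (D + I -> M)), small kappa D ->
    A `|` range b `<=` D ->
    realizes_over D F c -> definable A Y -> Y (vcat val c) ->
      ~ set_divides kappa A [set y | Y (vcat y c)]) ->
  small_type kappa O -> small_type kappa O' -> infinite_set [set: O] ->
    infinite_set [set: O'] ->
  indiscernible A s -> s o = a -> indiscernible A t -> t o' = b ->
  exists s' t', [/\ equiv_over (A `|` range a) (concat s') (concat s),
    equiv_over (A `|` range b) (concat t') (concat t),
    indiscernible (A `|` range (concat t')) s' &
    indiscernible (A `|` range (concat s')) t'].
Proof.
move=> sI sJ FU nF aF nd sO sO' infO infO' is_ so it to.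
have [s1 [is1 s10 es1]] := same_EM_nat o sI infO is_.
have [t1 [it1 t10 et1]] := same_EM_nat o' sJ infO' it.
rewrite so in s10; rewrite to in t10.
have [s2 [t2 [ss2 tt2 [s20 t20] is2 it2]]] :=
  mutually_indiscernible sI sJ FU nF aF nd is1 s10 it1 t10.
have es2 : same_EM A s s2 by exact: conjugate_emeq ss2.
have et2 : same_EM A t t2 by exact: conjugate_emeq tt2.
have sn := small_nat kappa_nat.
have infn : infinite_set [set: nat] by exact: infinite_nat.
have sB2 : small kappa (A `|` range (concat t2)).
  by apply: (small_setU kappa_nat kappa_pow) => //; apply: small_range;
    exact: (small_prod kappa_pow).
have [s3 is3 es3] := @stretch _ _ _ _ hM I _ _ nat 0 s2 _ O infn
  (iffLR (indiscE hM _ sI sB2) is2) sI sO sB2.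
have sB3 : small kappa (A `|` range (concat s3)).
  by apply: (small_setU kappa_nat kappa_pow) => //; apply: small_range;
    exact: (small_prod kappa_pow).
have it3 : indisc (A `|` range (concat s3)) t2.
  move=> u iu; apply: (homogeneous hM) => //;
    first exact: (small_prod kappa_pow).
  move=> Z /definable_split[Y [dY ZY]] /ZY Y2; apply/ZY.
  pose W := [set x : O * I -> M | Y (vcat (concat t2) x) ->
    Y (vcat (concat (t2 \o u)) x)].
  have dW : definable (A `|` range (concat t2)) W.
    apply: definableimp; apply: definable_subst dY; try exact: subsetUl.
      move=> [[k i]|z]; last by left; exists z.
      by right; exists (t2 k i) => //; right; exists (k, i).
    move=> [[k i]|z]; last by left; exists z.
    by right; exists (t2 (u k) i) => //; right; exists (u k, i).
  apply: (same_EM_transfer es3 dW) Y2 => f Yf.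
  have dYf : definable (A `|` range (concat s2)) [set x : nat * J ->
    M | Y (vcat x (fun z : O * I => s2 (f z.1) z.2))].
    apply: definable_vcat dY; first exact: subsetUl.
    by move=> _ [[k j] _ <-]; right; exists (f k, j).
  exact: (iffLR (conjugate_dfn (it2 u iu) dYf) Yf).
have [t3 it3' et3] := @stretch _ _ _ _ hM J _ _ nat 0 t2 _ O' infn
  (iffLR (indiscE hM _ sJ sB3) it3) sJ sO' sB3.
have is3' : indiscernible (A `|` range (concat t3)) s3.
  move=> n v v' iv iv'; apply/equiv_overE.
  suff h : forall w w' : 'I_n -> O, increasing_tuple w -> increasing_tuple w' ->
    forall X,
      definable (A `|` range (concat t3)) X ->
      X (concat (fun k => s3 (w k))) -> X (concat (fun k => s3 (w' k))).
    by move=> X dX; split; exact: h.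
  move=> w w' iw iw' Z /definable_split[Y [dY ZY]] /ZY Y2; apply/ZY.
  pose W := [set x : O' * J -> M | Y (vcat (concat (fun k => s3 (w k))) x) ->
    Y (vcat (concat (fun k => s3 (w' k))) x)].
  have dW : definable (A `|` range (concat s3)) W.
    apply: definableimp; apply: definable_subst dY; try exact: subsetUl.
      move=> [[k i]|z]; last by left; exists z.
      by right; exists (s3 (w k) i) => //; right; exists (w k, i).
    move=> [[k i]|z]; last by left; exists z.
    by right; exists (s3 (w' k) i) => //; right; exists (w' k, i).
  apply: (same_EM_transfer et3 dW) Y2 => f Yf.
  have dYf : definable (A `|` range (concat t2)) [set x : 'I_n * I ->
    M | Y (vcat x (fun z : O' * J => t2 (f z.1) z.2))].
    apply: definable_vcat dY; first exact: subsetUl.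
    by move=> _ [[k j] _ <-]; right; exists (f k, j).
  exact: (iffLR (iffLR (equiv_overE _ _ _) (is3 n w w' iw iw') _ dYf) Yf).
(* The pair of chosen terms has kept the type of (a, b) over [A] through both stretchings. *)
have [r ar rab] : conjugate A (vcat (s3 o) (t3 o')) (vcat a b).
  apply: conjugate_sym; apply: (homogeneous hM) => //;
    first exact: (small_sum kappa_nat kappa_pow).
  move=> X dX; rewrite -s20 -t20 => X2.
  have X3 : X (vcat (s3 o) (t2 0)).
    apply: (@same_EM_first _ _ _ _ _ _ _ _ 0 o [set x | X (vcat x (t2 0))] es3 _
      X2).
    apply: definable_vcat dX; first exact: subsetUl.
    by move=> _ [j _ <-]; right; exists (0, j).
  apply: (@same_EM_first _ _ _ _ _ _ _ _ 0 o' [set x | X (vcat (s3 o)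
    x)] et3 _ X3).
  apply: definable_subst dX; first exact: subsetUl.
  by move=> [i|j]; [right; exists (s3 o i) => //; right; exists (o, i)|left;
    exists j].
have rs3 : r \o s3 o = a by apply/funext => i;
  exact: (congr1 (fun f => f (inl i)) rab).
have rt3 : r \o t3 o' = b by apply/funext => j;
  exact: (congr1 (fun f => f (inr j)) rab).
have em_s : same_EM A s (fun k => r \o s3 k).
  apply: same_EM_aut => //; apply: same_EM_trans es2 _; apply: same_EMW es3;
    exact: subsetUl.
have em_t : same_EM A t (fun k => r \o t3 k).
  apply: same_EM_aut => //; apply: same_EM_trans et2 _; apply: same_EMW et3;
    exact: subsetUl.
exists (fun k => r \o s3 k), (fun k => r \o t3 k); split.
- exact: (equiv_over_from (o := o)).
- exact: (equiv_over_from (o := o')).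
- exact: (indiscernible_aut ar.1 (@range_move _ _ t3 r ar) is3').
- exact: (indiscernible_aut ar.1 (@range_move _ _ s3 r ar) it3').
Qed.

End Mutual.

(** * The equivalence *)

Section Equivalence.
Context {L : language} {T : set (sentence L)} {kappa : Type} {M : structure L}.
Hypothesis hM : monster T kappa M.
Hypothesis hdep : dependent T.

Let kappa_nat := monster_uncountable hM.
Let kappa_pow := monster_strong_limit hM.

Variable A : set M.
Hypotheses (sA : small kappa A) (eA : extension_base kappa A).

Lemma equiv_over_first O I (a : I -> M) (s s' : O -> I -> M) o :
  equiv_over (A `|` range a) (concat s') (concat s) -> s o = a -> s' o = a.
Proof.
move=> /equiv_overE e so; apply/funext => i.
have ai : a i \in A `|` range a by apply/mem_set; right; exists i.
have dE : definable (A `|` range a) [set v : O * I -> M | v (o, i) = a i].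
  by exists (Eq (Var L (inl (o, i))) (Var L (inr (SigSub ai :
    A `|` range a)%classic))).
by apply: (iffRL (e _ dE)); rewrite /= /concat /= so.
Qed.

Lemma ultra_exists (U : set_system nat) n (P : nat -> nat ->
  Prop) : UltraFilter U ->
  U [set m | exists2 i, (i < n)%N & P i m] ->
    exists2 i, (i < n)%N & U [set m | P i m].
Proof.
move=> UU; elim: n => [|n IH] h; first by have [m []] := filter_ex h.
have : U ([set m | P n m] `|` [set m | exists2 i, (i < n)%N & P i m]).
  apply: filterS h => m [i]; rewrite ltnS leq_eqVlt => /predU1P[->|ni] Pi;
    first by left.
  by right; exists i.
move=> /ultraU[h'|/IH[i ni Ui]]; first by exists n.
by exists i => //; exact: ltnW.
Qed.

Lemma ultra_increasing (U : set_system nat) (S : set nat) : UltraFilter U ->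
  (forall N, U [set k | (N <= k)%N]) -> U S ->
    exists2 u, increasing u & forall k, S (u k).
Proof.
move=> UU Uc US; apply: infinite_increasing => N.
by have [k [Sk Nk]] := filter_ex (filterI US (Uc N)); exists k.
Qed.

Section Pair.
Variables (I J : Type) (a : I -> M) (b : J -> M).
Hypotheses (sI : small_type kappa I) (sJ : small_type kappa J).

Lemma strict_nonforking_ultra : strict_nonforking kappa A a b ->
  exists F : set_system (I -> M), [/\ UltraFilter F, nonforking kappa A F,
    realizes_over (A `|` range b) F a &
    forall (D : set M) c (Y : set (D + I -> M)), small kappa D ->
      A `|` range b `<=` D -> realizes_over D F c -> definable A Y ->
        Y (vcat val c) ->
      ~ set_divides kappa A [set y | Y (vcat y c)]].
Proof.
move=> [p [[pcons ptot] tpp nfp stp]].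
have [|F [FU pF]] := @fip_ultrafilter (I ->
  M) [set X | exists2 phi, p phi & X = [set x | sat x phi]].
  move=> l lp; have [|q [q1 q2]] := @In_choice _ _ (fun phi X =>
    p phi /\ X = [set x : I -> M | sat x phi]) l.
    by move=> X /lp[phi ? ?]; exists phi.
  have [||x xq] := pcons [set phi | List.In phi q]; first exact: list_finite.
    by move=> phi /q1[X _ []].
  by exists x => X /q2[phi /xq ? [_ ->]].
have pN phi : p (Not phi) -> ~ F [set x | sat x phi].
  move=> pn; apply/ultraN; apply: pF; exists (Not phi) => //.
exists F; split=> //.
- move=> X sX FX; have [phi dphi phiX] := set_divides_divides hM sA sX.
  have [pphi|/pN[]] := ptot phi; last first.
    by apply: filterS FX => x /phiX.
  apply: nfp; exists [set phi]; split; first exact: finite_set1.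
    by move=> _ ->.
  exists [set phi]; split; first exact: finite_set1.
    by move=> _ ->.
  by move=> c /(_ phi erefl) ?; exists phi.
- move=> X [psi psiX] FX; apply: contrapT => nXa.
  have e x : sat x (subst_params psi val)
    <-> X x by rewrite sat_subst_params psiX.
  apply: (pN (subst_params psi val)); last by apply: filterS FX => x /e.
  apply: tpp; split; last by move=> /e.
  by exists (Not psi).
move=> D c Y sD bD cF dY Yc sY; apply: (stp D sD bD c).
  move=> phi [pphi [psi _ ephi]]; apply: (cF [set x | sat x phi]); last first.
    by apply: pF; exists phi.
  by exists psi => x; rewrite -ephi /= sat_subst_params.
have [phi dphi phiY] := set_divides_divides hM sA sY; exists phi => //.
have [psi psiY] : definable (A `|` range c) [set y : D ->
  M | Y (vcat y c)] by exact: definable_join.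
exists [set subst_params psi val]; split; first exact: finite_set1.
  by move=> _ ->; split; [exists psi|rewrite sat_subst_params -psiY].
move=> y /(_ _ erefl); rewrite sat_subst_params -psiY => Yy.
by exists phi => //; apply/phiY.
Qed.

(** A realization [c] over [D] has the type of [b] over [A]. A dividing formula implied by tp(D/Ac)
    thus yields some Y with Y(y, b) dividing and Y true at [D] and [c], which [F] excludes. *)
Lemma strict_type_nonforking F : strict_type (kappa :=
  kappa) A (A `|` range a) b F ->
  strict_nonforking kappa A b a.
Proof.
move=> [FU nF bF Fst]; exists [set phi | F [set x | sat x phi]].
have bA : realizes_over A F b by apply: realizes_overS bF; exact: subsetUl.
split.
- split.
    move=> q /finite_set_list[l ql] qF.
    have : F (cap_list (map (fun phi => [set x | sat x phi]) l)).
      by apply: filter_cap => X Xl; have [phi /ql/qF h ->] := In_map Xl.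
    move=> /filter_ex[x xl]; exists x => phi /ql phil.
    exact: (xl _ (map_In (fun phi => [set x | sat x phi]) phil)).
  move=> phi; have [|h] := in_ultra_setVsetC [set x | sat x phi] FU;
    first by left.
  by right; exact: h.
- move=> phi [[psi _ <-] sb] /=.
  have dX : definable (A `|` range a) [set x : J ->
    M | sat x (subst_params psi val)].
    by exists psi => x; rewrite /= sat_subst_params.
  exact: (iffLR (realizes_overE FU bF dX) sb).
- move=> [G [/finite_set_list[lg lG] Gd [q [/finite_set_list[l ql] qF h]]]].
  have Fl : F (cap_list (map (fun phi => [set x | sat x phi]) l)).
    by apply: filter_cap => X Xl; have [phi /ql/qF h' ->] := In_map Xl.
  have nG : F (cap_list (map (fun phi => [set x | ~ sat x phi]) lg)).
    apply: filter_cap => X Xl; have [phi phil ->] := In_map Xl.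
    apply/ultraN; apply: nF; apply: (divides_sdiv hM sA); apply: Gd; exact/lG.
  have [x [xl xG]] := filter_ex (filterI Fl nG).
  have [|phi /lG phil sphi] := h x.
    by move=> phi /ql phil; exact: (xl _ (map_In (fun phi =>
      [set x | sat x phi]) phil)).
  exact: (xG _ (map_In (fun phi => [set x | ~ sat x phi]) phil)).
move=> D sD aD c cF [phi dphi [q [/finite_set_list[l ql] qtp h]]].
have cD : realizes_over D F c.
  move=> X [psi psiX] FX; apply/psiX; rewrite -sat_subst_params.
  apply: cF; split; last by exists psi.
  by apply: filterS FX => x /psiX; rewrite /= sat_subst_params.
have AD : A `<=` D by move=> m Am; apply: aD; left.
pose X := cap_list (map (fun phi : Mformula D => [set y | sat y phi]) l).
have dX : definable (A `|` range c) X.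
  apply: definable_cap => Z Zl; have [chi /ql/qtp[[psi _ <-] _] ->] :=
    In_map Zl.
  by exists psi => x; rewrite /= sat_subst_params.
have [Y [dY XY]] := definable_split dX.
have sDT : small_type kappa D by exact/small_setE.
have Yphi y : Y (vcat y c) -> sat y phi.
  move=> /XY yX; have [|_ -> //] := h y.
  by move=> chi /ql chil; exact: (yX _ (map_In (fun phi : Mformula D =>
    [set y | sat y phi]) chil)).
have Yval : Y (vcat val c).
  by apply/XY => Z Zl; have [chi /ql/qtp[_ ?] ->] := In_map Zl.
(* Y(y, c) implies the dividing formula [phi] and hence divides itself. *)
have [s [is_ s0 sn]] := set_divides_witness hM sDT sJ sA (divides_sdiv hM sA
  dphi) dY Yphi.
have sYc : set_divides kappa A [set y | Y (vcat y c)].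
  by rewrite -s0; exact: (set_divides_intro hM sDT sJ sA dY is_ sn).
have [r ar rb] : conjugate A b c.
  exact: (realizes_over_eqv hM FU sJ sA bA (realizes_overS AD cD)).
have sYb : set_divides kappa A [set y | Y (vcat y b)].
  have := set_divides_aut ar sYc; congr (set_divides _ _ _); apply/funext => y;
    apply/propext.
  rewrite /= (aut_dfn (vcat y b) ar dY); apply/propeqP; congr Y.
  by apply/funext => -[i|j] //=; rewrite -rb.
have FY := Fst D Y sD dY sYb.
have dYv : definable D [set x : J -> M | ~ Y (vcat val x)].
  apply: definableN; apply: definable_subst dY => //.
  by move=> [x|j]; [right; exists (val x) => //; exact/set_mem/valP|left;
    exists j].
exact: (cD _ dYv FY Yval).
Qed.

Lemma strict_nonforking_independent : strict_nonforking kappa A a b ->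
  strictly_independent kappa A (pair_family (MTuple a) (MTuple b)).
Proof.
move=> /strict_nonforking_ultra[F [FU nF aF nd]] d O s hs.
have [infO1 /smallTE sO1 is1 s1] := hs false.
have [infO2 /smallTE sO2 is2 s2] := hs true.
have [s' [t' [es et is' it']]] := @mutually_indiscernible_orders _ _ _ _ hM hdep
  A sA I J a b F
  d (O false) \bot%O d (O true) \bot%O (s false) (s true)
  sI sJ FU nF aF nd sO1 sO2 infO1 infO2 is1 s1 is2 s2.
exists (fun i => match i return O i ->
  tidx (pair_family (MTuple a) (MTuple b) i) -> M with
  true => t' | false => s' end).
split=> -[] //.
  apply: indiscernibleW it' => m [Am|[[] // _ h]]; first by left.
  by right.
apply: indiscernibleW is' => m [Am|[[] // _ h]]; first by left.
by right.
Qed.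

(** The first term of a sequence belongs to it, so half-independence asks for less. In the ordered
    pair the tuple at [false] comes first, so that [b] precedes [a]; the two indices are exchanged
    accordingly. *)
Lemma strictly_half_strictly :
  strictly_independent kappa A (pair_family (MTuple a) (MTuple b)) ->
  half_strictly_independent kappa A (pair_family (MTuple b) (MTuple a)).
Proof.
move=> ind_ab d O s hs.
have [|s' [eqs inds]] := ind_ab d (fun i => O (~~ i))
  (fun i => match i return O (~~ i) ->
    tidx (pair_family (MTuple a) (MTuple b) i) -> M with
    true => s false | false => s true end).
  by move=> -[]; [exact: hs false|exact: hs true].
exists (fun i => match i return O i ->
  tidx (pair_family (MTuple b) (MTuple a) i) -> M with
  true => s' false | false => s' true end).
have [_ _ _ s1] := hs true.
have s'a : s' false \bot%O = a := equiv_over_first (eqs false) s1.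
split=> -[]; [exact: (eqs false)|exact: (eqs true)| |].
  apply: indiscernibleW (inds false) => m [[Am|[[] // _ h]]|[[] //]];
    first by left.
  by right; exists true.
apply: indiscernibleW (inds true) => m [[Am|[[] //]]|[[] // _ [x _ <-]]];
  first by left.
by right; exists false => //; exists (\bot%O, x) => //; rewrite /concat /= s'a.
Qed.

Lemma half_strictly_strict_type :
  half_strictly_independent kappa A (pair_family (MTuple b) (MTuple a)) ->
  exists F, strict_type (kappa := kappa) A (A `|` range a) b F.
Proof.
move=> half; apply: strict_type_fip => l.
move=> /list_partition[l12 [l3 [/list_partition[l1 [l2 [h1 h2 h12]]] h3 h]]].
apply: contrapT => l0.
have sn := small_nat kappa_nat.
have [|Xs [Xs1 Xs2]] := @In_choice _ _ (fun X Z =>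
  set_divides kappa A X /\ Z = ~` X) l2.
  by move=> Z /h2[X ? ->]; exists X.
have [|K [w [lz [sK lz1 lz2]]]] := @set_divides_join _ _ _ _ hM A J Xs;
  first by move=> X /Xs1[? _ []].
pose ent := {S : set M & set (S + J -> M)}.
have [|es [es1 es2]] := @In_choice ent _ (fun p Z => let: existT D Y := p in
    [/\ small kappa D, definable A Y, set_divides kappa A [set y | Y (vcat y b)]
      &
      Z = [set x | ~ Y (vcat val x)]]) l3.
  by move=> Z /h3[S [Y P]]; exists (existT _ S Y).
have [Theta [dTheta ThetaP]] : exists Y : set (J + I -> M), definable A Y /\
    forall v, cap_list l1 v <-> Y (vcat v a).
  by apply: definable_split; apply: definable_cap => X /h1[].
have Tb : Theta (vcat b a) by apply/ThetaP => X /h1[].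
pose E := [set m | exists2 S, List.In S (map (fun p : ent =>
  projT1 p) es) & S m].
have sE : small_type kappa E.
  apply/small_setE; apply: (small_bigU hM) => S Sl.
  by have [[S' Y] /es1[Z _ [? _ _ _]] ->] := In_map Sl.
(* The sequence to be found starts with [a] together with all parameters: [w] for the formulas of
   the first kind, the elements of [E] for those of the second. *)
pose V := (I + (K + E))%type.
have sV : small_type kappa V by do 2! (apply: (small_sum kappa_nat kappa_pow) =>
  //).
pose D : V -> M := vcat a (vcat w val).
pose Zx i : set (J + V -> M) := [set v | nth set0 lz i (fun z => match z with
  | inl j => v (inl j) | inr k => v (inr (inr (inl k))) end)].
have ZxE i x (d : V -> M) : Zx i (vcat x d) <-> nth set0 lz i (vcat x (fun k =>
  d (inr (inl k)))).
  rewrite /Zx /= (_ : (fun z : J + K => _) = vcat x (fun k => d (inr (inl k)))).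
    exact: iff_refl.
  by apply/funext => -[].
have /choice[rows rowsP] : forall i, exists s : nat -> V ->
  M, (i < size lz)%N ->
    [/\ definable A (Zx i), indisc A s, s 0 = D & forall x, ~ forall k,
      Zx i (vcat x (s k))].
  move=> i; have [il|_] := ltnP i (size lz); last by exists (fun=> D).
  have [dZ sZ] := lz1 _ (In_nth set0 il).
  have dZx : definable A (Zx i).
    by apply: definable_subst dZ => // -[j|k]; left;
      [exists (inl j)|exists (inr (inr (inl k)))].
  have [|s [? ? ?]] := set_divides_witness hM sJ sV sA sZ (d := D) dZx;
    last by exists s.
  by move=> x /ZxE.
have [s [is_ s0 sinc]] := universal_witness hM hdep sA eA sV rowsP.
pose p0 : ent := existT _ set0 setT.
pose Ye j := projT2 (nth p0 es j).
have /choice[rowsb rowsbP] : forall j, exists s : nat -> J ->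
  M, (j < size es)%N ->
    [/\ definable A (Ye j), indisc A s, s 0 = b & forall x, ~ forall k,
      Ye j (vcat x (s k))].
  move=> j; have [jl|_] := ltnP j (size es); last by exists (fun=> b).
  rewrite /Ye; case: (nth p0 es j) (In_nth p0 jl) =>
    S Y /es1[Z _ [sS dY sY _]] /=.
  have sST : small_type kappa S by exact/small_setE.
  by have [t [? ? ?]] := set_divides_witness hM sST sJ sA sY dY (fun _ h => h);
    exists t.
have [t [it t0 tinc]] := universal_witness hM hdep sA eA sJ rowsbP.
(* Half-independence concerns sequences starting with [a], so the other coordinates are forgotten
   for a while. *)
pose sa k : I -> M := s k \o inl.
have isa : indisc A sa by exact: (indisc_pre inl is_).
have [|s' [eqs inds]] := half _ (fun=> nat : bOrderType _)
    (fun i => match i return nat -> tidx (pair_family (MTuple b) (MTuple a) i)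
      -> M with
       true => sa | false => t end).
  have infn : infinite_set [set: nat] by exact: infinite_nat.
  move=> -[]; split=> //.
  - exact: (iffLR (indiscE hM _ sI sA)).
  - by rewrite /sa; change (s 0 \o inl = a); rewrite s0.
  - exact: (iffLR (indiscE hM _ sJ sA)).
pose t' : nat -> J -> M := s' false; pose a' : nat -> I -> M := s' true.
have t'0 : t' 0 = b := equiv_over_first (eqs false) t0.
have a'0 : a' 0 = a.
  apply: (equiv_over_first (eqs true)); by change (s 0 \o inl = a); rewrite s0.
have sAa : small kappa (A `|` range a) by apply:
  (small_setU kappa_nat kappa_pow) => //; exact: small_range.
have sAt : small kappa (A `|` range (concat t')).
  by apply: (small_setU kappa_nat kappa_pow) => //; apply: small_range;
    exact: (small_prod kappa_pow).
have it' : indisc (A `|` range a) t'.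
  apply: (iffRL (indiscE hM _ sJ sAa));
    apply: indiscernibleW (inds false) => m [Am|am].
    by left; left.
  by right; exists true.
have ia' : indisc (A `|` range (concat t')) a'.
  apply: (iffRL (indiscE hM _ sI sAt));
    apply: indiscernibleW (inds true) => m [Am|tm].
    by left; left.
  by left; right; exists false.
have [r ar rs] : conjugate A (concat sa) (concat a').
  apply: (homogeneous hM) => //; first exact: (small_prod kappa_pow).
  by move=> X dX; apply: (iffRL (iffLR (equiv_overE _ _ _) (eqs true)
    X (definableW (@subsetUl _ _ _) dX))).
have [q aq qt] : conjugate A (concat t') (concat t).
  apply: (homogeneous hM) => //; first exact: (small_prod kappa_pow).
  by move=> X dX; apply: (iffLR (iffLR (equiv_overE _ _ _) (eqs false)
    X (definableW (@subsetUl _ _ _) dX))).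
(* [r] restores the forgotten coordinates: [s2] projects onto [a'] and, being conjugate to [s],
   witnesses the same dividings. *)
pose s2 k := r \o s k.
have is2 : indisc A s2 by exact: indisc_autA.
have Tta m k : Theta (vcat (t' m) (a' k)).
  have d1 : definable (A `|` range a) [set v : J ->
    M | Theta (vcat v a)] by exact: definable_join.
  have /(indisc_elt m it' d1) Tm : [set v : J ->
    M | Theta (vcat v a)] (t' 0) by rewrite /= t'0.
  have d2 : definable (A `|` range (concat t')) [set v : I ->
    M | Theta (vcat (t' m) v)].
    apply: definable_subst dTheta; first exact: subsetUl.
    by move=> [j|i]; [right; exists (t' m j) => //; right; exists (m, j)|left;
      exists i].
  by apply/(indisc_elt k ia' d2); rewrite /= a'0.
(* An automorphism taking [D] to [s2 k] is undone: the preimage of [t' m] satisfies the part [l1] of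
   the type, so it violates one of the other conditions, as those in [l] have no common solution. *)
have cover m k : (exists2 i, (i < size lz)%N & Zx i (vcat (t' m) (s2 k))) \/
    (exists2 j, (j < size es)%N & forall h' : projT1 (nth p0 es j) -> V,
      (forall x, D (h' x) = val x) -> Ye j (vcat (s2 k \o h') (t' m))).
  have [g ag gD] : conjugate A D (s2 k).
    have [g ag gs] := is_ _ (@increasing_addn k); exists (r \o g);
      first exact: aut_comp.
    apply/funext => v /=; rewrite -s0.
    by have := congr1 (fun f => f (0, v)) gs; rewrite /concat /= addn0 => ->.
  have [g' [ag' gg' g'g]] := aut_inv ag.
  have gt : g \o (g' \o t' m) = t' m by apply/funext => j /=; rewrite g'g.
  have Tx : cap_list l1 (g' \o t' m).
    apply/ThetaP; have := iffLR (aut_dfn _ ag' dTheta) (Tta m k);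
      congr (Theta _).
    apply/funext => -[j|i] //=.
    have := congr1 (fun f => f (k, i)) rs; rewrite /concat /sa /= => <-.
    have := congr1 (fun f => f (inl i)) gD; rewrite /s2 /= => <-.
    by rewrite gg'.
  apply: contrapT => /not_orP[n1 n2]; apply: l0.
  exists (g' \o t' m) => Z /h[/h12[/Tx//|/Xs2[X /lz2[Z' /(nth_In set0)[i il Zi]
    XZ'] [_ ->]]]|].
    move=> /XZ' Zw; apply: n1; exists i => //.
    have [dZ' _] := lz1 _ (In_nth set0 il).
    apply/ZxE; rewrite Zi in dZ' *.
    have := iffLR (aut_dfn _ ag dZ') Zw; congr (Z' _);
      apply/funext => -[j|x] /=.
      by rewrite g'g.
    exact: (congr1 (fun f => f (inr (inl x))) gD).
  move=> /es2[p pes Pp]; have [j jl pj] := nth_In p0 pes; rewrite -pj in Pp.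
  apply: contrapT => nZ; apply: n2; exists j => //.
  rewrite /Ye; case: (nth p0 es j) Pp => S Y [_ dY _ ZY] h' h'P.
  have Yx : Y (vcat val (g' \o t' m)) by apply: contrapT => nY; apply: nZ;
    rewrite ZY.
  have := iffLR (aut_dfn _ ag dY) Yx; congr (Y _); apply/funext => -[x|j'] /=;
    last by rewrite g'g.
  rewrite -h'P; exact: (congr1 (fun f => f (h' x)) gD).
have hEx j : (j < size es)%N -> exists h' : projT1 (nth p0 es j) -> V,
    forall x, D (h' x) = val x.
  move=> jl; have /choice[h' h'P] : forall x : projT1 (nth p0 es j), exists e :
    E, val e = val x.
    move=> x; have Ex : E (val x).
      exists (projT1 (nth p0 es j)); last exact/set_mem/valP.
      by apply: (map_In (fun p : ent => projT1 p)); exact: In_nth.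
    by exists (SigSub (mem_set Ex)).
  by exists (fun x => inr (inr (h' x))).
have [U [UU Uc]] := nonprincipal_ultra.
(* For fixed [k], a failure would give one [j] and infinitely many [t' m] satisfying the same
   instance of [Ye j], contrary to the choice of [t]. *)
have UZ k : U [set m | exists2 i, (i < size lz)%N & Zx i (vcat (t' m) (s2 k))].
  apply: contrapT => /(iffRL (ultraN _ UU)) nU.
  have : U [set m | exists2 j, (j < size es)%N & forall h' :
    projT1 (nth p0 es j) -> V,
      (forall x, D (h' x) = val x) -> Ye j (vcat (s2 k \o h') (t' m))].
    by apply: filterS nU => m nm; have [] := cover m k.
  move=> /ultra_exists[j jl /(ultra_increasing UU Uc)[u iu uP]].
  have [h' h'P] := hEx j jl.
  have [dY _ _ _] := rowsbP j jl.
  have [g ag gt] := conjugate_sym (it u iu).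
  have [q' [aq' qq' q'q]] := aut_inv aq.
  apply: (tinc j (g \o (q \o (s2 k \o h'))) jl) => n.
  have := iffLR (aut_dfn _ (aut_comp ag aq) dY) (uP n h' h'P); congr (Ye j _).
  apply/funext => -[x|x] //=.
  have := congr1 (fun f => f (u n, x)) qt; rewrite /concat /= => ->.
  exact: (congr1 (fun f => f (n, x)) gt).
have dZx : definable A [set v | exists2 i, (i < size lz)%N & Zx i v].
  have [n nlz] : exists n, n = size lz by exists (size lz).
  rewrite -nlz; have : (n <= size lz)%N by rewrite nlz.
  elim: n {nlz} => [|n IH] nl; first by apply:
    definable_ext (definableN (definableT A _)) => v; split=> // -[].
  have [dn _ _ _] := rowsP n nl.
  apply: definable_ext (definableU dn (IH (ltnW nl))) => v;
    split=> [[Zn|[i ni Zi]]|[i]].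
  - by exists n.
  - by exists i => //; exact: ltnW.
  - by rewrite ltnS leq_eqVlt => /predU1P[->|ni] Zi; [left|right; exists i].
(* For finitely many [k] a single [t' m] works; compactness provides one [x] for all [k]. *)
have [x xP] : exists x, forall k, [set v | exists2 i, (i < size lz)%N &
  Zx i v] (vcat x (s2 k)).
  apply: (compactness_seq hM sJ sV sA dZx) => n.
  have Un : U (cap_list [seq [set m | exists2 i, (i < size lz)%N &
    Zx i (vcat (t' m) (s2 k))] | k <- iota 0 n]).
    by apply: filter_cap => X Xl; have [k _ ->] := In_map Xl; exact: UZ.
  have [m mP] := filter_ex Un; exists (t' m) => k kn'.
  apply: (mP _ (map_In (fun k => [set m | exists2 i, (i < size lz)%N &
    Zx i (vcat (t' m) (s2 k))]) _)).
  by apply/InP; rewrite mem_iota.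
have : U [set k | exists2 i, (i < size lz)%N & Zx i (vcat x (s2 k))].
  by apply: (@filterE _ U).
(* One of the finitely many formulas holds at [x] for infinitely many [k], contrary to the choice of
   [s]. *)
move=> /ultra_exists[i il /(ultra_increasing UU Uc)[u iu uP]].
have [g ag gs] := conjugate_sym (is2 u iu).
have [r' [ar' rr' r'r]] := aut_inv ar.
have [dZi _ _ _] := rowsP i il.
apply: (sinc i (r' \o (g \o x)) il) => n.
have := iffLR (aut_dfn _ (aut_comp ar' ag) dZi) (uP n); congr (Zx i _).
apply/funext => -[y|y] //=.
have := congr1 (fun f => f (n, y)) gs; rewrite /concat /= => ->.
by rewrite /s2 /= rr'.
Qed.

End Pair.
End Equivalence.

Theorem theorem3p7 (L : language) (T : set (sentence L))
  (hT : complete_theory T) (hdep : dependent T)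
  (kappa : Type) (M : structure L) (hM : monster T kappa M)
  (I J : Type) (hI : small kappa [set: I]) (hJ : small kappa [set: J])
  (a : I -> M) (b : J -> M)
  (A : set M) (hA : small kappa A) (hbase : extension_base kappa A) :
  [<-> strict_nonforking kappa A a b;
       strictly_independent kappa A (pair_family (MTuple a) (MTuple b));
       half_strictly_independent kappa A (pair_family (MTuple b) (MTuple a));
       strict_nonforking kappa A b a].
Proof.
have /smallTE sI := hI; have /smallTE sJ := hJ.
(* Stated for any two tuples: it leads from (3) to (4) and, with [a] and [b] exchanged, closes the
   cycle from (4) to (1). *)
have half_strict K K' (x : K -> M) (y : K' -> M) : small_type kappa K ->
  small_type kappa K' ->
    half_strictly_independent kappa A (pair_family (MTuple y) (MTuple x)) ->
    strict_nonforking kappa A y x.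
  move=> sK sK' /(half_strictly_strict_type hM hdep hA hbase sK sK')[F].
  exact: (strict_type_nonforking hM hA sK').
tfae.
- exact: (strict_nonforking_independent hM hdep hA sI sJ).
- exact: strictly_half_strictly.
- exact: half_strict.
- move=> /(strict_nonforking_independent hM hdep hA sJ
    sI)/strictly_half_strictly.
  exact: half_strict.
Qed.
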